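(* Let $(a,b)\subset\mathbb{R}$ be a finite interval, $m,n\in\mathbb{N}$, $\varepsilon_0>0$. For each $\varepsilon\in[0,\varepsilon_0)$ let $A(\cdot;\varepsilon)\in (W^{n-1}_\infty)^{m\times m}$ and let $B(\varepsilon)\colon (W^n_\infty)^m\to\mathbb{C}^m$ be a bounded linear operator, and consider the family of boundary-value problems $$y'(t;\varepsilon)+A(t;\varepsilon)y(t;\varepsilon)=f(t;\varepsilon),\ t\in(a,b),\qquad B(\varepsilon)y(\cdot;\varepsilon)=c(\varepsilon),$$ with $f(\cdot;\varepsilon)\in (W^{n-1}_\infty)^m$, $c(\varepsilon)\in\mathbb{C}^m$. The solution of this problem continuously depends on the parameter $\varepsilon$ at $\varepsilon=0$ (in the sense defined in the context) if and only if the following three conditions hold: (0) the homogeneous problem $y'(t)+A(t;0)y(t)=0$ for $t\in(a,b)$, $B(0)y=0$ has only the trivial solution $y=0$ in $(W^n_\infty)^m$; (I) $A(\cdot;\varepsilon)\to A(\cdot;0)$ in $(W^{n-1}_\infty)^{m\times m}$ as $\varepsilon\to0+$; (II) $B(\varepsilon)y\to B(0)y$ in $\mathbb{C}^m$ as $\varepsilon\to0+$ for every $y\in(W^n_\infty)^m$.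
   Context: For an integer $k\ge0$, $W^k_\infty=W^k_\infty([a,b];\mathbb{C})$ is the Sobolev space of complex functions on $[a,b]$ whose derivatives up to order $k$ (in the sense of absolute continuity of the lower ones) are essentially bounded, with norm $\|y\|_{k,\infty}=\sum_{j=0}^k\|y^{(j)}\|_{L_\infty}$; $W^0_\infty=L_\infty$. $(W^k_\infty)^m$ and $(W^k_\infty)^{m\times m}$ denote the spaces of vector/matrix functions with components in $W^k_\infty$, normed componentwise. A solution of the problem is a $y(\cdot;\varepsilon)\in (W^n_\infty)^m$ satisfying the differential equation almost everywhere on $(a,b)$ and the boundary condition. Definition: the solution of the problem continuously depends on $\varepsilon$ at $\varepsilon=0$ if ($\ast$) there exists $\varepsilon_1\in(0,\varepsilon_0)$ such that for every $\varepsilon\in[0,\varepsilon_1)$ and all $f(\cdot;\varepsilon)\in(W^{n-1}_\infty)^m$, $c(\varepsilon)\in\mathbb{C}^m$ the problem has a unique solution $y(\cdot;\varepsilon)\in(W^n_\infty)^m$; and ($\ast\ast$) whenever $f(\cdot;\varepsilon)\to f(\cdot;0)$ in $(W^{n-1}_\infty)^m$ and $c(\varepsilon)\to c(0)$ in $\mathbb{C}^m$ as $\varepsilon\to0+$, the corresponding solutions satisfy $y(\cdot;\varepsilon)\to y(\cdot;0)$ in $(W^n_\infty)^m$ as $\varepsilon\to0+$. *)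

(* Defs.v *)
From HB Require Import structures.
From mathcomp Require Import all_boot all_order all_algebra.
From mathcomp Require Import complex.
From mathcomp Require Import all_classical all_reals all_analysis.
From mathcomp Require Import ess_sup_inf.
Set Implicit Arguments. Unset Strict Implicit. Unset Printing Implicit Defensive.
Import Order.TTheory GRing.Theory Num.Theory.
Import numFieldNormedType.Exports.
Local Open Scope classical_set_scope.
Local Open Scope ring_scope.

Definition cabs (R : realType) (z : R[i]) : R := Normc.normc z.

(* norm on C^m (sum of moduli of the components; any norm gives the same
   topology) *)
Definition cvnorm (R : realType) (m : nat) (v : 'cV[R[i]]_m) : R :=
  \sum_(i < m) cabs (v i 0).

Definition esssup_ab (R : realType) (a b : R) (h : R -> R[i]) : \bar R :=
  ess_sup (@lebesgue_measure R)
    (fun t => ((if t \in `[a, b] then cabs (h t) else 0) : R)%:E).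

(* [Wrep a b k y g] : g 0, g 1, ..., g k are the derivatives of order 0..k of
   y on [a,b] in the sense of W^k_oo: g 0 = y on [a,b]; for j < k, g j is
   absolutely continuous on [a,b] with derivative g (j+1), i.e.
   g j t = g j a + \int_a^t g (j+1) (real and imaginary parts) with g (j+1)
   Lebesgue integrable; all g j measurable and g k essentially bounded. *)
Definition Wrep (R : realType) (a b : R) (k : nat) (y : R -> R[i])
    (g : nat -> R -> R[i]) : Prop :=
  [/\ (forall t, a <= t <= b -> g 0%N t = y t),
      (forall j, (j <= k)%N ->
         measurable_fun `[a, b] (fun t => complex.Re (g j t)) /\
         measurable_fun `[a, b] (fun t => complex.Im (g j t))),
      (forall j, (j < k)%N ->
         [/\ (@lebesgue_measure R).-integrable `[a, b]
               (fun t => (complex.Re (g j.+1 t))%:E),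
             (@lebesgue_measure R).-integrable `[a, b]
               (fun t => (complex.Im (g j.+1 t))%:E) &
             forall t, a <= t <= b ->
               ((complex.Re (g j t) - complex.Re (g j a))%:E =
                  \int[@lebesgue_measure R]_(s in `[a, t]) (complex.Re (g j.+1 s))%:E)%E
               /\
               ((complex.Im (g j t) - complex.Im (g j a))%:E =
                  \int[@lebesgue_measure R]_(s in `[a, t]) (complex.Im (g j.+1 s))%:E)%E])
    & (esssup_ab a b (g k) < +oo)%E ].

Definition inW (R : realType) (a b : R) (k : nat) (y : R -> R[i]) : Prop :=
  exists g, Wrep a b k y g.

(* the derivatives of y (chosen representatives; they are unique a.e.) *)
Definition Wder (R : realType) (a b : R) (k : nat) (y : R -> R[i]) :
    nat -> R -> R[i] :=
  match pselect (inW a b k y) with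
  | left h => projT1 (cid h)
  | right _ => fun _ _ => 0
  end.

Definition Wnorm (R : realType) (a b : R) (k : nat) (y : R -> R[i]) : R :=
  \sum_(j < k.+1) fine (esssup_ab a b (Wder a b k y j)).

Definition inWv (R : realType) (a b : R) (k m : nat)
    (y : R -> 'cV[R[i]]_m) : Prop :=
  forall i, inW a b k (fun t => y t i 0).

Definition Wnormv (R : realType) (a b : R) (k m : nat)
    (y : R -> 'cV[R[i]]_m) : R :=
  \sum_(i < m) Wnorm a b k (fun t => y t i 0).

Definition inWm (R : realType) (a b : R) (k m : nat)
    (A : R -> 'M[R[i]]_m) : Prop :=
  forall i j, inW a b k (fun t => A t i j).

Definition Wnormm (R : realType) (a b : R) (k m : nat)
    (A : R -> 'M[R[i]]_m) : R :=
  \sum_(i < m) \sum_(j < m) Wnorm a b k (fun t => A t i j).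

Definition Wderv1 (R : realType) (a b : R) (n m : nat)
    (y : R -> 'cV[R[i]]_m) : R -> 'cV[R[i]]_m :=
  fun t => \col_i (Wder a b n (fun s => y s i 0) 1%N t).

(* L : (W^n_oo)^m -> C^m is a bounded linear operator (L is given as a map on
   all functions, only its restriction to (W^n_oo)^m matters) *)
Definition bounded_linear_W (R : realType) (a b : R) (n m : nat)
    (L : (R -> 'cV[R[i]]_m) -> 'cV[R[i]]_m) : Prop :=
  (forall (alpha : R[i]) y z, inWv a b n y -> inWv a b n z ->
     L (fun t => alpha *: y t + z t) = alpha *: L y + L z) /\
  exists K : R, forall y, inWv a b n y -> cvnorm (L y) <= K * Wnormv a b n y.

Definition is_solution (R : realType) (a b : R) (n m : nat)
    (A : R -> 'M[R[i]]_m) (L : (R -> 'cV[R[i]]_m) -> 'cV[R[i]]_m)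
    (f : R -> 'cV[R[i]]_m) (c : 'cV[R[i]]_m) (y : R -> 'cV[R[i]]_m) : Prop :=
  [/\ inWv a b n y,
      (\forall t \ae (@lebesgue_measure R),
         a < t < b -> Wderv1 a b n y t + A t *m y t = f t)
    & L y = c].

Definition cont_dep_at0 (R : realType) (a b : R) (n m : nat) (eps0 : R)
    (A : R -> R -> 'M[R[i]]_m)
    (L : R -> (R -> 'cV[R[i]]_m) -> 'cV[R[i]]_m) : Prop :=
  exists eps1 : R, 0 < eps1 < eps0 /\
  (forall e, 0 <= e < eps1 ->
     forall (f : R -> 'cV[R[i]]_m) (c : 'cV[R[i]]_m), inWv a b n.-1 f ->
       exists y, is_solution a b n (A e) (L e) f c y /\
         forall z, is_solution a b n (A e) (L e) f c z ->
           forall t, a <= t <= b -> z t = y t) /\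
  (forall (f : R -> R -> 'cV[R[i]]_m) (c : R -> 'cV[R[i]]_m)
          (y : R -> R -> 'cV[R[i]]_m),
     (forall e, 0 <= e < eps1 ->
        inWv a b n.-1 (f e) /\ is_solution a b n (A e) (L e) (f e) (c e) (y e)) ->
     (fun e => Wnormv a b n.-1 (fun t => f e t - f 0 t)) @ 0^'+ --> (0 : R) ->
     (fun e => cvnorm (c e - c 0)) @ 0^'+ --> (0 : R) ->
     (fun e => Wnormv a b n (fun t => y e t - y 0 t)) @ 0^'+ --> (0 : R)).

(* Main.v *)
(* Up to equality on [a, b], W^(k+1) is the set of functions c + \int_a^t g with
   g in W^k, and its norm is the essential supremum of the function plus the
   norm of g in W^k; all properties of the scale (Banach algebra, completeness)
   follow by induction on k.

   A fundamental matrix X of y' + A(.;0) y = 0 and its inverse, the solution of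
   Z' = Z A, give the a priori bound
     |y|_(k+1) <= K (|y' + A(.;0) y|_k + |y(a)|),
   which survives small perturbations of A. By uniform boundedness the norms of
   B(e) are bounded near e = 0, so y(a) can be recovered from B(e) y through the
   matrix B(e) X, invertible for small e by (0) and (II); the resulting bound
     |y|_(k+1) <= K (|y' + A(.;e) y|_k + |B(e) y|),
   applied to y(.;e) - y(.;0), yields sufficiency.

   Conversely, let Y(e) solve Y' + A(.;e) Y = 0, B(e) Y = I. Then Y(e) -> Y(0)
   and A(.;e) = - Y'(e) Y(e)^-1, whence (I). For (II), let z(e) solve
   z' + A(.;e) z = y' + A(.;e) y, B(e) z = B(0) y; then z(e) -> y, and
   y - z(e) = Y(e) (B(e) y - B(0) y). *)

Require Import Defs.
From HB Require Import structures.
From mathcomp Require Import all_boot all_order all_algebra.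
From mathcomp Require Import complex.
From mathcomp Require Import all_classical all_reals all_analysis.
From mathcomp Require Import ess_sup_inf measurable_realfun.
From mathcomp Require Import ring lra.
Set Implicit Arguments. Unset Strict Implicit. Unset Printing Implicit Defensive.
Import Order.TTheory GRing.Theory Num.Theory.
Import numFieldNormedType.Exports.
Local Open Scope classical_set_scope.
Local Open Scope ring_scope.

(** * Primitives of essentially bounded functions *)

Section real_primitive.
Context (R : realType) (a b : R) (hab : a < b).
Local Notation mu := (@lebesgue_measure R).

(** The derivatives in [Wder] are chosen representatives, determined only almost everywhere, and the
    functions live on all of R, so every norm is a seminorm that sees [a, b] alone. Hence the work
    is done with primitives: the differential equation becomes an integral identity valid at each
    point of [a, b], and the uniqueness of derivatives serves to translate the definitions into this
    language. Completeness is used in a single form, for series whose j-th term is bounded by C /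
    2^j; it yields both the solutions of Cauchy problems and the limit in the gliding-hump argument.
    In the estimates for e -> 0 only matrices belonging to e = 0 are inverted. The inverses of B(e)
    X and of Y(e) are never bounded: the terms that measure the distance to e = 0 carry a small
    factor and are absorbed into the left-hand side, which is where the thresholds 1/2 and 1/4 come
    from. *)

Definition ess_bdd (f : R -> R) : Prop :=
  measurable_fun `[a, b] f /\
  exists M : R, \forall t \ae mu, a <= t <= b -> `|f t| <= M.

Definition prim (f : R -> R) (t : R) : R := (\int[mu]_(s in `[a, t]) f s)%R.

Lemma lebesgue_measure_cc (s t : R) : s <= t -> mu `[s, t]%classic = (t - s)%:E.
Proof.
move=> st; rewrite lebesgue_measure_itv/= lte_fin; case: ltgtP st => //.
by move=> -> _; rewrite subrr.
Qed.

Lemma ae_mono (P Q : R -> Prop) : (forall t, P t -> Q t) ->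
  (\forall t \ae mu, P t) -> \forall t \ae mu, Q t.
Proof. by move=> PQ; apply: (@filterS _ _ (ae_filter_ringOfSetsType mu)). Qed.

Lemma ae_and (P Q : R -> Prop) : (\forall t \ae mu, P t) ->
  (\forall t \ae mu, Q t) -> \forall t \ae mu, P t /\ Q t.
Proof. by move=> hP hQ; apply: (@filterI _ _ (ae_filter_ringOfSetsType mu)). Qed.

Lemma ae_itv_sub (P : R -> Prop) s t : a <= s -> t <= b ->
  (\forall x \ae mu, a <= x <= b -> P x) -> \forall x \ae mu, s <= x <= t -> P x.
Proof.
move=> as_ tb; apply: ae_mono => x h /andP[sx xt].
by apply: h; rewrite (le_trans as_ sx) (le_trans xt tb).
Qed.

Lemma ess_bdd_integrable f : ess_bdd f -> mu.-integrable `[a, b] (EFin \o f).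
Proof.
move=> [mf [M hM]]; apply/integrableP; split; first exact/measurable_EFinP.
apply: le_lt_trans.
  apply: (@integral_le_bound _ _ _ mu _ _ (`|M|)%:E) => //.
  - exact/measurable_EFinP.
  - apply: ae_mono hM => t h /=; rewrite in_itv/= => /h h'.
    by rewrite lee_fin (le_trans h')// ler_norm.
by rewrite [X in (_ * X)%E](lebesgue_measure_cc (ltW hab)) -EFinM ltry.
Qed.

Lemma ess_bdd_integrable_sub f A : ess_bdd f -> measurable A -> A `<=` `[a, b] ->
  mu.-integrable A (EFin \o f).
Proof. by move=> /ess_bdd_integrable hf mA sub; apply: integrableS hf. Qed.

Lemma subset_itv_cc (s t : R) : a <= s -> t <= b -> `[s, t] `<=` `[a, b].
Proof.
move=> ha hb x /=; rewrite !in_itv/= => /andP[h1 h2].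
by rewrite (le_trans ha h1) (le_trans h2 hb).
Qed.

Lemma subset_itv_oc (s t : R) : a <= s -> t <= b -> `]s, t] `<=` `[a, b].
Proof.
move=> ha hb x /=; rewrite !in_itv/= => /andP[/ltW h1 h2].
by rewrite (le_trans ha h1) (le_trans h2 hb).
Qed.

Lemma primD f g t : ess_bdd f -> ess_bdd g -> t <= b ->
  prim (fun s => f s + g s) t = prim f t + prim g t.
Proof.
move=> hf hg tb; rewrite /prim RintegralD//;
  by apply: ess_bdd_integrable_sub => //; apply: subset_itv_cc.
Qed.

Lemma primZ c f t : ess_bdd f -> t <= b ->
  prim (fun s => c * f s) t = c * prim f t.
Proof.
move=> hf tb; rewrite /prim RintegralZl//;
  by apply: ess_bdd_integrable_sub => //; apply: subset_itv_cc.
Qed.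

Lemma prim_diff f s t : ess_bdd f -> a <= s -> s <= t -> t <= b ->
  prim f t - prim f s = \int[mu]_(x in `]s, t]) f x.
Proof.
move=> hf sa st tb; rewrite /prim Rintegral_itvB ?bnd_simp//.
by apply: ess_bdd_integrable_sub => //; apply: subset_itv_cc.
Qed.

Lemma prim_ae f g t : measurable_fun `[a, b] f -> measurable_fun `[a, b] g ->
  (\forall t \ae mu, a <= t <= b -> f t = g t) -> t <= b -> prim f t = prim g t.
Proof.
move=> mf mg fg tb; rewrite /prim /Rintegral; congr fine.
have sub : `[a, t] `<=` `[a, b] by apply: subset_itv_cc.
apply: ae_eq_integral => //.
- by apply/measurable_EFinP; apply: measurable_funS mf.
- by apply/measurable_EFinP; apply: measurable_funS mg.
by apply: ae_mono fg => x h xt; rewrite h//; move/sub: xt; rewrite /= in_itv.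
Qed.

Lemma prim_le f g s t : ess_bdd f -> ess_bdd g ->
  (\forall x \ae mu, s <= x <= t -> `|f x| <= g x) -> a <= s -> s <= t -> t <= b ->
  `|prim f t - prim f s| <= prim g t - prim g s.
Proof.
move=> hf hg fg sa st tb; rewrite !prim_diff//.
have sub : `]s, t] `<=` `[a, b] by apply: subset_itv_oc.
have fg' : \forall x \ae mu, `]s, t]%classic x -> `|f x| <= g x.
  by apply: ae_mono fg => x h; rewrite /= in_itv/= => /andP[/ltW sx xt]; rewrite h// sx.
have iF : mu.-integrable `]s, t] (EFin \o f) by apply: ess_bdd_integrable_sub.
have iG : mu.-integrable `]s, t] (EFin \o g) by apply: ess_bdd_integrable_sub.
have iN : mu.-integrable `]s, t] (EFin \o (fun x => `|f x|)).
  by have := integrable_abse iF; apply: eq_integrable.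
rewrite (le_trans (le_normr_Rintegral _ iF))//.
rewrite /Rintegral fine_le ?integrable_fin_num//.
rewrite (@ae_eq_integral _ _ _ mu `]s, t] (fun x => (`|g x|)%:E) (fun x => (g x)%:E))//.
- apply: ae_ge0_le_integral => //.
  + by case/integrableP: iN.
  + by have /integrableP[] := integrable_abse iG.
  + by apply: ae_mono fg' => x h /h h'; rewrite lee_fin (le_trans h')// ler_norm.
- by case/integrableP: iG.
- by have /integrableP[] := integrable_abse iG.
apply: ae_mono fg' => x h /h h'.
by rewrite ger0_norm// (le_trans _ h').
Qed.

Lemma ess_bdd_cst c : ess_bdd (fun _ => c).
Proof.
by split; [exact: measurable_cst | exists `|c|; apply: aeW => /= t _].
Qed.

Lemma prim_cst c t : a <= t -> prim (fun _ => c) t = c * (t - a).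
Proof. by move=> at_; rewrite /prim Rintegral_cst//= [X in fine X](lebesgue_measure_cc at_). Qed.

Lemma prim_start f : prim f a = 0.
Proof. by rewrite /prim set_itv1 Rintegral_set1. Qed.

Lemma prim_lip f M s t : ess_bdd f ->
  (\forall x \ae mu, s <= x <= t -> `|f x| <= M) -> a <= s -> s <= t -> t <= b ->
  `|prim f t - prim f s| <= M * (t - s).
Proof.
move=> hf hM sa st tb.
have := prim_le hf (ess_bdd_cst M) hM sa st tb.
rewrite !prim_cst ?(le_trans sa)// => /le_trans; apply.
by rewrite -mulrBr opprB addrA subrK.
Qed.

(** Lebesgue differentiation, applied to the extension of [f] by zero: its integral from -oo
    vanishes identically. *)
Lemma prim_eq0_ae f : ess_bdd f -> (forall t, a <= t <= b -> prim f t = 0) ->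
  \forall t \ae mu, a <= t <= b -> f t = 0.
Proof.
move=> hf h0.
pose g := f \_ `[a, b].
have ig : mu.-integrable [set: R] (EFin \o g).
  rewrite /g -restrict_EFin; apply/integrable_restrict => //=.
  by rewrite setTI; exact: ess_bdd_integrable.
have F0 : (fun x => \int[mu]_(t in [set` `]-oo, x]]) g t) = cst 0.
  apply/funext => x /=.
  have -> : \int[mu]_(t in `]-oo, x]) g t = \int[mu]_(t in `]-oo, x] `&` `[a, b]) f t.
    by rewrite Rintegral_mkcondr.
  have [xb|bx] := leP x b.
    have -> : `]-oo, x] `&` `[a, b] = `[a, x]%classic.
      apply/seteqP; split=> y /=; rewrite !in_itv/=; first by case=> -> /andP[->].
      by move=> /andP[-> yx]; rewrite yx (le_trans yx xb).
    have [ax|xa] := leP a x; first by have := h0 x; rewrite /prim ax xb => ->.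
    by rewrite set_itv_ge ?Rintegral_set0// bnd_simp -ltNge.
  have -> : `]-oo, x] `&` `[a, b] = `[a, b]%classic.
    apply/setIidr => y /=; rewrite !in_itv/= => /andP[_ yb].
    by rewrite (le_trans yb (ltW bx)).
  by have := h0 b; rewrite /prim lexx (ltW hab) => ->.
have := @FTC1Ny R g _ (open_integrable_locally openT ig).
rewrite F0 => H.
have /H : forall y, mu.-integrable `]-oo, y] (EFin \o g).
  by move=> y; apply: integrableS ig.
apply: ae_mono => x [_]; rewrite derive1_cst /g => hx /andP[ax xb].
by move: hx; rewrite patchE mem_set//= in_itv/= ax xb.
Qed.

(** Such a function is continuous on [a, b]. This makes primitives measurable, so that they can be
    multiplied and integrated again. *)
Lemma lip_measurable (f : R -> R) M :
  (forall s t, a <= s -> s <= t -> t <= b -> `|f t - f s| <= M * (t - s)) ->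
  measurable_fun `[a, b] f.
Proof.
move=> hf; apply: subspace_continuous_measurable_fun => //.
apply/continuous_within_itvP => //.
have M0 : 0 <= M.
  have := hf a b (lexx _) (ltW hab) (lexx _); have := normr_ge0 (f b - f a).
  by move=> h1 h2; have := le_trans h1 h2; rewrite pmulr_lge0// subr_gt0.
have key x y : a <= x <= b -> a <= y <= b -> `|f x - f y| <= M * `|x - y|.
  move=> /andP[ax xb] /andP[ay yb]; have [xy|/ltW yx] := leP x y.
    by rewrite distrC [`|x - y|]distrC [`|y - x|]ger0_norm ?subr_ge0// hf.
  by rewrite [`|x - y|]ger0_norm ?subr_ge0// hf.
have E0 (e : R) : 0 < e -> 0 < e / (M + 1) by move=> e0; rewrite divr_gt0// ltr_wpDl.
have E1 (e d : R) : 0 < e -> 0 <= d -> d < e / (M + 1) -> M * d < e.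
  move=> e0 d0 h; apply: (@le_lt_trans _ _ ((M + 1) * d)); first by rewrite ler_wpM2r// lerDl.
  by rewrite mulrC -ltr_pdivlMr// ltr_wpDl.
split.
- move=> x; rewrite in_itv/= => /andP[ax xb]; apply/cvgrPdist_lt => e e0.
  near=> y; apply: le_lt_trans (key x y _ _) _.
  + by rewrite (ltW ax) (ltW xb).
  + apply/andP; split; near: y; [exact: lt_le_nbhsr|exact: lt_le_nbhsl].
  apply: E1 => //; near: y; apply: cvgr_dist_lt; [exact: cvg_id|exact: E0].
- apply/cvgrPdist_lt => e e0; near=> y; apply: le_lt_trans (key a y _ _) _.
  + by rewrite lexx ltW.
  + by apply/andP; split; near: y; [exact: nbhs_right_ge|exact: nbhs_right_le].
  apply: E1 => //; near: y.
  have := @nbhs_right_lt R a (a + e / (M + 1)).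
  rewrite ltrDl E0// => /(_ isT) h.
  near=> y; rewrite distrC ger0_norm ?subr_ge0; last by near: y; exact: nbhs_right_ge.
  by rewrite ltrBlDl; near: y.
- apply/cvgrPdist_lt => e e0; near=> y; apply: le_lt_trans (key b y _ _) _.
  + by rewrite lexx ltW.
  + by apply/andP; split; near: y; [exact: nbhs_left_ge|exact: nbhs_left_le].
  apply: E1 => //; near: y.
  near=> y; rewrite ger0_norm ?subr_ge0; last by near: y; exact: nbhs_left_le.
  rewrite ltrBlDl -ltrBlDr; near: y; apply: nbhs_left_gt.
  by rewrite ltrBlDr ltrDl E0.
Unshelve. all: by end_near. Qed.

Lemma ess_bdd_exp (k M : R) : ess_bdd (fun t => M * expR (k * t)).
Proof.
split.
  apply: measurable_funM => //; apply: measurableT_comp => //.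
exists (`|M| * expR (`|k| * (`|a| + `|b|))); apply: aeW => t /andP[at_ tb].
rewrite normrM ler_wpM2l// ger0_norm ?expR_ge0// ler_expR.
rewrite (le_trans (ler_norm _))// normrM ler_wpM2l//.
by rewrite ler_norml; have := ler_norm a; have := ler_norm b;
  have := ler_norm (- a); have := ler_norm (- b); rewrite !normrN; lra.
Qed.

(** The exact integral is a difference of two values of [F]; the nonnegative one at [a] is
    dropped. *)
Lemma prim_exp (k M t : R) : 0 < k -> 0 <= M -> a <= t -> t <= b ->
  prim (fun t => M * expR (k * t)) t <= M * expR (k * t) / k.
Proof.
move=> k0 M0; rewrite le_eqVlt => /predU1P[<- _|at_ tb].
  by rewrite prim_start divr_ge0 ?mulr_ge0 ?expR_ge0// ltW.
pose F x := M / k * expR (k * x).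
have dF x : is_derive x (1:R) F (M * expR (k * x)).
  rewrite /F; apply: is_derive_eq.
  by rewrite /GRing.scale/= mulr1 mulrC -mulrA [k * (M / k)]mulrC divfK ?gt_eqF// mulrC.
have cf (f : R -> R) x : is_derive x (1:R) F (f x) -> {for x, continuous F}.
  by move=> h; apply: differentiable_continuous; apply/derivable1_diffP; exact: ex_derive.
have := @continuous_FTC2 R (fun x => M * expR (k * x)) F a t at_ _ _ _.
rewrite /prim /Rintegral => -> //.
- rewrite /= /F mulrAC -[M * _ / k]mulrAC.
  by rewrite gerBl mulr_ge0 ?expR_ge0// divr_ge0// ltW.
- apply: continuous_subspaceT => x.
  apply: cvgM; first exact: cvg_cst.
  apply: continuous_comp; last exact: continuous_expR.
  by apply: cvgM; [exact: cvg_cst|exact: cvg_id].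
- split.
  + by move=> x _; exact: ex_derive.
  + by apply: cvg_at_right_filter; exact: (cf (fun x => M * expR (k * x))).
  + by apply: cvg_at_left_filter; exact: (cf (fun x => M * expR (k * x))).
- by move=> x _; rewrite derive1E; exact: derive_val.
Qed.

(** The partial sums telescope against 2C / 2^k - 2C / 2^(k+n), so the limit comes with an explicit
    rate. *)
Lemma geometric_series_lim (r : nat -> R) (C : R) :
  (forall j, `|r j| <= C / 2 ^+ j) ->
  exists l, forall k, `|l - \sum_(j < k) r j| <= 2 * C / 2 ^+ k.
Proof.
move=> hr.
have C0 : 0 <= C by have := le_trans (normr_ge0 _) (hr 0%N); rewrite expr0 divr1.
have tail k n : `|\sum_(j < k + n) r j - \sum_(j < k) r j| <= 2 * C / 2 ^+ k - 2 * C / 2 ^+ (k + n).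
  elim: n => [|n IH]; first by rewrite addn0 !subrr normr0.
  rewrite addnS big_ord_recr/= addrAC (le_trans (ler_normD _ _))//.
  have := hr (k + n)%N; move: IH; rewrite exprS invfM.
  set x := `|_ - _|; set y := `|r _|; set z := (2 ^+ (k + n))^-1; set w := _ / 2 ^+ k => h1 h2.
  apply: (le_trans (lerD h1 h2)); rewrite -subr_ge0 le_eqVlt; apply/orP; left; apply/eqP.
  by field.
pose S := [sequence \sum_(j < n) r j]_n.
have c2 : (fun n => 2 * C / 2 ^+ n) @ \oo --> (0 : R).
  rewrite -(mulr0 (2 * C)); apply: cvgM; first exact: cvg_cst.
  under eq_fun do rewrite -exprVn; apply: cvg_expr.
  by rewrite ger0_norm ?invr_ge0// invf_lt1// ltr1n.
have tail' k n : (k <= n)%N -> `|S n - S k| <= 2 * C / 2 ^+ k.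
  move=> kn; have := tail k (n - k)%N; rewrite subnKC// => /le_trans; apply.
  by rewrite gerBl divr_ge0 ?mulr_ge0 ?exprn_ge0.
have cS : cvg (S @ \oo).
  apply/cauchy_cvgP/cauchy_ballP => e e0.
  have e2 : 0 < e / 2 by rewrite divr_gt0.
  have [N _ hN] := (cvgrPdist_lt _ _).1 c2 _ e2.
  exists (S @` [set n | (N <= n)%N], S @` [set n | (N <= n)%N]).
    by split; exists N => // n hn; exists n.
  move=> [_ _] [[i /= iN <-] [k /= kN <-]]; rewrite /ball/= /ball_/=.
  have := hN N (leqnn _); rewrite sub0r normrN ger0_norm ?divr_ge0 ?mulr_ge0 ?exprn_ge0// => hNe.
  have -> : S i - S k = (S i - S N) - (S k - S N) by rewrite opprB addrA subrK.
  by rewrite (le_lt_trans (ler_normB _ _))// [ltRHS]splitr ltrD// (le_lt_trans (tail' _ _ _)).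
exists (lim (S @ \oo)) => k.
have : (fun n => `|S n - S k|) @ \oo --> `|lim (S @ \oo) - S k|.
  by apply: cvg_norm; apply: cvgB => //; exact: cvg_cst.
move=> h; rewrite -(cvg_lim _ h)//; apply: limr_le; first by apply/cvg_ex; eexists; exact: h.
by near=> n; apply: tail'; near: n; exists k.
Unshelve. all: by end_near. Qed.

Lemma geometric_bound_cvg (S : nat -> R) (l C : R) :
  (forall k, `|l - S k| <= C / 2 ^+ k) -> S @ \oo --> l.
Proof.
move=> h.
have c2 : (fun n => C / 2 ^+ n) @ \oo --> (0 : R).
  rewrite -(mulr0 C); apply: cvgM; first exact: cvg_cst.
  under eq_fun do rewrite -exprVn; apply: cvg_expr.
  by rewrite ger0_norm ?invr_ge0// invf_lt1// ltr1n.
apply/cvgrPdist_lt => e e0.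
have [N _ hN] := (cvgrPdist_lt _ _).1 c2 _ e0.
exists N => // n /hN; rewrite sub0r normrN => h'.
by rewrite (le_lt_trans (h n))// (le_lt_trans (ler_norm _)).
Qed.

(** The bounds hold only almost everywhere. Truncating the j-th term to [-C / 2^j, C / 2^j] makes
    the series converge at every point, so the sum is a pointwise limit of measurable functions; off
    one null set the truncation changes nothing. *)
Lemma ess_bdd_series (f : nat -> R -> R) (C : R) :
  (forall j, ess_bdd (f j)) ->
  (forall j, \forall t \ae mu, a <= t <= b -> `|f j t| <= C / 2 ^+ j) ->
  exists u, ess_bdd u /\ forall k, \forall t \ae mu, a <= t <= b ->
    `|u t - \sum_(j < k) f j t| <= 2 * C / 2 ^+ k.
Proof.
move=> hf hC.
(* A negative [C] would make [a, b] a null set. *)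
have C0 : 0 <= C.
  rewrite leNgt; apply/negP => Cn.
  have [N [mN N0 sub]] := hC 0%N.
  have : mu `[a, b]%classic = 0.
    apply: (subset_measure0 _ mN _ N0) => // x; rewrite /= in_itv/= => xab.
    apply: sub => /(_ xab); rewrite expr0 divr1 => /(le_trans (normr_ge0 _)).
    by rewrite leNgt Cn.
  rewrite lebesgue_measure_cc ?ltW// => /eqP; rewrite eqe subr_eq0 => /eqP ba.
  by move: hab; rewrite ba ltxx.
pose c j := C / 2 ^+ j.
have c0 j : 0 <= c j by rewrite divr_ge0 ?exprn_ge0.
pose g j t := Num.max (Num.min (f j t) (c j)) (- c j).
have gc j t : `|g j t| <= c j.
  rewrite /g ler_norml le_max lexx orbT/= ge_max ge_min lexx orbT/=.
  by rewrite (le_trans _ (c0 j))// oppr_le0.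
have gE j t : `|f j t| <= c j -> g j t = f j t.
  by rewrite ler_norml /g => /andP[h1 h2]; rewrite (min_idPl h2) (max_idPl h1).
have /choice[u hu] : forall t, exists l, forall k, `|l - \sum_(j < k) g j t| <= 2 * C / 2 ^+ k.
  by move=> t; apply: (@geometric_series_lim (fun j => g j t)) => j; exact: gc.
have mg j : measurable_fun `[a, b] (g j).
  by apply: measurable_maxr => //; apply: measurable_minr => //; case: (hf j).
exists u; split.
  split.
    apply: (@measurable_fun_cvg _ _ _ _ (fun k t => \sum_(j < k) g j t)).
    - by move=> k; apply: measurable_sum => j; exact: mg.
    - by move=> t _; apply: geometric_bound_cvg (hu t).
  exists (2 * C); apply: aeW => t _.
  by have := hu t 0%N; rewrite big_ord0 subr0 expr0 divr1.
move=> k.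
have : \forall t \ae mu, forall j, a <= t <= b -> `|f j t| <= C / 2 ^+ j by apply/ae_foralln.
apply: ae_mono => t h tab; rewrite (eq_bigr (fun j : 'I_k => g j t)); first exact: hu.
by move=> j _; rewrite gE// h.
Qed.

End real_primitive.

(** * The modulus of complex numbers *)

Section modulus.
Context (R : realType).
Implicit Types z w : R[i].
Local Notation cRe := (@complex.Re R).
Local Notation cIm := (@complex.Im R).

Lemma cabs_ge0 z : 0 <= cabs z.
Proof. by case: z => x y; exact: sqrtr_ge0. Qed.

Lemma cabs0 : cabs (0 : R[i]) = 0.
Proof. exact: Normc.normc0. Qed.

Lemma cabs0_eq0 z : cabs z = 0 -> z = 0.
Proof. exact: Normc.eq0_normc. Qed.

Lemma cabs1 : cabs (1 : R[i]) = 1.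
Proof. exact: Normc.normc1. Qed.

Lemma cabsM z w : cabs (z * w) = cabs z * cabs w.
Proof. exact: Normc.normcM. Qed.

Lemma cabsN z : cabs (- z) = cabs z.
Proof. exact: (@normcN R). Qed.

Lemma cabsD z w : cabs (z + w) <= cabs z + cabs w.
Proof. exact: (@le_normcD R). Qed.

Lemma cabsB z w : cabs (z - w) <= cabs z + cabs w.
Proof. by rewrite -[cabs w]cabsN; exact: cabsD. Qed.

Lemma cabs_distC z w : cabs (z - w) = cabs (w - z).
Proof. by rewrite -cabsN opprB. Qed.

Lemma cabs_sum (I : Type) (r : seq I) (P : pred I) (F : I -> R[i]) :
  cabs (\sum_(i <- r | P i) F i) <= \sum_(i <- r | P i) cabs (F i).
Proof.
elim/big_ind2: _ => [|x u y v hx hy|//]; first by rewrite cabs0.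
by rewrite (le_trans (cabsD _ _))// lerD.
Qed.

Lemma cRe_cabs z : `|cRe z| <= cabs z.
Proof.
case: z => x y; rewrite /cabs /= -sqrtr_sqr ler_sqrt ?addr_ge0 ?sqr_ge0//.
by rewrite lerDl sqr_ge0.
Qed.

Lemma cIm_cabs z : `|cIm z| <= cabs z.
Proof.
case: z => x y; rewrite /cabs /= -sqrtr_sqr ler_sqrt ?addr_ge0 ?sqr_ge0//.
by rewrite lerDr sqr_ge0.
Qed.

Lemma cabs_ReIm z : cabs z <= `|cRe z| + `|cIm z|.
Proof.
case: z => x y; rewrite /cabs /= -[leRHS]ger0_norm ?addr_ge0// -sqrtr_sqr.
rewrite ler_sqrt ?sqr_ge0// sqrrD !real_normK ?num_real//.
by rewrite mulr2n; have := mulr_ge0 (normr_ge0 x) (normr_ge0 y); lra.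
Qed.

Lemma cReD z w : cRe (z + w) = cRe z + cRe w. Proof. by case: z; case: w. Qed.
Lemma cImD z w : cIm (z + w) = cIm z + cIm w. Proof. by case: z; case: w. Qed.
Lemma cReM z w : cRe (z * w) = cRe z * cRe w - cIm z * cIm w.
Proof. by case: z; case: w. Qed.
Lemma cImM z w : cIm (z * w) = cRe z * cIm w + cIm z * cRe w.
Proof. by case: z => ? ?; case: w. Qed.
Lemma cReN z : cRe (- z) = - cRe z. Proof. by case: z. Qed.
Lemma cImN z : cIm (- z) = - cIm z. Proof. by case: z. Qed.

Lemma complex_ext z w : cRe z = cRe w -> cIm z = cIm w -> z = w.
Proof. by case: z => ? ?; case: w => ? ? /= -> ->. Qed.

Lemma cRe_sum (I : Type) (r : seq I) (P : pred I) (F : I -> R[i]) :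
  cRe (\sum_(i <- r | P i) F i) = \sum_(i <- r | P i) cRe (F i).
Proof. by apply: (big_morph cRe cReD). Qed.

Lemma cIm_sum (I : Type) (r : seq I) (P : pred I) (F : I -> R[i]) :
  cIm (\sum_(i <- r | P i) F i) = \sum_(i <- r | P i) cIm (F i).
Proof. by apply: (big_morph cIm cImD). Qed.

Lemma cgeometric_series_lim (r : nat -> R[i]) (C : R) :
  (forall j, cabs (r j) <= C / 2 ^+ j) ->
  exists l, forall k, cabs (l - \sum_(j < k) r j) <= 4 * C / 2 ^+ k.
Proof.
move=> hr.
have [x hx] := geometric_series_lim (fun j => le_trans (cRe_cabs (r j)) (hr j)).
have [y hy] := geometric_series_lim (fun j => le_trans (cIm_cabs (r j)) (hr j)).
exists (x +i* y)%C => k; rewrite (le_trans (cabs_ReIm _))//.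
rewrite cReD cImD cReN cImN cRe_sum cIm_sum /=.
apply: (le_trans (lerD (hx k) (hy k))).
by rewrite -!mulrA -mulrDl -natrD.
Qed.

End modulus.

(** * Complex primitives and integration by parts *)

Section complex_primitive.
Context (R : realType) (a b : R) (hab : a < b).
Local Notation mu := (@lebesgue_measure R).
Local Notation cRe := (@complex.Re R).
Local Notation cIm := (@complex.Im R).
Implicit Types f g h : R -> R[i].

Definition Linf f : Prop :=
  [/\ measurable_fun `[a, b] (fun t => cRe (f t)),
      measurable_fun `[a, b] (fun t => cIm (f t)) &
      exists M : R, \forall t \ae mu, a <= t <= b -> cabs (f t) <= M].

Definition cprim f (t : R) : R[i] :=
  (prim a (fun s => cRe (f s)) t +i* prim a (fun s => cIm (f s)) t)%C.

Lemma Linf_Re f : Linf f -> ess_bdd a b (fun t => cRe (f t)).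
Proof.
case=> m1 m2 [M hM]; split=> //; exists M.
by apply: ae_mono hM => t h /h; exact: le_trans (cRe_cabs _).
Qed.

Lemma Linf_Im f : Linf f -> ess_bdd a b (fun t => cIm (f t)).
Proof.
case=> m1 m2 [M hM]; split=> //; exists M.
by apply: ae_mono hM => t h /h; exact: le_trans (cIm_cabs _).
Qed.

Lemma Linf_ReIm f : ess_bdd a b (fun t => cRe (f t)) ->
  ess_bdd a b (fun t => cIm (f t)) -> Linf f.
Proof.
move=> [m1 [M hM]] [m2 [N hN]]; split=> //; exists (M + N).
apply: ae_mono (ae_and hM hN) => t [h1 h2] tab.
by rewrite (le_trans (cabs_ReIm _))// lerD ?h1 ?h2.
Qed.

Lemma Linf_cst c : Linf (fun _ => c).
Proof. by apply: Linf_ReIm; exact: ess_bdd_cst. Qed.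

Lemma LinfD f g : Linf f -> Linf g -> Linf (fun t => f t + g t).
Proof.
move=> [f1 f2 [M hM]] [g1 g2 [N hN]]; split.
- under [X in measurable_fun _ X]eq_fun do rewrite cReD; exact: measurable_funD.
- under [X in measurable_fun _ X]eq_fun do rewrite cImD; exact: measurable_funD.
exists (M + N); apply: ae_mono (ae_and hM hN) => t [h1 h2] tab.
by rewrite (le_trans (cabsD _ _))// lerD ?h1 ?h2.
Qed.

Lemma LinfM f g : Linf f -> Linf g -> Linf (fun t => f t * g t).
Proof.
move=> [f1 f2 [M hM]] [g1 g2 [N hN]]; split.
- by under [X in measurable_fun _ X]eq_fun do rewrite cReM; apply: measurable_funB; exact: measurable_funM.
- by under [X in measurable_fun _ X]eq_fun do rewrite cImM; apply: measurable_funD; exact: measurable_funM.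
exists (M * N); apply: ae_mono (ae_and hM hN) => t [h1 h2] tab.
by rewrite cabsM ler_pM ?cabs_ge0 ?h1 ?h2.
Qed.

Lemma Linf_ext f g : (forall t, a <= t <= b -> f t = g t) -> Linf f -> Linf g.
Proof.
move=> fg [f1 f2 [M hM]]; split.
- apply: eq_measurable_fun f1 => t; rewrite inE/= in_itv/= => /fg ->//.
- apply: eq_measurable_fun f2 => t; rewrite inE/= in_itv/= => /fg ->//.
by exists M; apply: ae_mono hM => t h tab; rewrite -fg// h.
Qed.

Lemma cprimD f g t : Linf f -> Linf g -> t <= b ->
  cprim (fun s => f s + g s) t = cprim f t + cprim g t.
Proof.
move=> hf hg tb; apply: complex_ext; rewrite ?cReD ?cImD /=.
  under [X in prim a X]eq_fun do rewrite cReD.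
  by rewrite (primD hab)//; apply: Linf_Re.
under [X in prim a X]eq_fun do rewrite cImD.
by rewrite (primD hab)//; apply: Linf_Im.
Qed.

Lemma ess_bddZ c (f : R -> R) : ess_bdd a b f -> ess_bdd a b (fun t => c * f t).
Proof.
move=> [mf [M hM]]; split; first exact: measurable_funM.
exists (`|c| * M); apply: ae_mono hM => t h tab.
by rewrite normrM ler_wpM2l// h.
Qed.

Lemma cprimZ c f t : Linf f -> t <= b -> cprim (fun s => c * f s) t = c * cprim f t.
Proof.
move=> hf tb; have hr := Linf_Re hf; have hi := Linf_Im hf.
apply: complex_ext; rewrite ?cReM ?cImM /=.
  under [X in prim a X]eq_fun do rewrite cReM -mulNr.
  by rewrite (primD hab)// ?(primZ hab)//; try exact: ess_bddZ; rewrite mulNr.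
under [X in prim a X]eq_fun do rewrite cImM.
by rewrite (primD hab)// ?(primZ hab)//; exact: ess_bddZ.
Qed.

Lemma cprim_ae f g t : Linf f -> Linf g ->
  (\forall t \ae mu, a <= t <= b -> f t = g t) -> t <= b -> cprim f t = cprim g t.
Proof.
move=> [f1 f2 _] [g1 g2 _] fg tb; apply: complex_ext => /=; apply: (prim_ae (b := b)) => //.
  by apply: ae_mono fg => s h /h ->.
by apply: ae_mono fg => s h /h ->.
Qed.

Lemma cprim_ext f g t : (forall t, a <= t <= b -> f t = g t) -> t <= b ->
  cprim f t = cprim g t.
Proof.
move=> fg tb; rewrite /cprim /prim; congr (_ +i* _)%C; apply: eq_Rintegral => s;
  rewrite inE/= in_itv/= => /andP[as_ st]; by rewrite fg// as_ (le_trans st).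
Qed.

Lemma cprim_start f : cprim f a = 0.
Proof. by rewrite /cprim !prim_start. Qed.

Lemma cprim_cst0 t : cprim (fun _ => 0) t = 0.
Proof.
by rewrite /cprim /prim /= /Rintegral integral0.
Qed.

(** The factor 2 comes from bounding real and imaginary parts separately; it reappears in the later
    constants 2 (b - a) and 4 (b - a). *)
Lemma cprim_lip f M s t : Linf f ->
  (\forall x \ae mu, s <= x <= t -> cabs (f x) <= M) ->
  a <= s -> s <= t -> t <= b -> cabs (cprim f t - cprim f s) <= 2 * M * (t - s).
Proof.
move=> hf hM sa st tb; rewrite (le_trans (cabs_ReIm _))// cReD cImD cReN cImN /=.
rewrite -mulrA mulrDl !mul1r; apply: lerD; apply: (prim_lip hab) => //.
- exact: Linf_Re.
- by apply: ae_mono hM => x h /h; exact: le_trans (cRe_cabs _).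
- exact: Linf_Im.
- by apply: ae_mono hM => x h /h; exact: le_trans (cIm_cabs _).
Qed.

Lemma cprim_le f M t : Linf f ->
  (\forall t \ae mu, a <= t <= b -> cabs (f t) <= M) -> a <= t <= b ->
  cabs (cprim f t) <= 2 * M * (b - a).
Proof.
move=> hf hM /andP[at_ tb].
have := cprim_lip hf (ae_itv_sub (lexx a) tb hM) (lexx a) at_ tb; rewrite cprim_start subr0.
have := cprim_lip hf hM (lexx a) (ltW hab) (lexx b) => /(le_trans (cabs_ge0 _)).
rewrite pmulr_lge0 ?subr_gt0// => M0 /le_trans; apply.
by rewrite ler_wpM2l// lerB.
Qed.

Lemma cprim_exp f (k M t : R) : 0 < k -> 0 <= M -> Linf f ->
  (\forall t \ae mu, a <= t <= b -> cabs (f t) <= M * expR (k * t)) ->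
  a <= t <= b -> cabs (cprim f t) <= 2 * (M * expR (k * t) / k).
Proof.
move=> k0 M0 hf hM /andP[at_ tb]; rewrite (le_trans (cabs_ReIm _))// /=.
have key (g : R -> R) : ess_bdd a b g ->
   (\forall t \ae mu, a <= t <= b -> `|g t| <= M * expR (k * t)) ->
   `|prim a g t| <= M * expR (k * t) / k.
  move=> hg hgM; have := prim_le hab hg (ess_bdd_exp a b k M) (ae_itv_sub (lexx a) tb hgM) (lexx a) at_ tb.
  by rewrite !prim_start !subr0 => /le_trans; apply; apply: prim_exp.
rewrite mulrDl mul1r; apply: lerD; apply: key.
- exact: Linf_Re.
- by apply: ae_mono hM => x h /h; exact: le_trans (cRe_cabs _).
- exact: Linf_Im.
- by apply: ae_mono hM => x h /h; exact: le_trans (cIm_cabs _).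
Qed.

Lemma Linf_cprim f : Linf f -> Linf (cprim f).
Proof.
move=> hf; have [_ _ [M hM]] := hf; split.
- apply: (lip_measurable hab (M := M)) => s t as_ st tb /=.
  apply: (prim_lip hab) => //; first exact: Linf_Re.
  by apply: ae_mono (ae_itv_sub as_ tb hM) => x h /h; exact: le_trans (cRe_cabs _).
- apply: (lip_measurable hab (M := M)) => s t as_ st tb /=.
  apply: (prim_lip hab) => //; first exact: Linf_Im.
  by apply: ae_mono (ae_itv_sub as_ tb hM) => x h /h; exact: le_trans (cIm_cabs _).
by exists (2 * M * (b - a)); apply: aeW => t tab; exact: cprim_le.
Qed.

Lemma cprim_eq0_ae f : Linf f -> (forall t, a <= t <= b -> cprim f t = 0) ->
  \forall t \ae mu, a <= t <= b -> f t = 0.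
Proof.
move=> hf h0.
have h1 := prim_eq0_ae hab (Linf_Re hf) (fun t tab => congr1 cRe (h0 t tab)).
have h2 := prim_eq0_ae hab (Linf_Im hf) (fun t tab => congr1 cIm (h0 t tab)).
by apply: ae_mono (ae_and h1 h2) => t [u v] tab; apply: complex_ext; rewrite ?u ?v.
Qed.

Lemma Linf_series (u : nat -> R -> R[i]) (C : R) :
  (forall j, Linf (u j)) ->
  (forall j, \forall t \ae mu, a <= t <= b -> cabs (u j t) <= C / 2 ^+ j) ->
  exists v, Linf v /\ forall k, \forall t \ae mu, a <= t <= b ->
    cabs (v t - \sum_(j < k) u j t) <= 4 * C / 2 ^+ k.
Proof.
move=> hu hC.
have hr j : \forall t \ae mu, a <= t <= b -> `|cRe (u j t)| <= C / 2 ^+ j.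
  by apply: ae_mono (hC j) => t h /h; exact: le_trans (cRe_cabs _).
have hi j : \forall t \ae mu, a <= t <= b -> `|cIm (u j t)| <= C / 2 ^+ j.
  by apply: ae_mono (hC j) => t h /h; exact: le_trans (cIm_cabs _).
have [x [bx hx]] := @ess_bdd_series R a b hab (fun j t => cRe (u j t)) C
  (fun j => Linf_Re (hu j)) hr.
have [y [by_ hy]] := @ess_bdd_series R a b hab (fun j t => cIm (u j t)) C
  (fun j => Linf_Im (hu j)) hi.
exists (fun t => (x t +i* y t)%C); split; first exact: Linf_ReIm.
move=> k; apply: ae_mono (ae_and (hx k) (hy k)) => t [h1 h2] tab.
rewrite (le_trans (cabs_ReIm _))// cReD cImD cReN cImN cRe_sum cIm_sum /=.
apply: (le_trans (lerD (h1 tab) (h2 tab))).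
by rewrite -!mulrA -mulrDl -natrD.
Qed.

(** Cutting [a, t] into n equal pieces bounds the increment by n terms of size C ((t - a) / n)^2,
    whose sum tends to 0. *)
Lemma quadratic_modulus_cst (H : R -> R[i]) (C : R) :
  (forall s t, a <= s -> s <= t -> t <= b -> cabs (H t - H s) <= C * (t - s) ^+ 2) ->
  forall t, a <= t <= b -> H t = H a.
Proof.
move=> hH t /andP[at_ tb].
have step (n : nat) : (0 < n)%N -> cabs (H t - H a) <= C * (t - a) ^+ 2 / n%:R.
  move=> n0; pose x (i : nat) := a + i%:R * ((t - a) / n%:R).
  have d0 : 0 <= (t - a) / n%:R by rewrite divr_ge0 ?subr_ge0.
  have xn : x n = t by rewrite /x mulrC divfK ?pnatr_eq0 -?lt0n// addrC subrK.
  have x0 : x 0%N = a by rewrite /x mul0r addr0.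
  have xS i : x i.+1 - x i = (t - a) / n%:R.
    by rewrite /x opprD addrACA subrr add0r -mulrBl -natr1 addrAC subrr add0r mul1r.
  have xa i : a <= x i by rewrite /x lerDl mulr_ge0.
  have xt i : (i <= n)%N -> x i <= t.
    by move=> hi; rewrite -xn /x lerD2l ler_wpM2r// ler_nat.
  have ind i : (i <= n)%N -> cabs (H (x i) - H a) <= i%:R * (C * ((t - a) / n%:R) ^+ 2).
    elim: i => [|i IH] hi; first by rewrite x0 subrr cabs0 mul0r.
    rewrite -(subrK (H (x i)) (H (x i.+1))) -addrA (le_trans (cabsD _ _))//.
    rewrite -natr1 mulrDl mul1r [leRHS]addrC lerD ?IH ?(ltnW hi)//.
    rewrite -(xS i) hH//; first by rewrite -subr_ge0 xS.
    by rewrite (le_trans _ tb)// xt.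
  have := ind n (leqnn n); rewrite xn => /le_trans; apply.
  rewrite le_eqVlt; apply/orP; left; apply/eqP; field.
  by rewrite pnatr_eq0 -lt0n.
apply/eqP; rewrite -subr_eq0; apply/eqP/cabs0_eq0/eqP.
rewrite eq_le cabs_ge0 andbT leNgt; apply/negP => hp.
pose K := C * (t - a) ^+ 2.
have [N hN] : exists N : nat, K / cabs (H t - H a) < N%:R.
  by exists (Num.truncn (`|K / cabs (H t - H a)|)).+1; rewrite (le_lt_trans (ler_norm _))// truncnS_gt.
have := step N.+1 isT; rewrite leNgt => /negP; apply.
rewrite -/K ltr_pdivrMr ?ltr0n// mulrC -ltr_pdivrMr//.
by rewrite (lt_le_trans hN)// ler_nat.
Qed.

(** Integration by parts, without differentiating the primitives: the difference [H] of the two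
    sides has increments of second order, so it is constant by [quadratic_modulus_cst], and it
    vanishes at [a]. *)
Lemma cprimM f g t : Linf f -> Linf g -> a <= t <= b ->
  cprim f t * cprim g t = cprim (fun s => f s * cprim g s + cprim f s * g s) t.
Proof.
move=> hf hg tab.
have [_ _ [M1 hM1]] := hf; have [_ _ [M2 hM2]] := hg.
pose M := Num.max `|M1| `|M2|.
have M0 : 0 <= M by rewrite le_max normr_ge0.
have hfM : \forall t \ae mu, a <= t <= b -> cabs (f t) <= M.
  by apply: ae_mono hM1 => x h /h /le_trans; apply; rewrite le_max ler_norm.
have hgM : \forall t \ae mu, a <= t <= b -> cabs (g t) <= M.
  by apply: ae_mono hM2 => x h /h /le_trans; apply; rewrite le_max ler_norm orbT.
have hF := Linf_cprim hf; have hG := Linf_cprim hg.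
have hfG := LinfM hf hG; have hFg := LinfM hF hg.
pose H x := cprim f x * cprim g x - cprim (fun s => f s * cprim g s + cprim f s * g s) x.
suff : H t = H a.
  by rewrite /H !cprim_start mul0r subrr => /eqP; rewrite subr_eq0 => /eqP.
(* 12 = 4 + 8: the product of two increments is at most 4 M^2 (x - s)^2, the remaining integral at
   most 8 M^2 (x - s)^2. *)
apply: (quadratic_modulus_cst (C := 12 * M ^+ 2)) => // s x as_ sx xb.
have sb : s <= b := le_trans sx xb.
pose k1 y := f y * (cprim g y - cprim g s).
pose k2 y := (cprim f y - cprim f s) * g y.
have hsG : Linf (fun y => cprim g y - cprim g s) := LinfD hG (Linf_cst _).
have hsF : Linf (fun y => cprim f y - cprim f s) := LinfD hF (Linf_cst _).
have hk1 : Linf k1 := LinfM hf hsG.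
have hk2 : Linf k2 := LinfM hsF hg.
have hk : Linf (fun y => k1 y + k2 y) := LinfD hk1 hk2.
(* On [s, x] the primitives are frozen at s: what remains is the product of
   two increments and an integral of size O((x - s)^2). *)
have dec y : y <= b -> cprim (fun s => f s * cprim g s + cprim f s * g s) y =
    cprim g s * cprim f y + cprim f s * cprim g y + cprim (fun y => k1 y + k2 y) y.
  move=> yb; pose f1 z := cprim g s * f z; pose g1 z := cprim f s * g z.
  have hf1 : Linf f1 := LinfM (Linf_cst _) hf.
  have hg1 : Linf g1 := LinfM (Linf_cst _) hg.
  rewrite -(cprimZ (cprim g s) hf yb) -(cprimZ (cprim f s) hg yb).
  rewrite -(cprimD hf1 hg1 yb) -(cprimD (LinfD hf1 hg1) hk yb).
  by apply: cprim_ext => // z _; rewrite /k1 /k2 /f1 /g1; ring.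
have -> : H x - H s = (cprim f x - cprim f s) * (cprim g x - cprim g s) -
    (cprim (fun y => k1 y + k2 y) x - cprim (fun y => k1 y + k2 y) s).
  by rewrite /H !dec//; ring.
rewrite (le_trans (cabsB _ _))// cabsM.
have e1 := cprim_lip hf (ae_itv_sub as_ xb hfM) as_ sx xb.
have e2 := cprim_lip hg (ae_itv_sub as_ xb hgM) as_ sx xb.
have d0 : 0 <= x - s by rewrite subr_ge0.
have e3 : cabs (cprim (fun y => k1 y + k2 y) x - cprim (fun y => k1 y + k2 y) s) <=
    2 * (4 * M ^+ 2 * (x - s)) * (x - s).
  apply: cprim_lip => //; apply: ae_mono (ae_and hfM hgM) => y [fy gy] /andP[sy yx].
  have yab : a <= y <= b by rewrite (le_trans as_ sy) (le_trans yx xb).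
  have bd h N : Linf h -> (\forall t \ae mu, a <= t <= b -> cabs (h t) <= N) ->
      0 <= N -> cabs (cprim h y - cprim h s) <= 2 * N * (x - s).
    move=> hh hN N0; case/andP: yab => _ yb.
    have := cprim_lip hh (ae_itv_sub as_ yb hN) as_ sy yb => /le_trans; apply.
    by rewrite ler_wpM2l ?mulr_ge0// lerD2r.
  rewrite (le_trans (cabsD _ _))// /k1 /k2 !cabsM.
  apply: (le_trans (lerD (ler_pM (cabs_ge0 _) (cabs_ge0 _) (fy yab) (bd g M hg hgM M0))
    (ler_pM (cabs_ge0 _) (cabs_ge0 _) (bd f M hf hfM M0) (gy yab)))).
  by rewrite le_eqVlt; apply/orP; left; apply/eqP; ring.
apply: (le_trans (lerD (ler_pM (cabs_ge0 _) (cabs_ge0 _) e1 e2) e3)).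
by rewrite le_eqVlt; apply/orP; left; apply/eqP; ring.
Qed.

End complex_primitive.

(** * The Sobolev spaces W^k_oo([a, b]; C) *)

Section scalar_sobolev.
Context (R : realType) (a b : R) (hab : a < b).
Local Notation mu := (@lebesgue_measure R).
Local Notation cRe := (@complex.Re R).
Local Notation cIm := (@complex.Im R).
Local Notation Linf := (Linf a b).
Local Notation cprim := (cprim a).
Local Notation W := (inW a b).
Local Notation N := (Wnorm a b).
Implicit Types f y z : R -> R[i].

Definition essN (f : R -> R[i]) : R := fine (esssup_ab a b f).

(** [esssup_ab] extends by zero outside [a, b], hence the sign condition on [r]. *)
Lemma esssup_abP f (r : R) : 0 <= r ->
  ((esssup_ab a b f <= r%:E)%E <-> \forall t \ae mu, a <= t <= b -> cabs (f t) <= r).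
Proof.
move=> r0; split.
  move=> /ess_supP; apply: ae_mono => t; rewrite lee_fin in_itv/=.
  by move=> h tab; rewrite tab in h.
move=> h; apply/ess_supP; apply: ae_mono h => t h.
by rewrite lee_fin in_itv/=; case: ifP.
Qed.

Lemma lebesgue_measureT_gt0 : (0 < mu [set: R])%E.
Proof.
apply: (@lt_le_trans _ _ (mu `[a, b]%classic)).
  by rewrite lebesgue_measure_cc ?ltW// lte_fin subr_gt0.
by apply: le_measure => //; rewrite inE.
Qed.

Lemma esssup_ab_ge0 f : (0 <= esssup_ab a b f)%E.
Proof.
apply: ess_sup_gee; first exact: lebesgue_measureT_gt0.
by apply: aeW => t; rewrite lee_fin; case: ifP => // _; exact: cabs_ge0.
Qed.

Lemma essN_ge0 f : 0 <= essN f.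
Proof. by rewrite fine_ge0// esssup_ab_ge0. Qed.

Lemma esssup_ab_fin f (M : R) :
  (\forall t \ae mu, a <= t <= b -> cabs (f t) <= M) -> (esssup_ab a b f < +oo)%E.
Proof.
move=> h; apply: (@le_lt_trans _ _ (`|M|)%:E); last exact: ltry.
by apply/esssup_abP => //; apply: ae_mono h => t h /h /le_trans; apply; exact: ler_norm.
Qed.

Lemma essN_ae f : Linf f -> \forall t \ae mu, a <= t <= b -> cabs (f t) <= essN f.
Proof.
move=> [_ _ [M hM]]; apply/esssup_abP; first exact: essN_ge0.
by rewrite /essN fineK// ge0_fin_numE ?esssup_ab_ge0// (esssup_ab_fin hM).
Qed.

Lemma essN_le f (r : R) : 0 <= r ->
  (\forall t \ae mu, a <= t <= b -> cabs (f t) <= r) -> essN f <= r.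
Proof.
move=> r0 h; have /esssup_abP := h => /(_ r0) h'.
rewrite -lee_fin /essN fineK// ge0_fin_numE ?esssup_ab_ge0//.
exact: esssup_ab_fin h.
Qed.

Lemma eq_essN f g : (\forall t \ae mu, a <= t <= b -> f t = g t) -> essN f = essN g.
Proof.
move=> fg; congr fine; apply: eq_ess_sup; apply: ae_mono fg => t h.
by rewrite in_itv/=; case: ifP => // /h ->.
Qed.

Lemma Wrep_last k y g : Wrep a b k y g -> Linf (g k).
Proof.
move=> [_ hm _ hk]; have [m1 m2] := hm k (leqnn k); split=> //.
exists (essN (g k)); apply/esssup_abP; first exact: essN_ge0.
by rewrite /essN fineK// ge0_fin_numE ?esssup_ab_ge0.
Qed.

Lemma Wrep_prim k y g j t : Wrep a b k y g -> (j < k)%N -> a <= t <= b ->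
  g j t = g j a + cprim (g j.+1) t.
Proof.
move=> [_ _ h _] jk tab; have [_ _ /(_ t tab)[h1 h2]] := h j jk.
rewrite addrC; apply/eqP; rewrite -subr_eq; apply/eqP/complex_ext.
  by rewrite cReD cReN /= /prim /Rintegral -h1.
by rewrite cImD cImN /= /prim /Rintegral -h2.
Qed.

Lemma Wrep_behead k y g : Wrep a b k.+1 y g -> Wrep a b k (g 1%N) (fun j => g j.+1).
Proof. by move=> [h0 hm h hk]; split=> // j jk; [exact: hm|exact: h]. Qed.

Lemma Wrep_Linf k y g : Wrep a b k y g -> Linf (g 0%N).
Proof.
elim: k y g => [|k IH] y g hg; first exact: (Wrep_last hg).
have h1 := IH _ _ (Wrep_behead hg).
apply: (@Linf_ext _ _ _ (fun t => g 0%N a + cprim (g 1%N) t)).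
  by move=> t tab; rewrite -(Wrep_prim hg).
by apply: LinfD (Linf_cst _ _ _) (Linf_cprim hab h1).
Qed.

Lemma Wrep_cons k y g h c : Wrep a b k h g ->
  (forall t, a <= t <= b -> y t = c + cprim h t) ->
  Wrep a b k.+1 y (fun j => if j is j'.+1 then g j' else y).
Proof.
move=> hg hy; have L0 := Wrep_Linf hg.
have [g0 gm gi gk] := hg.
have Lh : Linf h by apply: Linf_ext L0.
have Ly : Linf y.
  apply: (@Linf_ext _ _ _ (fun t => c + cprim h t)); first by move=> t /hy.
  by apply: LinfD (Linf_cst _ _ _) (Linf_cprim hab Lh).
have ya : y a = c by rewrite hy ?lexx ?ltW// cprim_start addr0.
split=> //.
- by case=> [_|j jk]; [case: Ly|exact: gm].
- case=> [_|j jk]; last exact: gi.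
  have iR := ess_bdd_integrable hab (Linf_Re L0).
  have iI := ess_bdd_integrable hab (Linf_Im L0).
  split=> // t tab; have /andP[at_ tb] := tab.
  have E : y t = c + cprim (g 0%N) t.
    by rewrite (hy t tab) (@cprim_ext _ a b h (g 0%N) t)// => s sab; rewrite g0.
  rewrite ya E.
  rewrite cReD cImD /= addrAC subrr add0r addrAC subrr add0r /prim /Rintegral.
  have sub := subset_itv_cc (lexx a) tb.
  have mt : measurable `[a, t]%classic by exact: measurable_itv.
  have iRt := ess_bdd_integrable_sub hab (Linf_Re L0) mt sub.
  have iIt := ess_bdd_integrable_sub hab (Linf_Im L0) mt sub.
  by split; rewrite fineK//; exact: integrable_fin_num.
Qed.

(** Every subinterval of positive length contains a zero, and the Lipschitz bound of the primitive
    carries this zero to a nearby point with an arbitrarily small error. *)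
Lemma affine_prim_ae0 f c : Linf f ->
  (\forall t \ae mu, a <= t <= b -> c + cprim f t = 0) ->
  forall t, a <= t <= b -> c + cprim f t = 0.
Proof.
move=> hf h0 t0 /andP[at0 t0b].
have hM := essN_ae hf; set K := 2 * essN f.
have K0 : 0 <= K by rewrite mulr_ge0// essN_ge0.
apply/cabs0_eq0/eqP; rewrite eq_le cabs_ge0 andbT leNgt; apply/negP => d0.
set d := cabs _ in d0.
(* An interval of length [l] fits into [a, b] on at least one side of [t0], and over it the function
   varies by less than [d]. *)
pose l := Num.min ((b - a) / 2) (d / (2 * (K + 1))).
have l0 : 0 < l.
  by rewrite lt_min !divr_gt0 ?subr_gt0// mulr_gt0// ltr_wpDl.
have l1 : l <= (b - a) / 2 by rewrite ge_min lexx.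
have l2 : K * l < d.
  apply: (@le_lt_trans _ _ (K * (d / (2 * (K + 1))))).
    by rewrite ler_wpM2l// ge_min lexx orbT.
  rewrite mulrA ltr_pdivrMr ?mulr_gt0 ?ltr_wpDl// mulrC.
  by rewrite ltr_pM2l//; lra.
have zero s : a <= s -> s + l <= b -> exists2 x, s <= x <= s + l & c + cprim f x = 0.
  move=> as_ sb; apply: contrapT => hn.
  have [Z [mZ Z0 sub]] := h0.
  have : mu `[s, s + l]%classic = 0.
    apply: (subset_measure0 _ mZ _ Z0) => // x; rewrite /= in_itv/= => /andP[sx xl].
    apply: sub => /= hx; apply: hn; exists x; first by rewrite sx.
    by apply: hx; rewrite (le_trans as_ sx) (le_trans xl sb).
  by rewrite lebesgue_measure_cc ?lerDl ?ltW// addrAC subrr add0r => /eqP; rewrite eqe gt_eqF.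
have fin x : a <= x <= b -> c + cprim f x = 0 -> `|t0 - x| <= l -> False.
  move=> /andP[ax xb] hx dl; move: l2; rewrite ltNge => /negP; apply.
  have -> : d = cabs (cprim f t0 - cprim f x).
    rewrite /d; congr cabs; move/eqP: hx; rewrite addrC addr_eq0 => /eqP ->.
    by rewrite opprK addrC.
  apply: (@le_trans _ _ (K * `|t0 - x|)); last by rewrite ler_wpM2l.
  have [h|/ltW h] := leP x t0.
    rewrite ger0_norm ?subr_ge0//; apply: (cprim_lip hab) => //.
    exact: ae_itv_sub hM.
  rewrite distrC ger0_norm ?subr_ge0// cabs_distC; apply: (cprim_lip hab) => //.
  exact: ae_itv_sub hM.
have [h|h] := leP (t0 + l) b.
  have [x /andP[h1 h2] hx] := zero t0 at0 h.
  apply: (fin x) => //; first by rewrite (le_trans at0 h1) (le_trans h2).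
  by rewrite distrC ger0_norm ?subr_ge0// lerBlDl.
have ha : a <= t0 - l by lra.
have [|x] := zero (t0 - l) ha; first by rewrite subrK.
rewrite subrK => /andP[h1 h2] hx.
apply: (fin x) => //; first by rewrite (le_trans ha h1) (le_trans h2).
by rewrite ger0_norm ?subr_ge0//; lra.
Qed.

(** Primitives that agree almost everywhere agree at every point. So the initial values coincide,
    the primitive of the difference of the first derivatives vanishes, and these derivatives agree
    almost everywhere; the induction then goes on with them. *)
Lemma Wrep_uniq k y z g h :
  (\forall t \ae mu, a <= t <= b -> y t = z t) ->
  Wrep a b k y g -> Wrep a b k z h ->
  forall j, (j <= k)%N -> \forall t \ae mu, a <= t <= b -> g j t = h j t.
Proof.
elim: k y z g h => [|k IH] y z g h yz hg hh j jk; have [g0 _ _ _] := hg; have [h0 _ _ _] := hh.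
  move: jk; rewrite leqn0 => /eqP ->; apply: ae_mono yz => t e tab.
  by rewrite g0// h0// e.
have gh0 : \forall t \ae mu, a <= t <= b -> g 0%N t = h 0%N t.
  by apply: ae_mono yz => t e tab; rewrite g0// h0// e.
case: j jk => [_ //|j jk].
have Lg := Wrep_Linf (Wrep_behead hg); have Lh := Wrep_Linf (Wrep_behead hh).
have Lmh : Linf (fun t => -1 * h 1%N t) := LinfM (Linf_cst _ _ _) Lh.
have Lgh : Linf (fun t => g 1%N t + -1 * h 1%N t) := LinfD Lg Lmh.
pose c := g 0%N a - h 0%N a.
have E t : a <= t <= b -> c + cprim (fun t => g 1%N t + -1 * h 1%N t) t = g 0%N t - h 0%N t.
  move=> tab; have /andP[_ tb] := tab.
  rewrite (cprimD hab)// (cprimZ hab)// (Wrep_prim hg (ltn0Sn k) tab) (Wrep_prim hh (ltn0Sn k) tab).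
  by rewrite /c mulN1r opprD addrACA.
have F : forall t, a <= t <= b -> c + cprim (fun t => g 1%N t + -1 * h 1%N t) t = 0.
  apply: affine_prim_ae0 => //; apply: ae_mono gh0 => t e tab.
  by rewrite E// e// subrr.
have c0 : c = 0 by have := F a; rewrite cprim_start addr0 lexx ltW//; apply.
have gh1 : \forall t \ae mu, a <= t <= b -> g 1%N t = h 1%N t.
  have : \forall t \ae mu, a <= t <= b -> g 1%N t + -1 * h 1%N t = 0.
    by apply: (cprim_eq0_ae hab Lgh) => t tab; rewrite -[LHS]add0r -{1}c0 F.
  apply: ae_mono => t e /e /eqP; rewrite mulN1r subr_eq0 => /eqP//.
exact: (IH _ _ _ _ gh1 (Wrep_behead hg) (Wrep_behead hh) j jk).
Qed.

Lemma WderP k y : W k y -> Wrep a b k y (Wder a b k y).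
Proof. by move=> h; rewrite /Wder; case: pselect => // p; case: cid. Qed.

Lemma inW0P y : W 0 y <-> Linf y.
Proof.
split.
  by move=> [g hg]; have [g0 _ _ _] := hg; exact: Linf_ext (Wrep_Linf hg).
move=> Ly; exists (fun _ => y); have [m1 m2 [M hM]] := Ly; split=> //.
exact: esssup_ab_fin hM.
Qed.

Lemma inWS_prim k y g c : W k g ->
  (forall t, a <= t <= b -> y t = c + cprim g t) -> W k.+1 y.
Proof. by move=> [h hh] hy; eexists; exact: Wrep_cons hh hy. Qed.

Lemma inWS_ex k y : W k.+1 y -> exists g, W k g /\ 
  forall t, a <= t <= b -> y t = y a + cprim g t.
Proof.
move=> [g hg]; exists (g 1%N); split; first by exists (fun j => g j.+1); exact: Wrep_behead hg.
move=> t tab; have [g0 _ _ _] := hg.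
by rewrite -(g0 t tab) (Wrep_prim hg (ltn0Sn k) tab) g0// lexx ltW.
Qed.

Lemma inW_Linf k y : W k y -> Linf y.
Proof. by move=> [g hg]; have [g0 _ _ _] := hg; exact: Linf_ext (Wrep_Linf hg). Qed.

Lemma inW_ext k y z : (forall t, a <= t <= b -> y t = z t) -> W k y -> W k z.
Proof. by move=> yz [g [h0 h1 h2 h3]]; exists g; split=> // t tab; rewrite h0// yz. Qed.

Lemma Wnorm0 y : Linf y -> N 0 y = essN y.
Proof.
move=> /inW0P/WderP[h0 _ _ _]; rewrite /Wnorm big_ord1; apply: eq_essN.
by apply: aeW => t /h0.
Qed.

Lemma Wder1_ae k y g c : W k g ->
  (forall t, a <= t <= b -> y t = c + cprim g t) ->
  \forall t \ae mu, a <= t <= b -> Wder a b k.+1 y 1%N t = g t.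
Proof.
move=> hg hy; have := hg => -[h hh]; have rc := Wrep_cons hh hy.
have yy : \forall t \ae mu, a <= t <= b -> y t = y t by apply: aeW.
have := Wrep_uniq yy (WderP (inWS_prim hg hy)) rc (ltn0Sn k : (1 <= k.+1)%N).
by have [h0 _ _ _] := hh; apply: ae_mono => t e tab; rewrite e//= h0.
Qed.

(** By uniqueness the chosen derivatives of [y] agree almost everywhere with [y] followed by the
    chosen derivatives of [g]. Together with [Wnorm0], this recursion replaces the definition of the
    norm in the inductions on [k]. *)
Lemma WnormS k y g c : W k g ->
  (forall t, a <= t <= b -> y t = c + cprim g t) ->
  N k.+1 y = essN y + N k g.
Proof.
move=> hg hy; have rc := Wrep_cons (WderP hg) hy.
have yy : \forall t \ae mu, a <= t <= b -> y t = y t by apply: aeW.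
have U := Wrep_uniq yy (WderP (inWS_prim hg hy)) rc.
rewrite /Wnorm big_ord_recl; congr (_ + _).
  by apply: eq_essN; exact: (U 0%N).
by apply: eq_bigr => j _; apply: eq_essN; exact: (U j.+1 (ltn_ord j)).
Qed.

Lemma Wnorm_ge0 k y : 0 <= N k y.
Proof. by apply: sumr_ge0 => j _; exact: essN_ge0. Qed.

Lemma inW_prim k g : W k g -> W k.+1 (cprim g).
Proof. by move=> hg; apply: (inWS_prim (c := 0) hg) => t _; rewrite add0r. Qed.

Lemma inW_cst k c : W k (fun _ => c).
Proof.
elim: k c => [|k IH] c; first by apply/inW0P; exact: Linf_cst.
by apply: (inWS_prim (IH 0) (c := c)) => t _; rewrite cprim_cst0 addr0.
Qed.

Lemma Wnorm_ext k y z : (forall t, a <= t <= b -> y t = z t) -> W k y -> N k y = N k z.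
Proof.
move=> yz; have ae_yz : \forall t \ae mu, a <= t <= b -> y t = z t by apply: aeW.
case: k => [|k] hy.
  by rewrite !Wnorm0 ?(eq_essN ae_yz)//; apply: Linf_ext (inW_Linf hy).
have [g [hg yg]] := inWS_ex hy.
rewrite (WnormS hg yg) (@WnormS _ z g (y a)) ?(eq_essN ae_yz)// => t tab.
by rewrite -yz// yg.
Qed.

Lemma essN_le_Wnorm k y : W k y -> essN y <= N k y.
Proof.
case: k => [|k] hy; first by rewrite Wnorm0//; apply: inW_Linf hy.
by have [g [hg yg]] := inWS_ex hy; rewrite (WnormS hg yg) lerDl Wnorm_ge0.
Qed.

Lemma inWD k y z : W k y -> W k z -> W k (fun t => y t + z t).
Proof.
elim: k y z => [|k IH] y z hy hz.
  by apply/inW0P; apply: LinfD; [exact: inW_Linf hy|exact: inW_Linf hz].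
have [g [hg yg]] := inWS_ex hy; have [h [hh zh]] := inWS_ex hz.
apply: (inWS_prim (IH _ _ hg hh) (c := y a + z a)) => t tab.
have /andP[_ tb] := tab.
by rewrite yg// zh// (cprimD hab (inW_Linf hg) (inW_Linf hh))// addrACA.
Qed.

Lemma WnormD k y z : W k y -> W k z -> N k (fun t => y t + z t) <= N k y + N k z.
Proof.
have E y' z' : Linf y' -> Linf z' -> essN (fun t => y' t + z' t) <= essN y' + essN z'.
  move=> Ly Lz; apply: essN_le; first by rewrite addr_ge0 ?essN_ge0.
  apply: ae_mono (ae_and (essN_ae Ly) (essN_ae Lz)) => t [h1 h2] tab.
  by rewrite (le_trans (cabsD _ _))// lerD ?h1 ?h2.
elim: k y z => [|k IH] y z hy hz; have Ly := inW_Linf hy; have Lz := inW_Linf hz.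
  by rewrite !Wnorm0 ?E//; exact: LinfD.
have [g [hg yg]] := inWS_ex hy; have [h [hh zh]] := inWS_ex hz.
rewrite (WnormS hg yg) (WnormS hh zh).
rewrite (@WnormS _ (fun t => y t + z t) (fun t => g t + h t) (y a + z a)); last 2 first.
- exact: inWD.
- move=> t tab; have /andP[_ tb] := tab.
  by rewrite yg// zh// (cprimD hab (inW_Linf hg) (inW_Linf hh))// addrACA.
by rewrite addrACA lerD ?E ?IH.
Qed.

Lemma inWZ k c y : W k y -> W k (fun t => c * y t).
Proof.
elim: k y => [|k IH] y hy.
  by apply/inW0P; apply: LinfM (Linf_cst _ _ _) (inW_Linf hy).
have [g [hg yg]] := inWS_ex hy.
apply: (inWS_prim (IH _ hg) (c := c * y a)) => t tab.
have /andP[_ tb] := tab.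
by rewrite yg// (cprimZ hab c (inW_Linf hg))// mulrDr.
Qed.

Lemma WnormZ k c y : W k y -> N k (fun t => c * y t) <= cabs c * N k y.
Proof.
have E z : Linf z -> essN (fun t => c * z t) <= cabs c * essN z.
  move=> Lz; apply: essN_le; first by rewrite mulr_ge0 ?cabs_ge0 ?essN_ge0.
  apply: ae_mono (essN_ae Lz) => t h tab.
  by rewrite cabsM ler_wpM2l ?cabs_ge0 ?h.
elim: k y => [|k IH] y hy; have Ly := inW_Linf hy.
  by rewrite !Wnorm0 ?E//; exact: LinfM (Linf_cst _ _ _) Ly.
have [g [hg yg]] := inWS_ex hy.
rewrite (WnormS hg yg).
rewrite (@WnormS _ (fun t => c * y t) (fun t => c * g t) (c * y a)); last 2 first.
- exact: inWZ.
- move=> t tab; have /andP[_ tb] := tab.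
  by rewrite yg// (cprimZ hab c (inW_Linf hg))// mulrDr.
by rewrite mulrDr lerD ?E ?IH.
Qed.

Lemma inW_pred k y : W k.+1 y -> W k y.
Proof.
elim: k y => [|k IH] y hy; first by apply/inW0P; exact: inW_Linf hy.
by have [g [hg yg]] := inWS_ex hy; apply: inWS_prim (IH _ hg) yg.
Qed.

Lemma Wnorm_pred k y : W k.+1 y -> N k y <= N k.+1 y.
Proof.
elim: k y => [|k IH] y hy; have [g [hg yg]] := inWS_ex hy.
  by rewrite Wnorm0 ?(WnormS hg yg) ?lerDl ?Wnorm_ge0//; exact: inW_Linf hy.
by rewrite (WnormS (inW_pred hg) yg) (WnormS hg yg) lerD2l IH.
Qed.

Lemma Wnorm_cst k c : N k (fun _ => c) <= cabs c.
Proof.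
have E d : essN (fun _ => d) <= cabs d.
  by apply: essN_le; [exact: cabs_ge0|exact: aeW].
elim: k c => [|k IH] c; first by rewrite Wnorm0 ?E//; exact: Linf_cst.
rewrite (@WnormS _ _ (fun _ => 0) c); last 2 first.
- exact: inW_cst.
- by move=> t _; rewrite cprim_cst0 addr0.
by rewrite -[leRHS]addr0 lerD ?E// (le_trans (IH 0))// cabs0.
Qed.

Lemma Wnorm_prim k g : W k g -> N k.+1 (cprim g) <= (1 + 2 * (b - a)) * N k g.
Proof.
move=> hg; rewrite (WnormS (c := 0) hg) => [|t _]; last by rewrite add0r.
rewrite mulrDl mul1r addrC lerD2l; apply: (@le_trans _ _ (2 * essN g * (b - a))).
  apply: essN_le; first by rewrite !mulr_ge0 ?essN_ge0// subr_ge0 ltW.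
  by apply: aeW => t tab; apply: cprim_le => //; [exact: inW_Linf hg|exact: essN_ae (inW_Linf hg)].
rewrite mulrAC ler_wpM2l ?essN_le_Wnorm// mulr_ge0// subr_ge0 ltW//.
Qed.

(** One derivative is spent to pass from essential to pointwise bounds. Some point [x] satisfies the
    essential bound, and the increments from [a] to [t] and from [a] to [x] each cost 2 (b - a)
    times the bound of the derivative. *)
Lemma Wnorm_eval k y t : W k.+1 y -> a <= t <= b -> 
  cabs (y t) <= (1 + 4 * (b - a)) * N k.+1 y.
Proof.
move=> hy tab; have Ly := inW_Linf hy.
have [g [hg yg]] := inWS_ex hy; have Lg := inW_Linf hg.
have [x xab hx] : exists2 x, a <= x <= b & cabs (y x) <= essN y.
  apply: contrapT => hn; have [Z [mZ Z0 sub]] := essN_ae Ly.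
  have : mu `[a, b]%classic = 0.
    apply: (subset_measure0 _ mZ _ Z0) => // x; rewrite /= in_itv/= => xab.
    by apply: sub => /= hx; apply: hn; exists x => //; apply: hx.
  by rewrite lebesgue_measure_cc ?ltW// => /eqP; rewrite eqe gt_eqF// subr_gt0.
have -> : y t = y x + (cprim g t - cprim g x).
  by rewrite (yg t)// (yg x)// addrACA subrr addr0.
have e1 := cprim_le hab Lg (essN_ae Lg) tab.
have e2 := cprim_le hab Lg (essN_ae Lg) xab.
apply: (le_trans (cabsD _ _)); apply: (le_trans (lerD hx (cabsB _ _))).
have e3 : essN g * (b - a) <= N k.+1 y * (b - a).
  apply: ler_wpM2r; first by rewrite subr_ge0 ltW.
  apply: le_trans (essN_le_Wnorm hg) _.
  by rewrite (WnormS hg yg) lerDr essN_ge0.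
have := essN_le_Wnorm hy; lra.
Qed.

(** The product rule in integral form: [cprimM] treats the primitives vanishing at [a], and the
    initial values contribute linear terms. *)
Lemma inWM_prim y z g h : Linf g -> Linf h ->
  (forall t, a <= t <= b -> y t = y a + cprim g t) ->
  (forall t, a <= t <= b -> z t = z a + cprim h t) ->
  forall t, a <= t <= b ->
  y t * z t = y a * z a + cprim (fun t => y t * h t + g t * z t) t.
Proof.
move=> Lg Lh yg zh t tab; have /andP[_ tb] := tab.
have LG := Linf_cprim hab Lg; have LH := Linf_cprim hab Lh.
rewrite (@cprim_ext _ _ b _ (fun s => (y a * h s + z a * g s) + (g s * cprim h s + cprim g s * h s)))//; last first.
  by move=> s sab; rewrite (yg s)// (zh s)//; ring.
have L1 : Linf (fun s => y a * h s) := LinfM (Linf_cst _ _ _) Lh.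
have L2 : Linf (fun s => z a * g s) := LinfM (Linf_cst _ _ _) Lg.
have L3 := LinfD (LinfM Lg LH) (LinfM LG Lh).
rewrite (cprimD hab (LinfD L1 L2) L3 tb) (cprimD hab L1 L2 tb).
rewrite (cprimZ hab _ Lh tb) (cprimZ hab _ Lg tb) -(cprimM hab Lg Lh tab).
by rewrite (yg t)// (zh t)//; ring.
Qed.

Lemma inWM k y z : W k y -> W k z -> W k (fun t => y t * z t).
Proof.
elim: k y z => [|k IH] y z hy hz.
  by apply/inW0P; apply: LinfM; [exact: inW_Linf hy|exact: inW_Linf hz].
have [g [hg yg]] := inWS_ex hy; have [h [hh zh]] := inWS_ex hz.
apply: (inWS_prim _ (inWM_prim (inW_Linf hg) (inW_Linf hh) yg zh)).
by apply: inWD; apply: IH => //; exact: inW_pred.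
Qed.

(** At order k+1 there is one product of suprema and two products of order k, from y z' and y' z;
    and 1 + 2 3^k <= 3^(k+1). *)
Lemma WnormM k y z : W k y -> W k z ->
  N k (fun t => y t * z t) <= 3 ^+ k * (N k y * N k z).
Proof.
have E u v : Linf u -> Linf v -> essN (fun t => u t * v t) <= essN u * essN v.
  move=> Lu Lv; apply: essN_le; first by rewrite mulr_ge0 ?essN_ge0.
  apply: ae_mono (ae_and (essN_ae Lu) (essN_ae Lv)) => t [h1 h2] tab.
  by rewrite cabsM ler_pM ?cabs_ge0 ?h1 ?h2.
elim: k y z => [|k IH] y z hy hz; have Ly := inW_Linf hy; have Lz := inW_Linf hz.
  by rewrite expr0 mul1r !Wnorm0 ?E//; exact: LinfM.
have [g [hg yg]] := inWS_ex hy; have [h [hh zh]] := inWS_ex hz.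
have hyh := inWM (inW_pred hy) hh; have hgz := inWM hg (inW_pred hz).
rewrite (WnormS (inWD hyh hgz) (inWM_prim (inW_Linf hg) (inW_Linf hh) yg zh)).
have e1 := IH _ _ (inW_pred hy) hh; have e2 := IH _ _ hg (inW_pred hz).
apply: (le_trans (lerD (E _ _ Ly Lz) (le_trans (WnormD hyh hgz) (lerD e1 e2)))).
have n1 := Wnorm_pred hy; have n2 := Wnorm_pred hz.
have n3 : N k g <= N k.+1 y by rewrite (WnormS hg yg) lerDr essN_ge0.
have n4 : N k h <= N k.+1 z by rewrite (WnormS hh zh) lerDr essN_ge0.
have p0 : 1 <= 3 ^+ k :> R by rewrite exprn_ege1// ler1n.
have p1 := ler_pM (essN_ge0 y) (essN_ge0 z) (essN_le_Wnorm hy) (essN_le_Wnorm hz).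
have p2 := ler_pM (Wnorm_ge0 k y) (Wnorm_ge0 k h) n1 n4.
have p3 := ler_pM (Wnorm_ge0 k g) (Wnorm_ge0 k z) n3 n2.
set Q := N k.+1 y * N k.+1 z in p1 p2 p3 *.
have Q0 : 0 <= Q by rewrite mulr_ge0 ?Wnorm_ge0.
have p3k : 0 <= 3 ^+ k :> R by rewrite exprn_ge0.
have q2 := ler_wpM2l p3k p2; have q3 := ler_wpM2l p3k p3.
have q1 := ler_wpM2r Q0 p0; rewrite mul1r in q1.
apply: (le_trans (lerD p1 (lerD q2 q3))).
rewrite exprS -mulrA; move: q1; clear; set P := _ * Q; clearbody P Q; lra.
Qed.

(** Completeness, in the form used later. The derivatives are summed by the induction hypothesis and
    the values at [a] by a numerical series; the sum is the primitive of the one with the other as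
    initial value. *)
Lemma Wnorm_series k (u : nat -> R -> R[i]) (C : R) :
  (forall j, W k (u j)) -> (forall j, N k (u j) <= C / 2 ^+ j) ->
  exists v D, W k v /\ forall n, N k (fun t => v t - \sum_(j < n) u j t) <= D / 2 ^+ n.
Proof.
elim: k u C => [|k IH] u C hu hC.
  have hL j := inW_Linf (hu j).
  have C0 : 0 <= C by have := le_trans (Wnorm_ge0 _ _) (hC 0%N); rewrite expr0 divr1.
  have [|v [Lv hv]] := @Linf_series R a b hab u C hL.
    move=> j; apply: ae_mono (essN_ae (hL j)) => t h /h /le_trans; apply.
    by rewrite -Wnorm0.
  exists v, (4 * C); split; first exact/inW0P.
  have LS n : Linf (fun t => \sum_(j < n) u j t).
    elim: n => [|n IHn].
      by apply: (@Linf_ext _ _ _ (fun _ => 0)) (Linf_cst _ _ _) => t _; rewrite big_ord0.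
    apply: (@Linf_ext _ _ _ (fun t => \sum_(j < n) u j t + u n t)); last exact: LinfD.
    by move=> t _; rewrite big_ord_recr.
  move=> n; rewrite Wnorm0; last first.
    apply: (@Linf_ext _ _ _ (fun t => v t + (-1) * \sum_(j < n) u j t)).
      by move=> t _; rewrite mulN1r.
    by apply: LinfD => //; apply: LinfM (Linf_cst _ _ _) (LS n).
  by apply: essN_le => //; rewrite divr_ge0 ?exprn_ge0 ?mulr_ge0.
have /choice[g hg] j := inWS_ex (hu j).
have hgW j : W k (g j) by case: (hg j).
have hgE j : forall t, a <= t <= b -> u j t = u j a + cprim (g j) t by case: (hg j).
have [j|v [D [hv hD]]] := IH g C hgW.
  by rewrite (le_trans _ (hC j))// (WnormS (hgW j) (hgE j)) lerDr essN_ge0.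
pose e := 1 + 4 * (b - a).
have [j|c hc] := @cgeometric_series_lim R (fun j => u j a) (e * C).
  rewrite -mulrA (le_trans (Wnorm_eval (hu j) _))//; first by rewrite lexx ltW.
  by rewrite ler_wpM2l// addr_ge0// mulr_ge0// subr_ge0 ltW.
have hD0 : 0 <= D by have := le_trans (Wnorm_ge0 _ _) (hD 0%N); rewrite expr0 divr1.
(* The error of the initial value enters once; that of the derivative enters through its own norm
   and through its primitive, which gives 1 + 2 (b - a). *)
exists (fun t => c + cprim v t), (4 * (e * C) + (1 + 2 * (b - a)) * D); split.
  exact: (inWS_prim hv).
move=> n.
have hS i : W k (fun t => \sum_(j < i) g j t).
  elim: i => [|i IHi].
    by apply: (@inW_ext _ (fun _ => 0)) (inW_cst _ _) => t _; rewrite big_ord0.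
  apply: (@inW_ext _ (fun t => \sum_(j < i) g j t + g i t)); last exact: inWD.
  by move=> t _; rewrite big_ord_recr.
have ES i t : t <= b -> cprim (fun t => \sum_(j < i) g j t) t = \sum_(j < i) cprim (g j) t.
  move=> tb; elim: i => [|i IHi].
    rewrite big_ord0 (@cprim_ext _ _ b _ (fun _ => 0)) ?cprim_cst0//.
    by move=> s _; rewrite big_ord0.
  rewrite big_ord_recr/= -IHi -(cprimD hab (inW_Linf (hS i)) (inW_Linf (hgW i)) tb).
  by apply: cprim_ext => // s _; rewrite big_ord_recr.
have hT : W k (fun t => v t - \sum_(j < n) g j t).
  apply: (@inW_ext _ (fun t => v t + (-1) * \sum_(j < n) g j t)).
    by move=> t _; rewrite mulN1r.
  by apply: inWD => //; apply: inWZ.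
have E t : a <= t <= b -> c + cprim v t - \sum_(j < n) u j t =
    (c - \sum_(j < n) u j a) + cprim (fun t => v t - \sum_(j < n) g j t) t.
  move=> tab; have /andP[_ tb] := tab.
  rewrite (@cprim_ext _ _ b (fun t => v t - \sum_(j < n) g j t)
    (fun t => v t + (-1) * \sum_(j < n) g j t) t)//; last by move=> s _; rewrite mulN1r.
  have L1 := inW_Linf (inWZ (-1) (hS n)).
  rewrite (cprimD hab (inW_Linf hv) L1 tb) (cprimZ hab _ (inW_Linf (hS n)) tb) ES//.
  rewrite (eq_bigr (fun j : 'I_n => u j a + cprim (g j) t)); last by move=> j _; rewrite hgE.
  by rewrite big_split/= mulN1r opprD addrACA.
rewrite (WnormS hT E).
have e1 : essN (fun t => c + cprim v t - \sum_(j < n) u j t) <=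
   4 * (e * C) / 2 ^+ n + 2 * (b - a) * N k (fun t => v t - \sum_(j < n) g j t).
  apply: essN_le.
    rewrite addr_ge0//; first exact: le_trans (cabs_ge0 _) (hc n).
    by rewrite !mulr_ge0 ?Wnorm_ge0// subr_ge0 ltW.
  apply: aeW => t tab; rewrite E// (le_trans (cabsD _ _))// lerD//.
  have := cprim_le hab (inW_Linf hT) (essN_ae (inW_Linf hT)) tab => /le_trans; apply.
  rewrite mulrAC ler_wpM2l ?essN_le_Wnorm// mulr_ge0// subr_ge0 ltW//.
have e2 := hD n.
have e3 : 2 * (b - a) * N k (fun t => v t - \sum_(j < n) g j t) <= 2 * (b - a) * (D / 2 ^+ n).
  by rewrite ler_wpM2l// mulr_ge0// subr_ge0 ltW.
apply: (le_trans (lerD (le_trans e1 (lerD (lexx _) e3)) e2)).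
by rewrite le_eqVlt; apply/orP; left; apply/eqP; ring.
Qed.

End scalar_sobolev.

(** * The sum norm on complex matrices *)

Section matrix_norm.
Context (R : realType).

Definition mxn (p q : nat) (M : 'M[R[i]]_(p, q)) : R :=
  \sum_(i < p) \sum_(j < q) cabs (M i j).

Lemma mxn_ge0 p q (M : 'M[R[i]]_(p, q)) : 0 <= mxn M.
Proof. by apply: sumr_ge0 => i _; apply: sumr_ge0 => j _; exact: cabs_ge0. Qed.

Lemma mxn_entry p q (M : 'M[R[i]]_(p, q)) i j : cabs (M i j) <= mxn M.
Proof.
rewrite /mxn (bigD1 i)//= (bigD1 j)//= -addrA lerDl addr_ge0//.
  by apply: sumr_ge0 => l _; exact: cabs_ge0.
by apply: sumr_ge0 => l _; apply: sumr_ge0 => l' _; exact: cabs_ge0.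
Qed.

Lemma mxn0 p q : mxn (0 : 'M[R[i]]_(p, q)) = 0.
Proof. by rewrite /mxn big1// => i _; rewrite big1// => j _; rewrite mxE cabs0. Qed.

Lemma mxn_eq0 p q (M : 'M[R[i]]_(p, q)) : mxn M <= 0 -> M = 0.
Proof.
move=> h; apply/matrixP => i j; rewrite mxE; apply: cabs0_eq0; apply/eqP.
by rewrite eq_le cabs_ge0 (le_trans (mxn_entry M i j)).
Qed.

Lemma mxnD p q (M P : 'M[R[i]]_(p, q)) : mxn (M + P) <= mxn M + mxn P.
Proof.
rewrite /mxn -big_split; apply: ler_sum => i _; rewrite -big_split.
by apply: ler_sum => j _; rewrite mxE cabsD.
Qed.

Lemma mxnN p q (M : 'M[R[i]]_(p, q)) : mxn (- M) = mxn M.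
Proof. by apply: eq_bigr => i _; apply: eq_bigr => j _; rewrite mxE cabsN. Qed.

Lemma mxnB p q (M P : 'M[R[i]]_(p, q)) : mxn (M - P) <= mxn M + mxn P.
Proof. by rewrite -[mxn P]mxnN; exact: mxnD. Qed.

Lemma mxnZ p q c (M : 'M[R[i]]_(p, q)) : mxn (c *: M) = cabs c * mxn M.
Proof.
rewrite /mxn mulr_sumr; apply: eq_bigr => i _; rewrite mulr_sumr.
by apply: eq_bigr => j _; rewrite mxE cabsM.
Qed.

Lemma sum_matmul_le p q r (x : 'I_p -> 'I_q -> R) (y : 'I_q -> 'I_r -> R) :
  (forall i k, 0 <= x i k) -> (forall k j, 0 <= y k j) ->
  \sum_i \sum_j \sum_k x i k * y k j <= (\sum_i \sum_k x i k) * (\sum_k \sum_j y k j).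
Proof.
move=> x0 y0; rewrite mulr_suml; apply: ler_sum => i _.
rewrite exchange_big mulr_suml; apply: ler_sum => k _.
rewrite -mulr_sumr ler_wpM2l//.
rewrite [leRHS](bigD1 k)//= lerDl; apply: sumr_ge0 => k' _; apply: sumr_ge0 => //.
Qed.

Lemma mxnM p q r (M : 'M[R[i]]_(p, q)) (P : 'M[R[i]]_(q, r)) :
  mxn (M *m P) <= mxn M * mxn P.
Proof.
apply: le_trans (sum_matmul_le (fun i k => cabs_ge0 (M i k)) (fun k j => cabs_ge0 (P k j))).
apply: ler_sum => i _; apply: ler_sum => j _; rewrite mxE (le_trans (cabs_sum _ _ _))//.
by apply: ler_sum => k _; rewrite cabsM.
Qed.

Lemma cvnormE m (v : 'cV[R[i]]_m) : cvnorm v = mxn v.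
Proof. by apply: eq_bigr => i _; rewrite big_ord1. Qed.

End matrix_norm.

(** * Matrix-valued Sobolev functions *)

Section matrix_sobolev.
Context (R : realType) (a b : R) (hab : a < b).
Local Notation mu := (@lebesgue_measure R).
Local Notation Linf := (Linf a b).
Local Notation cprim := (cprim a).
Local Notation W := (inW a b).
Local Notation N := (Wnorm a b).

(** Rectangular shapes cover vectors, as single columns, together with coefficient matrices, for
    which this is [inWm]. *)
Definition inWmx k p q (F : R -> 'M[R[i]]_(p, q)) : Prop :=
  forall i j, W k (fun t => F t i j).

Definition Nmx k p q (F : R -> 'M[R[i]]_(p, q)) : R :=
  \sum_(i < p) \sum_(j < q) N k (fun t => F t i j).

Definition mprim p q (F : R -> 'M[R[i]]_(p, q)) (t : R) : 'M[R[i]]_(p, q) :=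
  \matrix_(i, j) cprim (fun s => F s i j) t.

Lemma inWvP k m (y : R -> 'cV[R[i]]_m) : inWv a b k y <-> inWmx k y.
Proof. by split=> [h i j|h i]; [rewrite (ord1 j)|]; exact: h. Qed.

Lemma WnormvE k m (y : R -> 'cV[R[i]]_m) : Wnormv a b k y = Nmx k y.
Proof. by apply: eq_bigr => i _; rewrite big_ord1. Qed.

Lemma inWmx_ext k p q (F G : R -> 'M[R[i]]_(p, q)) :
  (forall t, a <= t <= b -> F t = G t) -> inWmx k F -> inWmx k G.
Proof. by move=> FG hF i j; apply: inW_ext (hF i j) => t /FG ->. Qed.

Lemma inWmx_cst k p q (C : 'M[R[i]]_(p, q)) : inWmx k (fun _ => C).
Proof. by move=> i j; exact: inW_cst. Qed.

Lemma inWmxD k p q (F G : R -> 'M[R[i]]_(p, q)) : inWmx k F -> inWmx k G ->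
  inWmx k (fun t => F t + G t).
Proof.
move=> hF hG i j; apply: (inW_ext _ (inWD hab (hF i j) (hG i j))) => t _.
by rewrite mxE.
Qed.

Lemma inWmxZ k p q c (F : R -> 'M[R[i]]_(p, q)) : inWmx k F ->
  inWmx k (fun t => c *: F t).
Proof.
move=> hF i j; apply: (inW_ext _ (inWZ hab c (hF i j))) => t _; by rewrite mxE.
Qed.

Lemma inWmxN k p q (F : R -> 'M[R[i]]_(p, q)) : inWmx k F -> inWmx k (fun t => - F t).
Proof. by move=> /(inWmxZ (-1)); apply: inWmx_ext => t _; rewrite scaleN1r. Qed.

Lemma inWmxB k p q (F G : R -> 'M[R[i]]_(p, q)) : inWmx k F -> inWmx k G ->
  inWmx k (fun t => F t - G t).
Proof. by move=> hF hG; exact: inWmxD hF (inWmxN hG). Qed.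

Lemma inW_sum k (I : Type) (r : seq I) (f : I -> R -> R[i]) :
  (forall i, W k (f i)) -> W k (fun t => \sum_(i <- r) f i t).
Proof.
move=> hf; elim: r => [|x r IH].
  by apply: (inW_ext _ (inW_cst hab k 0)) => t _; rewrite big_nil.
by apply: (inW_ext _ (inWD hab (hf x) IH)) => t _; rewrite big_cons.
Qed.

Lemma Wnorm_sum k (I : Type) (r : seq I) (f : I -> R -> R[i]) :
  (forall i, W k (f i)) ->
  N k (fun t => \sum_(i <- r) f i t) <= \sum_(i <- r) N k (f i).
Proof.
move=> hf; elim: r => [|x r IH].
  have -> : N k (fun t => \sum_(i <- [::]) f i t) = N k (fun _ => 0).
    by apply: (Wnorm_ext hab _ (inW_sum _ hf)) => t _; rewrite big_nil.
  by rewrite big_nil -(@cabs0 R) Wnorm_cst.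
have -> : N k (fun t => \sum_(i <- x :: r) f i t) = N k (fun t => f x t + \sum_(i <- r) f i t).
  by apply: (Wnorm_ext hab _ (inW_sum _ hf)) => t _; rewrite big_cons.
rewrite big_cons; apply: (le_trans (WnormD hab (hf x) (inW_sum r hf))).
by rewrite lerD2l.
Qed.

Lemma inWmxM k p q r (F : R -> 'M[R[i]]_(p, q)) (G : R -> 'M[R[i]]_(q, r)) :
  inWmx k F -> inWmx k G -> inWmx k (fun t => F t *m G t).
Proof.
move=> hF hG i j.
have h := inW_sum (index_enum 'I_q) (fun l => inWM hab (hF i l) (hG l j)).
by apply: (inW_ext _ h) => t _; rewrite mxE.
Qed.

Lemma inWmx_sum k p q (U : nat -> R -> 'M[R[i]]_(p, q)) n : (forall j, inWmx k (U j)) ->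
  inWmx k (fun t => \sum_(j < n) U j t).
Proof.
move=> hU i j; have h := inW_sum (index_enum 'I_n) (fun l : 'I_n => hU l i j).
by apply: (inW_ext _ h) => t _; rewrite summxE.
Qed.

Lemma inWmx_pred k p q (F : R -> 'M[R[i]]_(p, q)) : inWmx k.+1 F -> inWmx k F.
Proof. by move=> hF i j; exact: inW_pred. Qed.

Lemma inWmx_le j k p q (F : R -> 'M[R[i]]_(p, q)) : (j <= k)%N -> inWmx k F -> inWmx j F.
Proof.
move=> /subnK <-; elim: (k - j)%N => [//|i IH] h.
by apply/IH/inWmx_pred.
Qed.

Lemma inWmx_prim k p q (F : R -> 'M[R[i]]_(p, q)) : inWmx k F -> inWmx k.+1 (mprim F).
Proof.
by move=> hF i j; apply: (inW_ext _ (inW_prim hab (hF i j))) => t _; rewrite mxE.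
Qed.

Lemma inWmxS_ex k p q (F : R -> 'M[R[i]]_(p, q)) : inWmx k.+1 F ->
  exists G, inWmx k G /\ forall t, a <= t <= b -> F t = F a + mprim G t.
Proof.
move=> hF.
have /choice[g hg] : forall ij : 'I_p * 'I_q, exists g, W k g /\
    forall t, a <= t <= b -> F t ij.1 ij.2 = F a ij.1 ij.2 + cprim g t.
  by move=> [i j]; exact: (inWS_ex hab (hF i j)).
exists (fun t => \matrix_(i, j) g (i, j) t); split.
  by move=> i j; have [h _] := hg (i, j); apply: (inW_ext _ h) => t _; rewrite mxE.
move=> t tab; apply/matrixP => i j; rewrite !mxE; have [_ /(_ t tab)/= ->] := hg (i, j).
have /andP[_ tb] := tab.
congr (_ + _); apply: (@cprim_ext _ _ b) => // s _; by rewrite mxE.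
Qed.

Lemma Nmx_ge0 k p q (F : R -> 'M[R[i]]_(p, q)) : 0 <= Nmx k F.
Proof. by apply: sumr_ge0 => i _; apply: sumr_ge0 => j _; exact: Wnorm_ge0. Qed.

Lemma Nmx_ext k p q (F G : R -> 'M[R[i]]_(p, q)) :
  (forall t, a <= t <= b -> F t = G t) -> inWmx k F -> Nmx k F = Nmx k G.
Proof.
move=> FG hF; apply: eq_bigr => i _; apply: eq_bigr => j _.
by apply: (Wnorm_ext hab _ (hF i j)) => t /FG ->.
Qed.

Lemma NmxD k p q (F G : R -> 'M[R[i]]_(p, q)) : inWmx k F -> inWmx k G ->
  Nmx k (fun t => F t + G t) <= Nmx k F + Nmx k G.
Proof.
move=> hF hG; rewrite /Nmx -big_split; apply: ler_sum => i _; rewrite -big_split.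
apply: ler_sum => j _ /=.
rewrite (Wnorm_ext hab (z := fun t => F t i j + G t i j)); first exact: (WnormD hab (hF i j) (hG i j)).
  by move=> t _; rewrite mxE.
exact: (inWmxD hF hG i j).
Qed.

Lemma NmxZ k p q c (F : R -> 'M[R[i]]_(p, q)) : inWmx k F ->
  Nmx k (fun t => c *: F t) <= cabs c * Nmx k F.
Proof.
move=> hF; rewrite /Nmx mulr_sumr; apply: ler_sum => i _; rewrite mulr_sumr.
apply: ler_sum => j _.
rewrite (Wnorm_ext hab (z := fun t => c * F t i j)); first exact: (WnormZ hab c (hF i j)).
  by move=> t _; rewrite mxE.
exact: (inWmxZ c hF i j).
Qed.

Lemma cabsN1 : cabs (-1 : R[i]) = 1.
Proof. by rewrite cabsN cabs1. Qed.

Lemma NmxN k p q (F : R -> 'M[R[i]]_(p, q)) : inWmx k F -> Nmx k (fun t => - F t) <= Nmx k F.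
Proof.
move=> hF; rewrite (Nmx_ext (G := fun t => (-1) *: F t)); last exact: inWmxN.
  by rewrite (le_trans (NmxZ _ hF))// cabsN1 mul1r.
by move=> t _; rewrite scaleN1r.
Qed.

Lemma NmxB k p q (F G : R -> 'M[R[i]]_(p, q)) : inWmx k F -> inWmx k G ->
  Nmx k (fun t => F t - G t) <= Nmx k F + Nmx k G.
Proof.
move=> hF hG; apply: le_trans (NmxD hF (inWmxN hG)) _.
by rewrite lerD2l; exact: NmxN.
Qed.

Lemma NmxM k p q r (F : R -> 'M[R[i]]_(p, q)) (G : R -> 'M[R[i]]_(q, r)) :
  inWmx k F -> inWmx k G ->
  Nmx k (fun t => F t *m G t) <= 3 ^+ k * (Nmx k F * Nmx k G).
Proof.
move=> hF hG.
have p3 : 0 <= 3 ^+ k :> R by rewrite exprn_ge0.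
have key : \sum_i \sum_j \sum_l N k (fun t => F t i l) * N k (fun t => G t l j) <=
    Nmx k F * Nmx k G.
  by apply: sum_matmul_le => ? ?; exact: Wnorm_ge0.
apply: le_trans (ler_wpM2l p3 key).
rewrite mulr_sumr; apply: ler_sum => i _; rewrite mulr_sumr; apply: ler_sum => j _.
have hW l := inWM hab (hF i l) (hG l j).
rewrite (Wnorm_ext hab (z := fun t => \sum_l F t i l * G t l j)); last 2 first.
- by move=> t _; rewrite mxE.
- exact: (inWmxM hF hG i j).
rewrite (le_trans (Wnorm_sum _ hW))// mulr_sumr; apply: ler_sum => l _.
exact: (WnormM hab (hF i l) (hG l j)).
Qed.

Lemma Nmx_pred k p q (F : R -> 'M[R[i]]_(p, q)) : inWmx k.+1 F -> Nmx k F <= Nmx k.+1 F.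
Proof. by move=> hF; apply: ler_sum => i _; apply: ler_sum => j _; exact: Wnorm_pred. Qed.

Lemma Nmx_cst k p q (C : 'M[R[i]]_(p, q)) : Nmx k (fun _ => C) <= mxn C.
Proof. by apply: ler_sum => i _; apply: ler_sum => j _; exact: Wnorm_cst. Qed.

Lemma Nmx_subrr k p q (F : R -> 'M[R[i]]_(p, q)) : Nmx k (fun t => F t - F t) = 0.
Proof.
have -> : (fun t => F t - F t) = (fun _ => 0) by apply/funext => t; rewrite subrr.
apply/eqP; rewrite eq_le Nmx_ge0 andbT.
by have := Nmx_cst k (0 : 'M[R[i]]_(p, q)); rewrite mxn0.
Qed.

Lemma Nmx_cols k p q (F : R -> 'M[R[i]]_(p, q)) :
  Nmx k F = \sum_j Nmx k (fun t => col j (F t)).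
Proof.
rewrite /Nmx exchange_big; apply: eq_bigr => j _; apply: eq_bigr => i _.
by rewrite big_ord1; congr (N k _); apply/funext => t; rewrite mxE.
Qed.

Lemma Nmx_prim k p q (F : R -> 'M[R[i]]_(p, q)) : inWmx k F ->
  Nmx k.+1 (mprim F) <= (1 + 2 * (b - a)) * Nmx k F.
Proof.
move=> hF; rewrite /Nmx mulr_sumr; apply: ler_sum => i _; rewrite mulr_sumr.
apply: ler_sum => j _.
rewrite (Wnorm_ext hab (z := cprim (fun t => F t i j))); first exact: (Wnorm_prim hab (hF i j)).
  by move=> t _; rewrite mxE.
exact: (inWmx_prim hF i j).
Qed.

Lemma Nmx_eval k p q (F : R -> 'M[R[i]]_(p, q)) t : inWmx k.+1 F -> a <= t <= b ->
  mxn (F t) <= (1 + 4 * (b - a)) * Nmx k.+1 F.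
Proof.
move=> hF tab; rewrite /Nmx mulr_sumr; apply: ler_sum => i _; rewrite mulr_sumr.
by apply: ler_sum => j _; exact: (Wnorm_eval hab (hF i j) tab).
Qed.

Lemma Nmx_deriv k p q (F G : R -> 'M[R[i]]_(p, q)) C : inWmx k G ->
  (forall t, a <= t <= b -> F t = C + mprim G t) -> Nmx k G <= Nmx k.+1 F.
Proof.
move=> hG FG; apply: ler_sum => i _; apply: ler_sum => j _.
rewrite (WnormS hab (y := fun t => F t i j) (c := C i j) (hG i j)).
  by rewrite lerDr essN_ge0.
by move=> t /FG ->; rewrite !mxE.
Qed.

Lemma inWmx_prim_eq k p q (F G : R -> 'M[R[i]]_(p, q)) C : inWmx k G ->
  (forall t, a <= t <= b -> F t = C + mprim G t) -> inWmx k.+1 F.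
Proof.
move=> hG FG i j; apply: (inWS_prim hab (hG i j) (c := C i j)) => t /FG ->.
by rewrite !mxE.
Qed.

Lemma mprim_start p q (F : R -> 'M[R[i]]_(p, q)) : mprim F a = 0.
Proof. by apply/matrixP => i j; rewrite !mxE cprim_start. Qed.

Lemma mprim_cst0 p q t : mprim (fun _ => 0 : 'M[R[i]]_(p, q)) t = 0.
Proof.
by apply/matrixP => i j; rewrite !mxE; exact: cprim_cst0.
Qed.

Lemma mprim_ext p q (F G : R -> 'M[R[i]]_(p, q)) t :
  (forall t, a <= t <= b -> F t = G t) -> t <= b -> mprim F t = mprim G t.
Proof.
by move=> FG tb; apply/matrixP => i j; rewrite !mxE; apply: (@cprim_ext _ _ b) => // s /FG ->.
Qed.

Lemma mprimD k p q (F G : R -> 'M[R[i]]_(p, q)) t : inWmx k F -> inWmx k G -> t <= b ->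
  mprim (fun s => F s + G s) t = mprim F t + mprim G t.
Proof.
move=> hF hG tb; apply/matrixP => i j; rewrite !mxE.
rewrite -(cprimD hab (inW_Linf hab (hF i j)) (inW_Linf hab (hG i j)) tb).
by apply: (@cprim_ext _ _ b) => // s _; rewrite mxE.
Qed.

Lemma mprimZ k p q c (F : R -> 'M[R[i]]_(p, q)) t : inWmx k F -> t <= b ->
  mprim (fun s => c *: F s) t = c *: mprim F t.
Proof.
move=> hF tb; apply/matrixP => i j; rewrite !mxE.
rewrite -(cprimZ hab c (inW_Linf hab (hF i j)) tb).
by apply: (@cprim_ext _ _ b) => // s _; rewrite mxE.
Qed.

Lemma mprimN k p q (F : R -> 'M[R[i]]_(p, q)) t : inWmx k F -> t <= b ->
  mprim (fun s => - F s) t = - mprim F t.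
Proof.
move=> hF tb; rewrite -scaleN1r -(mprimZ (-1) hF tb).
by apply: mprim_ext => // s _; rewrite scaleN1r.
Qed.

Lemma mprimB k p q (F G : R -> 'M[R[i]]_(p, q)) t : inWmx k F -> inWmx k G -> t <= b ->
  mprim (fun s => F s - G s) t = mprim F t - mprim G t.
Proof. by move=> hF hG tb; rewrite (mprimD hF (inWmxN hG) tb) (mprimN hG tb). Qed.

Lemma cprim_sum (I : Type) (r : seq I) (f : I -> R -> R[i]) t :
  (forall i, Linf (f i)) -> t <= b ->
  cprim (fun s => \sum_(i <- r) f i s) t = \sum_(i <- r) cprim (f i) t.
Proof.
move=> hf tb.
have hS r' : Linf (fun s => \sum_(i <- r') f i s).
  by apply/(inW0P hab)/inW_sum => i; apply/(inW0P hab).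
elim: r => [|x r IH].
  rewrite big_nil (@cprim_ext _ _ b _ (fun _ => 0))// ?cprim_cst0// => s _.
  by rewrite big_nil.
rewrite big_cons -IH -(cprimD hab (hf x) (hS r) tb).
by apply: (@cprim_ext _ _ b) => // s _; rewrite big_cons.
Qed.

Lemma mprimM k p q r (F F' : R -> 'M[R[i]]_(p, q)) (G G' : R -> 'M[R[i]]_(q, r)) :
  inWmx k F' -> inWmx k G' ->
  (forall t, a <= t <= b -> F t = F a + mprim F' t) ->
  (forall t, a <= t <= b -> G t = G a + mprim G' t) ->
  forall t, a <= t <= b ->
  F t *m G t = F a *m G a + mprim (fun t => F t *m G' t + F' t *m G t) t.
Proof.
move=> hF' hG' EF EG t tab; have /andP[_ tb] := tab.
have LF' i l := inW_Linf hab (hF' i l); have LG' l j := inW_Linf hab (hG' l j).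
have hF := inWmx_prim_eq hF' EF; have hG := inWmx_prim_eq hG' EG.
have LF i l := inW_Linf hab (hF i l); have LG l j := inW_Linf hab (hG l j).
apply/matrixP => i j; rewrite !mxE.
have E l : F t i l * G t l j = F a i l * G a l j +
    cprim (fun t => F t i l * G' t l j + F' t i l * G t l j) t.
  apply: (inWM_prim hab (LF' i l) (LG' l j) (y := fun t => F t i l)
      (z := fun t => G t l j)) => // s sab.
    by rewrite {1}(EF s sab) !mxE.
  by rewrite {1}(EG s sab) !mxE.
rewrite (eq_bigr _ (fun l _ => E l)) big_split; congr (_ + _).
rewrite -cprim_sum// => [|l]; last exact: LinfD (LinfM (LF _ _) (LG' _ _)) (LinfM (LF' _ _) (LG _ _)).
by apply: (@cprim_ext _ _ b) => // s _; rewrite !mxE -big_split.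
Qed.

Lemma ae_ord n (P : 'I_n -> R -> Prop) : (forall i, \forall t \ae mu, P i t) ->
  \forall t \ae mu, forall i, P i t.
Proof.
move=> h.
have : \forall t \ae mu, forall k : nat, forall hk : (k < n)%N, P (Ordinal hk) t.
  apply/ae_foralln => k; have /orP[kn|kn] := orbN (k < n)%N.
    by apply: ae_mono (h (Ordinal kn)) => t ht hk; rewrite (bool_irrelevance hk kn).
  by apply: aeW => t hk; move: kn; rewrite hk.
by apply: ae_mono => t ht [k hk]; exact: ht.
Qed.

Lemma mxn_ae p q (F : R -> 'M[R[i]]_(p, q)) : inWmx 0 F ->
  \forall t \ae mu, a <= t <= b -> mxn (F t) <= Nmx 0 F.
Proof.
move=> hF.
have h : \forall t \ae mu, forall i j, a <= t <= b -> cabs (F t i j) <= N 0 (fun t => F t i j).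
  apply: ae_ord => i; apply: ae_ord => j; have L := inW_Linf hab (hF i j).
  by rewrite (Wnorm0 hab L); exact: essN_ae.
apply: ae_mono h => t h tab; apply: ler_sum => i _; apply: ler_sum => j _.
exact: h.
Qed.

Lemma Nmx0_le p q (F : R -> 'M[R[i]]_(p, q)) (r : R) : inWmx 0 F -> 0 <= r ->
  (\forall t \ae mu, a <= t <= b -> mxn (F t) <= r) -> Nmx 0 F <= (p * q)%:R * r.
Proof.
move=> hF r0 h; apply: (@le_trans _ _ (\sum_(i < p) \sum_(j < q) r)).
  apply: ler_sum => i _; apply: ler_sum => j _; rewrite (Wnorm0 hab (inW_Linf hab (hF i j))).
  by apply: (essN_le hab) => //; apply: ae_mono h => t h /h; apply: le_trans (mxn_entry _ _ _).
by rewrite sumr_const sumr_const !card_ord -mulrnA mulr_natl mulnC.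
Qed.

Lemma Nmx_series k p q (U : nat -> R -> 'M[R[i]]_(p, q)) (C : R) :
  (forall j, inWmx k (U j)) -> (forall j, Nmx k (U j) <= C / 2 ^+ j) ->
  exists V D, inWmx k V /\ forall n, Nmx k (fun t => V t - \sum_(j < n) U j t) <= D / 2 ^+ n.
Proof.
move=> hU hC.
have /choice[v hv] : forall ij : 'I_p * 'I_q, exists vD : (R -> R[i]) * R, W k vD.1 /\
    forall n, N k (fun t => vD.1 t - \sum_(l < n) U l t ij.1 ij.2) <= vD.2 / 2 ^+ n.
  move=> [i j]; have [|v [D h]] := @Wnorm_series R a b hab k (fun l t => U l t i j) C
    (fun l => hU l i j); last by exists (v, D).
  move=> l; apply: le_trans (hC l); rewrite /Nmx (bigD1 i)//= (bigD1 j)//= -addrA lerDl.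
  rewrite addr_ge0//; first by apply: sumr_ge0 => ? _; exact: Wnorm_ge0.
  by apply: sumr_ge0 => ? _; apply: sumr_ge0 => ? _; exact: Wnorm_ge0.
exists (fun t => \matrix_(i, j) (v (i, j)).1 t), (\sum_i \sum_j (v (i, j)).2).
have hV : inWmx k (fun t => \matrix_(i, j) (v (i, j)).1 t).
  by move=> i j; have [h _] := hv (i, j); apply: (inW_ext _ h) => t _; rewrite mxE.
split=> // n; rewrite /Nmx mulr_suml; apply: ler_sum => i _; rewrite mulr_suml.
apply: ler_sum => j _; have [_ /(_ n)] := hv (i, j); apply: le_trans.
rewrite (Wnorm_ext hab (z := fun t => (v (i, j)).1 t - \sum_(l < n) U l t i j))//.
- by move=> t _; rewrite !mxE summxE.
- exact: (inWmxB hV (inWmx_sum n hU) i j).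
Qed.

End matrix_sobolev.

(** * Linear Cauchy problems *)

Section linear_ode.
Context (R : realType) (a b : R) (hab : a < b).
Local Notation mu := (@lebesgue_measure R).
Local Notation mprim := (mprim a).
Local Notation inWmx := (inWmx a b).
Local Notation Nmx := (Nmx a b).

(* Picard iterates: in the norm weighted by [expR (- k * t)], with k large, the
   Volterra operator contracts by the factor 1/2. *)
Fixpoint picard m q (A : R -> 'M[R[i]]_m) (Q : 'M[R[i]]_(m, q)) (j : nat) : R -> 'M[R[i]]_(m, q) :=
  if j is j'.+1 then fun t => - mprim (fun s => A s *m picard A Q j' s) t
  else fun _ => Q.

Lemma inWmx_picard m q (A : R -> 'M[R[i]]_m) (Q : 'M[R[i]]_(m, q)) j :
  inWmx 0 A -> inWmx 0 (picard A Q j).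
Proof.
move=> hA; elim: j => [|j IH] /=; first exact: inWmx_cst.
apply: (inWmx_pred hab); apply: (inWmxN hab); apply: (inWmx_prim hab).
exact: (inWmxM hab hA IH).
Qed.

Lemma mxn_mprim_exp p q (F : R -> 'M[R[i]]_(p, q)) (k M t : R) :
  0 < k -> 0 <= M -> inWmx 0 F ->
  (\forall t \ae mu, a <= t <= b -> mxn (F t) <= M * expR (k * t)) ->
  a <= t <= b -> mxn (mprim F t) <= (p * q)%:R * (2 * (M * expR (k * t) / k)).
Proof.
move=> k0 M0 hF hM tab.
apply: (@le_trans _ _ (\sum_(i < p) \sum_(j < q) (2 * (M * expR (k * t) / k)))).
  apply: ler_sum => i _; apply: ler_sum => j _; rewrite mxE.
  apply: (cprim_exp hab) => //; first exact: (inW_Linf hab (hF i j)).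
  by apply: ae_mono hM => s h /h; apply: le_trans (mxn_entry _ _ _).
by set x := 2 * _; rewrite !sumr_const !card_ord -mulrnA mulr_natl mulnC.
Qed.

Lemma picard_bound m q (A : R -> 'M[R[i]]_m) (Q : 'M[R[i]]_(m, q)) : inWmx 0 A ->
  exists k M : R, [/\ 0 < k, 0 <= M & forall j t, a <= t <= b ->
    mxn (picard A Q j t) <= M / 2 ^+ j * expR (k * t)].
Proof.
move=> hA; pose L := Nmx 0 A; have L0 : 0 <= L := Nmx_ge0 hab _ _.
pose c : R := (m * q)%:R; have c0 : 0 <= c by [].
(* One iteration costs the factor 2 c L / k, where [c] counts the entries; this [k] keeps it below
   1/2. *)
pose k := 4 * c * L + 1.
have k0 : 0 < k by rewrite ltr_wpDl// !mulr_ge0.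
(* Normalized so that the weighted bound equals [mxn Q] at [a], which settles the constant
   iterate. *)
pose M := mxn Q * expR (- (k * a)).
have M0 : 0 <= M by rewrite mulr_ge0 ?mxn_ge0 ?expR_ge0.
exists k, M; split=> //; elim=> [|j IH] t tab.
  rewrite expr0 divr1 /M -mulrA -expRD /=; rewrite ler_peMr ?mxn_ge0//.
  have /andP[at_ _] := tab.
  by rewrite -expR0 ler_expR addrC -mulrBr mulr_ge0 ?subr_ge0// ltW.
rewrite /= mxnN.
have Mj0 : 0 <= M / 2 ^+ j by rewrite divr_ge0 ?exprn_ge0.
have hP := inWmxM hab hA (inWmx_picard Q j hA).
have hb : \forall t \ae mu, a <= t <= b ->
    mxn (A t *m picard A Q j t) <= L * (M / 2 ^+ j) * expR (k * t).
  apply: ae_mono (mxn_ae hab hA) => s hs sab; apply: le_trans (mxnM _ _) _.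
  by rewrite -mulrA; apply: ler_pM; rewrite ?mxn_ge0 ?hs ?IH.
apply: le_trans (mxn_mprim_exp k0 (mulr_ge0 L0 Mj0) hP hb tab) _.
rewrite -/c exprS invfM; set E := expR _; have E0 : 0 <= E := expR_ge0 _.
set x := M / 2 ^+ j in Mj0 *.
have -> : c * (2 * (L * x * E / k)) = (2 * c * L / k) * (x * E) by rewrite -!mulrA; ring.
have -> : M * (2^-1 / 2 ^+ j) * E = 2^-1 * (x * E).
  have swap (u v w e : R) : u * (v * w) * e = v * (u * w * e) by ring.
  exact: swap.
apply: ler_wpM2r; first exact: mulr_ge0.
by rewrite ler_pdivrMr// /k; lra.
Qed.

(** The sum [V] of the Picard series has a residual [E] of norm zero, so it solves the equation only
    almost everywhere. Applying the Volterra operator once more gives a representative for which the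
    equation holds at every point. *)
Lemma volterra_exists m q (A : R -> 'M[R[i]]_m) (Q : 'M[R[i]]_(m, q)) : inWmx 0 A ->
  exists X, inWmx 0 X /\
    forall t, a <= t <= b -> X t = Q - mprim (fun s => A s *m X s) t.
Proof.
move=> hA; have [k [M [k0 M0 hM]]] := picard_bound Q hA.
pose U := picard A Q; have hU j : inWmx 0 (U j) := inWmx_picard Q j hA.
pose C := (m * q)%:R * (M * expR (k * b)).
have hC j : Nmx 0 (U j) <= C / 2 ^+ j.
  rewrite /C -mulrA mulrAC; apply: (Nmx0_le hab (hU j)).
    by rewrite mulr_ge0 ?expR_ge0// divr_ge0 ?exprn_ge0.
  apply: aeW => t tab; apply: le_trans (hM j t tab) _.
  apply: ler_wpM2l; first by rewrite divr_ge0 ?exprn_ge0.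
  by have /andP[_ tb] := tab; rewrite ler_expR ler_wpM2l// ltW.
have [V [D [hV hD]]] := Nmx_series hab hU hC.
pose S n t := \sum_(j < n) U j t.
have hS n : inWmx 0 (S n) := inWmx_sum hab n hU.
have hAV := inWmxM hab hA hV; have hAS n := inWmxM hab hA (hS n).
have SE n t : t <= b -> S n.+1 t = Q - mprim (fun s => A s *m S n s) t.
  move=> tb; elim: n => [|n IH].
    rewrite /S big_ord1 (@mprim_ext _ a b _ _ _ (fun _ => 0))//; last first.
      by move=> s _; rewrite big_ord0 mulmx0.
    by rewrite mprim_cst0 subr0.
  rewrite {1}/S big_ord_recr -/(S n.+1 t) IH /= -addrA -opprD; congr (_ - _).
  rewrite -(mprimD hab (hAS n) (inWmxM hab hA (hU n)) tb).
  by apply: (@mprim_ext _ a b) => // s _; rewrite /S big_ord_recr mulmxDr.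
pose E t := V t - (Q - mprim (fun s => A s *m V s) t).
have hmAV := inWmx_pred hab (inWmx_prim hab hAV).
have hE : inWmx 0 E.
  by apply: (inWmxB hab hV); apply: (inWmxB hab _ hmAV); exact: inWmx_cst.
pose K := (1 + 2 * (b - a)) * (3 ^+ 0 * Nmx 0 A).
have K0 : 0 <= K.
  by rewrite !mulr_ge0 ?exprn_ge0 ?Nmx_ge0// addr_ge0// mulr_ge0// subr_ge0 ltW.
(* Subtracting the exact identity for [S n.+1] leaves the error of that partial sum and the image of
   the error of [S n] under the Volterra operator, whose norm is at most [K]. *)
have hEn n : Nmx 0 E <= (D + K * D) / 2 ^+ n.
  pose G t := V t - S n.+1 t; pose H t := V t - S n t.
  have hG : inWmx 0 G := inWmxB hab hV (hS n.+1).
  have hH : inWmx 0 H := inWmxB hab hV (hS n).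
  have hAH := inWmxM hab hA hH.
  rewrite (Nmx_ext hab (G := fun t => G t + mprim (fun s => A s *m H s) t) _ hE); last first.
    move=> t tab; have /andP[_ tb] := tab.
    rewrite /E /G SE// (@mprim_ext _ a b _ _ (fun s => A s *m H s) (fun s => A s *m V s - A s *m S n s) t)//; last first.
      by move=> s _; rewrite /H mulmxBr.
    rewrite (mprimB hab hAV (hAS n) tb) !opprB [RHS]addrA.
    by rewrite -!addrA; congr (_ + _); rewrite [RHS]addrC -!addrA addNr addr0 addrC.
  have hmH := inWmx_prim hab hAH.
  apply: le_trans (NmxD hab hG (inWmx_pred hab hmH)) _.
  rewrite mulrDl; apply: lerD.
    apply: le_trans (hD n.+1) _; have := le_trans (Nmx_ge0 hab _ _) (hD 0%N).
    rewrite expr0 divr1 => D0; rewrite ler_wpM2l// lef_pV2 ?posrE ?exprn_gt0//.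
    by rewrite exprS ler_peMl ?exprn_ge0// ler1n.
  apply: le_trans (Nmx_pred hab hmH) _; apply: le_trans (Nmx_prim hab hAH) _.
  rewrite -mulrA /K -mulrA ler_wpM2l//.
    by rewrite addr_ge0// mulr_ge0// subr_ge0 ltW.
  apply: le_trans (NmxM hab hA hH) _.
  by rewrite -mulrA ler_wpM2l ?exprn_ge0// ler_wpM2l ?Nmx_ge0// hD.
have E0 : Nmx 0 E = 0.
  apply/eqP; rewrite eq_le (Nmx_ge0 hab) andbT leNgt; apply/negP => e0.
  have h n : `|0 - Nmx 0 E| <= (D + K * D) / 2 ^+ n by rewrite sub0r normrN ger0_norm ?Nmx_ge0.
  have := @geometric_bound_cvg R (fun _ => Nmx 0 E) 0 (D + K * D) h.
  move=> /(cvg_lim (@Rhausdorff R)); rewrite lim_cst; last exact: Rhausdorff.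
  by move=> e; rewrite e ltxx in e0.
have VE : \forall t \ae mu, a <= t <= b -> V t = Q - mprim (fun s => A s *m V s) t.
  apply: ae_mono (mxn_ae hab hE) => t h tab; apply/eqP; rewrite -subr_eq0; apply/eqP.
  by apply: mxn_eq0; rewrite -E0; exact: h.
pose X t := Q - mprim (fun s => A s *m V s) t.
have hX : inWmx 0 X by apply: (inWmxB hab _ hmAV); exact: inWmx_cst.
exists X; split; first exact: hX.
move=> t tab; rewrite {1}/X; congr (_ - _); apply/matrixP => i j; rewrite !mxE.
have /andP[_ tb] := tab.
have hAX := inWmxM hab hA hX.
apply: (cprim_ae (inW_Linf hab (hAV i j)) (inW_Linf hab (hAX i j)) _ tb).
by apply: ae_mono VE => s h sab; rewrite {1}h.
Qed.

(** Bootstrapping: each passage through the integral gains one derivative, as long as A has the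
    regularity to let A X keep that of X. *)
Lemma volterra_regular k m q (A : R -> 'M[R[i]]_m) (X : R -> 'M[R[i]]_(m, q)) Q :
  inWmx k A -> inWmx 0 X ->
  (forall t, a <= t <= b -> X t = Q - mprim (fun s => A s *m X s) t) -> inWmx k.+1 X.
Proof.
move=> hA hX XE.
suff h j : (j <= k.+1)%N -> inWmx j X by exact: h.
elim: j => [//|j IH] jk; have hAj := inWmx_le hab (jk : (j <= k)%N) hA.
have hAX := inWmxM hab hAj (IH (ltnW jk)).
apply: (inWmx_prim_eq hab (inWmxN hab hAX) (C := Q)) => t tab; have /andP[_ tb] := tab.
by rewrite (mprimN hab hAX tb) XE.
Qed.

(** [Z] is the transpose of a solution for the coefficient -A^T. The product rule gives (Z X)' = Z A
    X - Z A X = 0, hence Z X = 1, and X Z = 1 because the matrices are square. *)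
Lemma fundamental_matrix k m (A : R -> 'M[R[i]]_m) : inWmx k A ->
  exists X Z : R -> 'M[R[i]]_m, [/\ inWmx k.+1 X, inWmx k.+1 Z,
    forall t, a <= t <= b -> X t = 1%:M + mprim (fun s => - (A s *m X s)) t,
    forall t, a <= t <= b -> Z t = 1%:M + mprim (fun s => Z s *m A s) t &
    forall t, a <= t <= b -> X t *m Z t = 1%:M /\ Z t *m X t = 1%:M].
Proof.
move=> hA; have hA0 := inWmx_le hab (leq0n k) hA.
have [X [hX0 XE]] := volterra_exists 1%:M hA0.
have hX := volterra_regular hA hX0 XE.
pose B s := - (A s)^T.
have hB : inWmx k B.
  apply: (inWmxN hab) => i j; apply: (inW_ext _ (hA j i)) => t _; by rewrite mxE.
have [Y [hY0 YE]] := volterra_exists 1%:M (inWmx_le hab (leq0n k) hB).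
have hY := volterra_regular hB hY0 YE.
pose Z t := (Y t)^T.
have hZ : inWmx k.+1 Z.
  by move=> i j; apply: (inW_ext _ (hY j i)) => t _; rewrite mxE.
have hAX := inWmxM hab hA (inWmx_pred hab hX).
have hZA := inWmxM hab (inWmx_pred hab hZ) hA.
have XE' t : a <= t <= b -> X t = 1%:M + mprim (fun s => - (A s *m X s)) t.
  by move=> tab; have /andP[_ tb] := tab; rewrite (mprimN hab hAX tb) {1}XE.
have ZE t : a <= t <= b -> Z t = 1%:M + mprim (fun s => Z s *m A s) t.
  move=> tab; have /andP[_ tb] := tab; have hBY := inWmxM hab hB (inWmx_pred hab hY).
  rewrite /Z {1}YE// -(mprimN hab hBY tb) linearD /= trmx1; congr (_ + _).
  apply/matrixP => i j; rewrite !mxE; apply: (@cprim_ext _ _ b) => // s _.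
  by rewrite /B mulNmx opprK !mxE; apply: eq_bigr => l _; rewrite !mxE mulrC.
have aab : a <= a <= b by rewrite lexx ltW.
have Xa : X a = 1%:M by rewrite XE' // mprim_start addr0.
have Za : Z a = 1%:M by rewrite ZE // mprim_start addr0.
have ZX t : a <= t <= b -> Z t *m X t = 1%:M.
  move=> tab; have /andP[_ tb] := tab.
  have EX s : a <= s <= b -> X s = X a + mprim (fun s => - (A s *m X s)) s by rewrite Xa; exact: XE'.
  have EZ s : a <= s <= b -> Z s = Z a + mprim (fun s => Z s *m A s) s by rewrite Za; exact: ZE.
  rewrite (mprimM hab hZA (inWmxN hab hAX) EZ EX tab) Xa Za mulmx1.
  rewrite (@mprim_ext _ a b _ _ _ (fun _ => 0))// ?mprim_cst0 ?addr0// => s _.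
  by rewrite mulmxN mulmxA addNr.
exists X, Z; split=> // t tab; split; last exact: ZX.
by apply: mulmx1C; exact: ZX.
Qed.

Section cauchy.
Context (k m : nat) (A X Z : R -> 'M[R[i]]_m).
Context (hA : inWmx k A) (hX : inWmx k.+1 X) (hZ : inWmx k.+1 Z).
Context (XE : forall t, a <= t <= b -> X t = 1%:M + mprim (fun s => - (A s *m X s)) t).
Context (ZE : forall t, a <= t <= b -> Z t = 1%:M + mprim (fun s => Z s *m A s) t).
Context (XZ : forall t, a <= t <= b -> X t *m Z t = 1%:M /\ Z t *m X t = 1%:M).

Let aab : a <= a <= b. Proof. by rewrite lexx ltW. Qed.

Lemma fundamental_start : X a = 1%:M /\ Z a = 1%:M.
Proof. by rewrite XE// ZE// !mprim_start !addr0. Qed.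

(** Variation of constants: y = X V with V' = Z f. *)
Lemma cauchy_solve q (f : R -> 'M[R[i]]_(m, q)) (c : 'M[R[i]]_(m, q)) : inWmx k f ->
  exists y, [/\ inWmx k.+1 y, y a = c &
    forall t, a <= t <= b -> y t = y a + mprim (fun s => f s - A s *m y s) t].
Proof.
move=> hf; have [Xa Za] := fundamental_start.
have hZf := inWmxM hab (inWmx_pred hab hZ) hf.
pose V t := c + mprim (fun s => Z s *m f s) t.
have Va : V a = c by rewrite /V mprim_start addr0.
have hV : inWmx k.+1 V by apply: (inWmx_prim_eq hab hZf (C := c)).
have EX s : a <= s <= b -> X s = X a + mprim (fun s => - (A s *m X s)) s by rewrite Xa; exact: XE.
have EV s : a <= s <= b -> V s = V a + mprim (fun s => Z s *m f s) s by rewrite Va.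
have hAX := inWmxN hab (inWmxM hab hA (inWmx_pred hab hX)).
exists (fun t => X t *m V t); split; [exact: inWmxM hX hV|by rewrite Xa Va mul1mx|].
move=> t tab; have /andP[_ tb] := tab.
rewrite (mprimM hab hAX hZf EX EV tab); congr (_ + _).
apply: (@mprim_ext _ a b) => // s sab; have [e _] := XZ sab.
by rewrite mulmxA e mul1mx mulNmx mulmxA.
Qed.

(** Since Z' = Z A, one has (Z y)' = Z (y' + A y) for any [y]. No equation is imposed on [y], so the
    representation also applies to solutions of perturbed equations. *)
Lemma cauchy_repr q (y g : R -> 'M[R[i]]_(m, q)) : inWmx k g ->
  (forall t, a <= t <= b -> y t = y a + mprim g t) -> forall t, a <= t <= b ->
  y t = X t *m (y a + mprim (fun s => Z s *m (g s + A s *m y s)) t).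
Proof.
move=> hg yE t tab; have [Xa Za] := fundamental_start; have /andP[_ tb] := tab.
have hZA := inWmxM hab (inWmx_pred hab hZ) hA.
have EZ s : a <= s <= b -> Z s = Z a + mprim (fun s => Z s *m A s) s by rewrite Za; exact: ZE.
have := mprimM hab hZA hg EZ yE tab; rewrite Za mul1mx => e.
have [xz _] := XZ tab; rewrite -[LHS]mul1mx -xz -mulmxA e; congr (_ *m (_ + _)).
by apply: (@mprim_ext _ a b) => // s _; rewrite mulmxDr mulmxA.
Qed.

Lemma cauchy_estimate : exists K : R, 0 <= K /\
  forall q (y g : R -> 'M[R[i]]_(m, q)), inWmx k g ->
  (forall t, a <= t <= b -> y t = y a + mprim g t) ->
  Nmx k.+1 y <= K * (Nmx k (fun s => g s + A s *m y s) + mxn (y a)).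
Proof.
pose e := 1 + 2 * (b - a); have e0 : 0 <= e by rewrite addr_ge0// mulr_ge0// subr_ge0 ltW.
pose d := e * (3 ^+ k * Nmx k Z).
have d0 : 0 <= d by rewrite !mulr_ge0 ?exprn_ge0 ?Nmx_ge0.
exists (3 ^+ k.+1 * Nmx k.+1 X * (d + 1)); split.
  by rewrite !mulr_ge0 ?exprn_ge0 ?Nmx_ge0// addr_ge0.
move=> q y g hg yE; have hy := inWmx_prim_eq hab hg yE.
have hp : inWmx k (fun s => g s + A s *m y s).
  by apply: (inWmxD hab hg); apply: (inWmxM hab hA); exact: inWmx_pred hy.
have hZp := inWmxM hab (inWmx_pred hab hZ) hp.
have hmZp := inWmx_prim hab hZp.
have hc : inWmx k.+1 (fun _ : R => y a) := inWmx_cst hab _ _.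
rewrite (Nmx_ext hab (cauchy_repr hg yE) hy).
apply: le_trans (NmxM hab hX (inWmxD hab hc hmZp)) _.
rewrite -!mulrA ler_wpM2l ?exprn_ge0// ler_wpM2l ?Nmx_ge0//.
apply: le_trans (NmxD hab hc hmZp) _.
apply: le_trans (lerD (Nmx_cst hab _ _) (Nmx_prim hab hZp)) _.
have h1 := ler_wpM2l e0 (NmxM hab (inWmx_pred hab hZ) hp).
rewrite -/e; apply: le_trans (lerD (lexx _) h1) _.
set P := Nmx k (fun s => g s + A s *m y s); have P0 : 0 <= P := Nmx_ge0 hab _ _.
have -> : e * (3 ^+ k * (Nmx k Z * P)) = d * P by rewrite /d; ring.
have Y0 := mxn_ge0 (y a).
have : 0 <= d * mxn (y a) by exact: mulr_ge0.
rewrite mulrDl mul1r mulrDr; lra.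
Qed.

End cauchy.

End linear_ode.

(** * Uniform boundedness *)

Section bounded_operators.
Context (R : realType) (a b : R) (hab : a < b) (k m : nat).
Local Notation inWmx := (inWmx a b).
Local Notation Nmx := (Nmx a b).
Local Notation V := (R -> 'cV[R[i]]_m).
Implicit Types (y z : V) (T : V -> 'cV[R[i]]_m).

Lemma cabs_real (x : R) : cabs (x%:C)%C = `|x|.
Proof. by rewrite /cabs /= expr0n addr0 sqrtr_sqr. Qed.

Section one_operator.
Context (T : V -> 'cV[R[i]]_m) (hT : bounded_linear_W a b k T).

Lemma opD y z : inWmx k y -> inWmx k z -> T (fun t => y t + z t) = T y + T z.
Proof.
move=> /inWvP hy /inWvP hz; have [/(_ 1 y z hy hz) + _] := hT; rewrite scale1r => <-.
by congr T; apply/funext => t; rewrite scale1r.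
Qed.

Lemma op0 : T (fun _ => 0) = 0.
Proof.
have h0 : inWmx k (fun _ : R => 0 : 'cV[R[i]]_m) := inWmx_cst hab k _.
have := opD h0 h0; rewrite (_ : (fun _ => 0 + 0) = (fun _ : R => 0)); last first.
  by apply/funext => t; rewrite addr0.
by move/eqP; rewrite -subr_eq0 opprD addrA subrr sub0r oppr_eq0 => /eqP.
Qed.

Lemma opZ c y : inWmx k y -> T (fun t => c *: y t) = c *: T y.
Proof.
move=> /inWvP hy; have h0 : inWv a b k (fun _ : R => 0 : 'cV[R[i]]_m).
  by apply/inWvP; exact: inWmx_cst.
have [/(_ c y _ hy h0) + _] := hT; rewrite op0 addr0 => <-.
by congr T; apply/funext => t; rewrite addr0.
Qed.

Lemma opB y z : inWmx k y -> inWmx k z -> T (fun t => y t - z t) = T y - T z.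
Proof.
move=> hy hz; rewrite (opD hy (inWmxN hab hz)); congr (_ + _).
rewrite -scaleN1r -opZ//; congr T; apply/funext => t; by rewrite scaleN1r.
Qed.

Lemma op_bound : exists K : R, 0 <= K /\ forall y, inWmx k y -> mxn (T y) <= K * Nmx k y.
Proof.
have [_ [K hK]] := hT; exists `|K|; split=> // y /inWvP hy.
rewrite -cvnormE (le_trans (hK y hy))// WnormvE ler_wpM2r ?ler_norm//.
exact: Nmx_ge0.
Qed.

(** The operators are maps on functions on all of R; boundedness makes them blind to the values
    outside [a, b], because a difference that vanishes on [a, b] has norm zero. *)
Lemma op_ext y z : inWmx k y -> inWmx k z -> (forall t, a <= t <= b -> y t = z t) ->
  T y = T z.
Proof.
move=> hy hz yz; apply/eqP; rewrite -subr_eq0; apply/eqP; rewrite -opB//.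
have [K [K0 hK]] := op_bound; apply: mxn_eq0; apply: le_trans (hK _ (inWmxB hab hy hz)) _.
rewrite (Nmx_ext hab (G := fun _ => 0)); last exact: inWmxB.
  have := Nmx_cst hab k (0 : 'cV[R[i]]_m); rewrite mxn0 => h.
  by rewrite mulr_ge0_le0.
by move=> t /yz ->; rewrite subrr.
Qed.

Lemma op_sum n (c : 'I_n -> R[i]) (y : 'I_n -> V) : (forall i, inWmx k (y i)) ->
  T (fun t => \sum_i c i *: y i t) = \sum_i c i *: T (y i).
Proof.
move=> hy.
have hsum (r : seq 'I_n) : inWmx k (fun t => \sum_(i <- r) c i *: y i t).
  elim: r => [|i r IH].
    by apply: (inWmx_ext _ (inWmx_cst hab k 0)) => t _; rewrite big_nil.
  apply: (inWmx_ext _ (inWmxD hab (inWmxZ hab (c i) (hy i)) IH)) => t _.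
  by rewrite big_cons.
elim: (index_enum _) => [|i r IH].
  by rewrite big_nil -[RHS]op0; congr T; apply/funext => t; rewrite big_nil.
rewrite big_cons -IH -(opZ _ (hy i)) -(opD (inWmxZ hab (c i) (hy i)) (hsum r)).
by congr T; apply/funext => t; rewrite big_cons.
Qed.

(** [tv.1] is the operator norm and [tv.2] a vector of the unit ball where at least half of it is
    reached. The gliding hump needs the same number in the lower and in the upper bound. *)
Lemma op_norming (B : R) : 0 <= B ->
  ~ (forall y, inWmx k y -> mxn (T y) <= B * Nmx k y) ->
  exists tv : R * V, [/\ B <= tv.1, inWmx k tv.2, Nmx k tv.2 <= 1,
    tv.1 / 2 <= mxn (T tv.2) &
    forall y, inWmx k y -> mxn (T y) <= tv.1 * Nmx k y].
Proof.
move=> B0 hn; have [K [K0 hK]] := op_bound.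
pose E := [set r | exists2 v, inWmx k v /\ Nmx k v <= 1 & r = mxn (T v)].
have h0 : inWmx k (fun _ : R => 0 : 'cV[R[i]]_m) := inWmx_cst hab k _.
have supE : has_sup E.
  split.
    exists (mxn (T (fun _ => 0))), (fun _ => 0) => //; split=> //.
    by have := Nmx_cst hab k (0 : 'cV[R[i]]_m); rewrite mxn0 => /le_trans; apply.
  exists K => _ [v [hv v1] ->]; apply: le_trans (hK v hv) _.
  by rewrite ler_piMr.
pose tau := sup E.
have bd y : inWmx k y -> mxn (T y) <= tau * Nmx k y.
  move=> hy; have [s0|s0] := leP (Nmx k y) 0.
    have e0 : Nmx k y = 0 by apply/eqP; rewrite eq_le s0 (Nmx_ge0 hab).
    by have := hK y hy; rewrite e0 !mulr0.
  pose c := ((Nmx k y)^-1)%:C%C : R[i].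
  have cE : cabs c = (Nmx k y)^-1 by rewrite /c cabs_real ger0_norm// invr_ge0 ltW.
  have : mxn (T (fun t => c *: y t)) <= tau.
    apply: ub_le_sup; first by case: supE.
    exists (fun t => c *: y t) => //; split; first exact: inWmxZ.
    apply: le_trans (NmxZ hab c hy) _.
    by rewrite cE mulVf// gt_eqF.
  by rewrite opZ// mxnZ cE mulrC ler_pdivrMr.
have Btau : B < tau.
  rewrite ltNge; apply/negP => tB; apply: hn => y hy; apply: le_trans (bd y hy) _.
  by apply: ler_wpM2r => //; exact: Nmx_ge0.
have t0 : 0 < tau := le_lt_trans B0 Btau.
have [|_ [v [hv v1] ->] hlt] := @sup_adherent R E (tau / 2) _ supE.
  by rewrite divr_gt0.
exists (tau, v); split=> //=; first exact: ltW.
by have h := ltW hlt; rewrite -/tau in h; lra.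
Qed.

End one_operator.

Section sequence.
Context (S : nat -> V -> 'cV[R[i]]_m) (v : nat -> V).

(* Sokal's gliding hump: the sign of the i-th step is chosen so that
   [S i] does not lose the contribution of [v i]. *)
Fixpoint hump (i : nat) : V :=
  if i is j.+1 then
    let w t := ((8 ^+ j)^-1)%:C%C *: v j t in
    if mxn (S j w) <= mxn (S j (fun t => hump j t + w t))
    then fun t => hump j t + w t else fun t => hump j t - w t
  else fun _ => 0.

End sequence.

(** Operators S_i of norm tau_i >= 16^i meet steps of length at most 8^-i. The i-th step secures at
    least 8^-i tau_i / 2 in S_i, all later steps remove at most 8^-i tau_i / 4, and what is left is
    at least 2^i / 4, unbounded at the limit point. *)
Lemma uniform_boundedness (T : nat -> V -> 'cV[R[i]]_m) :
  (forall j, bounded_linear_W a b k (T j)) ->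
  (forall y, inWmx k y -> exists B, forall j, mxn (T j y) <= B) ->
  exists B : R, 0 <= B /\ forall j y, inWmx k y -> mxn (T j y) <= B * Nmx k y.
Proof.
move=> hT hp; apply: contrapT => hn.
have /choice[jv hjv] : forall i : nat, exists jtv : nat * (R * V),
    [/\ 16 ^+ i <= jtv.2.1, inWmx k jtv.2.2, Nmx k jtv.2.2 <= 1,
     jtv.2.1 / 2 <= mxn (T jtv.1 jtv.2.2) &
     forall y, inWmx k y -> mxn (T jtv.1 y) <= jtv.2.1 * Nmx k y].
  move=> i; apply: contrapT => hi; apply: hn; exists (16 ^+ i); split; first exact: exprn_ge0.
  move=> j; apply: contrapT => hj; apply: hi.
  have [|tv h] := op_norming (hT j) (exprn_ge0 i (ler0n R 16)) (B := 16 ^+ i).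
    by move=> h; apply: hj => y; exact: h.
  by exists (j, tv).
pose S i := T (jv i).1; pose tau i := (jv i).2.1; pose v i := (jv i).2.2.
have hS i : bounded_linear_W a b k (S i) := hT _.
have h16 i : 16 ^+ i <= tau i by case: (hjv i).
have hv i : inWmx k (v i) by case: (hjv i).
have hv1 i : Nmx k (v i) <= 1 by case: (hjv i).
have hnorm i : tau i / 2 <= mxn (S i (v i)) by case: (hjv i).
have hbd i y : inWmx k y -> mxn (S i y) <= tau i * Nmx k y by case: (hjv i) => _ _ _ _; apply.
pose x := hump S v; pose w i t := ((8 ^+ i)^-1)%:C%C *: v i t.
have w8 i : cabs ((8 ^+ i)^-1)%:C%C = (8 ^+ i)^-1 :> R.
  by rewrite cabs_real ger0_norm// invr_ge0 exprn_ge0.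
have hw i : inWmx k (w i) := inWmxZ hab _ (hv i).
have xS i : x i.+1 = if mxn (S i (w i)) <= mxn (S i (fun t => x i t + w i t))
    then (fun t => x i t + w i t) else (fun t => x i t - w i t) by [].
have hx i : inWmx k (x i).
  elim: i => [|i IH]; first exact: inWmx_cst.
  by rewrite xS; case: ifP => _; [exact: (inWmxD hab IH (hw i))|exact: (inWmxB hab IH (hw i))].
have xstep i : mxn (S i (w i)) <= mxn (S i (x i.+1)).
  rewrite xS; case: ifP => [//|/negbT]; rewrite -ltNge => hlt.
  have := hlt; rewrite (opD (hS i) (hx i) (hw i)) (opB (hS i) (hx i) (hw i)) => h.
  have : mxn (S i (w i) + S i (w i)) <= mxn (S i (x i) + S i (w i)) + mxn (S i (x i) - S i (w i)).
    have E (p q : 'cV[R[i]]_m) : q + q = (p + q) - (p - q).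
      by rewrite opprB [p + q]addrC addrACA subrr addr0.
    by rewrite [X in mxn X <= _](E (S i (x i))); exact: mxnB.
  rewrite -mulr2n -scaler_nat mxnZ (_ : cabs (2%:R) = 2); first by move: h; lra.
  by rewrite -(rmorph_nat (real_complex R)) cabs_real ger0_norm.
have xdiff i : Nmx k (fun t => x i.+1 t - x i t) <= (8 ^+ i)^-1.
  have wb : Nmx k (w i) <= (8 ^+ i)^-1.
    apply: le_trans (NmxZ hab _ (hv i)) _; rewrite w8.
    by rewrite ler_piMr ?invr_ge0 ?exprn_ge0.
  have E : (fun t => x i.+1 t - x i t) = w i \/ (fun t => x i.+1 t - x i t) = (fun t => - w i t).
    rewrite xS; case: ifP => _; [left|right];
      by apply/funext => t; rewrite addrAC subrr add0r.
  case: E => ->; first exact: wb.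
  exact: le_trans (NmxN hab (hw i)) wb.
have hxd i j : inWmx k (fun t => x i t - x j t) := inWmxB hab (hx i) (hx j).
have tail n l : Nmx k (fun t => x (n + l)%N t - x n t) <= 2 / 8 ^+ n - 2 / 8 ^+ (n + l).
  elim: l => [|l IH].
    rewrite addn0 subrr (Nmx_ext hab (G := fun _ => 0)) ?hxd//; last first.
      by move=> t _; rewrite subrr.
    by have := Nmx_cst hab k (0 : 'cV[R[i]]_m); rewrite mxn0.
  rewrite (Nmx_ext hab (G := fun t => (x (n + l).+1 t - x (n + l)%N t) + (x (n + l)%N t - x n t))).
  - apply: le_trans (NmxD hab (hxd _ _) (hxd _ _)) _.
    apply: le_trans (lerD (xdiff _) IH) _; rewrite addnS exprS invfM.
    have p8 : 0 <= (8 ^+ (n + l))^-1 :> R by rewrite invr_ge0 exprn_ge0.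
    by lra.
  - by move=> t _; rewrite addnS addrA subrK.
  - by rewrite addnS; exact: hxd.
have [|X [D [hX hD]]] := @Nmx_series R a b hab k m 1 (fun i t => x i.+1 t - x i t) 1
    (fun i => hxd i.+1 i).
  move=> i; apply: le_trans (xdiff i) _; rewrite div1r lef_pV2 ?posrE ?exprn_gt0//.
  by rewrite lerXn2r ?nnegrE ?ler_nat.
have tele n t : \sum_(i < n) (x i.+1 t - x i t) = x n t.
  elim: n => [|n IH]; first by rewrite big_ord0.
  by rewrite big_ord_recr /= IH addrC subrK.
(* The rate [D] of the series is not explicit; comparing with x (n + l) and letting l grow removes
   it. *)
have lim n : Nmx k (fun t => X t - x n t) <= 2 / 8 ^+ n.
  have h l : Nmx k (fun t => X t - x n t) <= D / 2 ^+ (n + l) + 2 / 8 ^+ n.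
    rewrite (Nmx_ext hab (G := fun t => (X t - x (n + l)%N t) + (x (n + l)%N t - x n t))).
    - apply: le_trans (NmxD hab (inWmxB hab hX (hx _)) (hxd _ _)) _; apply: lerD.
        have := hD (n + l)%N; rewrite (Nmx_ext hab (G := fun t => X t - x (n + l)%N t))//.
          by move=> t _; rewrite tele.
        apply: (inWmx_ext _ (inWmxB hab hX (hx (n + l)%N))) => t _; by rewrite tele.
      by apply: le_trans (tail n l) _; rewrite gerBl divr_ge0 ?exprn_ge0.
    - by move=> t _; rewrite addrA subrK.
    - exact: inWmxB.
  have D0 : 0 <= D by have := le_trans (Nmx_ge0 hab _ _) (hD 0%N); rewrite expr0 divr1.
  rewrite leNgt; apply/negP => hlt; set d := Nmx k _ in h hlt.
  have h' l : `|0 - (d - 2 / 8 ^+ n)| <= D / 2 ^+ l.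
    have dp : 0 <= d - 2 / 8 ^+ n by rewrite subr_ge0 ltW.
    rewrite sub0r normrN (ger0_norm dp) lerBlDr; apply: le_trans (h l) _; rewrite lerD2r.
    rewrite ler_wpM2l// lef_pV2 ?posrE ?exprn_gt0// ler_eXn2l ?ltr1n// leq_addl//.
  have := @geometric_bound_cvg R (fun _ => d - 2 / 8 ^+ n) 0 D h'.
  move=> /(cvg_lim (@Rhausdorff R)); rewrite lim_cst; last exact: Rhausdorff.
  by move=> e; rewrite -subr_gt0 e ltxx in hlt.
have [B hB] := hp X hX.
have final n : 2 ^+ n <= 4 * B.
  have h1 : mxn (S n X) <= B := hB _.
  have h2 : mxn (S n (w n)) = (8 ^+ n)^-1 * mxn (S n (v n)).
    by rewrite (opZ (hS n) _ (hv n)) mxnZ w8.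
  have h3 := xstep n; rewrite h2 in h3.
  have h4 := hbd n _ (inWmxB hab hX (hx n.+1)).
  have tau0 : 0 <= tau n := le_trans (exprn_ge0 _ (ler0n _ _)) (h16 n).
  have h5 := ler_wpM2l tau0 (lim n.+1).
  have h6 : mxn (S n (x n.+1)) <= mxn (S n X) + mxn (S n (fun t => X t - x n.+1 t)).
    rewrite (opB (hS n) hX (hx n.+1)); apply: le_trans (mxnB _ _).
    by rewrite opprB addrC subrK.
  have p8 : 0 <= (8 ^+ n)^-1 :> R by rewrite invr_ge0 exprn_ge0.
  have h7 := ler_wpM2l p8 (hnorm n).
  have h8 := ler_wpM2l p8 (h16 n).
  have e16 : (8 ^+ n)^-1 * 16 ^+ n = 2 ^+ n :> R.
    rewrite (_ : 16 = 8 * 2); last by rewrite -natrM.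
    by rewrite exprMn mulKf// expf_neq0.
  rewrite e16 in h8; rewrite exprS invfM in h5.
  set q := (8 ^+ n)^-1 in h3 h5 h7 h8 p8.
  have e5 : tau n * (2 * (8^-1 * q)) = (q * tau n) / 4 by field.
  rewrite e5 in h5; rewrite mulrA in h7.
  lra.
have /= := final (Num.truncn `|4 * B|).+1; apply/negP; rewrite -ltNge.
apply: (le_lt_trans (ler_norm _)); apply: (lt_le_trans (truncnS_gt _)).
by rewrite -natrX ler_nat ltnW// ltn_expl.
Qed.

End bounded_operators.

(** * Boundary-value problems *)

Section right_limit.
Context (R : realType).

Lemma cvg_right0P (f : R -> R) : f @ 0^'+ --> (0 : R) <->
  forall d, 0 < d -> exists2 r, 0 < r & forall e, 0 < e < r -> `|f e| < d.
Proof.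
split.
  move=> /cvgrPdist_lt h d d0; have [r /= r0 hr] := h d d0.
  exists r => // e /andP[e0 er]; have := hr e; rewrite /= sub0r normrN gtr0_norm// => /(_ er e0).
  by rewrite sub0r normrN.
move=> h; apply/cvgrPdist_lt => d /h[r r0 hr]; exists r => // e /= he e0.
rewrite sub0r normrN; apply: hr; rewrite e0/=.
by move: he; rewrite sub0r normrN gtr0_norm.
Qed.

Lemma cvg_right0_lt (f : R -> R) (c : R) : f @ 0^'+ --> (0 : R) -> 0 <= c ->
  forall d, 0 < d -> exists2 r, 0 < r & forall e, 0 < e < r -> c * `|f e| < d.
Proof.
move=> /cvg_right0P h c0 d d0.
have [r r0 hr] := h (d / (c + 1)) (divr_gt0 d0 (ltr_wpDl c0 ltr01)).
exists r => // e /hr; rewrite ltr_pdivlMr ?ltr_wpDl// => he.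
apply: le_lt_trans he; rewrite mulrC ler_wpM2l// lerDl//.
Qed.

Lemma cvg_right0_sum n (f : 'I_n -> R -> R) : (forall j, f j @ 0^'+ --> (0 : R)) ->
  (fun e => \sum_j f j e) @ 0^'+ --> (0 : R).
Proof.
move=> hf; elim: (index_enum _) => [|j r IH].
  rewrite (_ : (fun e => _) = fun _ => 0); first exact: cvg_cst.
  by apply/funext => e; rewrite big_nil.
rewrite (_ : (fun e => _) = fun e => f j e + \sum_(i <- r) f i e).
  by rewrite -[X in _ --> X](addr0 (0 : R)); exact: cvgD (hf j) IH.
by apply/funext => e; rewrite big_cons.
Qed.

Lemma cvg_right0_le (f g : R -> R) (C r : R) : 0 <= C -> 0 < r ->
  (forall e, 0 < e < r -> `|f e| <= C * `|g e|) ->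
  g @ 0^'+ --> (0 : R) -> f @ 0^'+ --> (0 : R).
Proof.
move=> C0 r0 fg hg; apply/cvg_right0P => d d0.
have [r1 r10 hr1] := cvg_right0_lt hg C0 d0.
exists (Num.min r r1); first by rewrite lt_min r0.
move=> e /andP[e0]; rewrite lt_min => /andP[er er1].
by rewrite (le_lt_trans (fg e _)) ?e0// hr1// e0.
Qed.

End right_limit.

Lemma unitmx_of_inj (F : fieldType) m (M : 'M[F]_m) :
  (forall q : 'cV[F]_m, M *m q = 0 -> q = 0) -> M \in unitmx.
Proof.
move=> h; rewrite -unitmx_tr -row_free_unit -kermx_eq0; apply/eqP/row_matrixP => i.
have e : M *m (row i (kermx M^T))^T = 0.
  by rewrite -[M]trmxK -trmx_mul trmxK; have /sub_kermxP -> := row_sub i (kermx M^T); rewrite trmx0.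
by rewrite row0 -[LHS]trmxK (h _ e) trmx0.
Qed.

(** * The boundary-value problem in integral form *)

Section problem.
Context (R : realType) (a b : R) (hab : a < b) (k m : nat).
Local Notation mu := (@lebesgue_measure R).
Local Notation inWmx := (inWmx a b).
Local Notation Nmx := (Nmx a b).
Local Notation mprim := (mprim a).
Local Notation V := (R -> 'cV[R[i]]_m).
Implicit Types (A X : R -> 'M[R[i]]_m) (L : V -> 'cV[R[i]]_m) (f y z : V).

(** The differential equation alone, without boundary condition, written as an identity at every
    point of [a, b]: neither null sets nor chosen derivatives occur. *)
Definition isol A f y : Prop := inWmx k.+1 y /\
  forall t, a <= t <= b -> y t = y a + mprim (fun s => f s - A s *m y s) t.

Lemma ae_neq (x : R) : \forall t \ae mu, t != x.
Proof.
exists [set x]; split=> //; first exact: lebesgue_measure_set1.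
by move=> t /= /negP; rewrite negbK => /eqP.
Qed.

(** The chosen first derivative agrees almost everywhere with any integrand that represents the
    component. The equation on the open interval passes to [a, b] because the two endpoints form a
    null set. *)
Lemma is_solutionP A L f c y : inWmx k A -> inWmx k f ->
  is_solution a b k.+1 A L f c y <-> isol A f y /\ L y = c.
Proof.
move=> hA hf.
have hF : inWmx k.+1 y -> inWmx k (fun s => f s - A s *m y s).
  by move=> hy; exact: (inWmxB hab hf (inWmxM hab hA (inWmx_pred hab hy))).
split.
  move=> [/inWvP hy hae Ly]; split=> //; split=> // t tab.
  have /andP[_ tb] := tab.
  apply/matrixP => i j; rewrite (ord1 j) !mxE.
  have [g [hg yg]] := inWS_ex hab (hy i 0).
  rewrite yg//; congr (_ + _); apply: (cprim_ae (inW_Linf hab hg) (inW_Linf hab (hF hy i 0))) => //.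
  have h1 := Wder1_ae hab hg yg.
  apply: ae_mono (ae_and (ae_and h1 hae) (ae_and (ae_neq a) (ae_neq b))).
  move=> s [[e1 e2] [na nb]] sab; have /andP[as_ sb] := sab.
  have sab' : a < s < b by rewrite !lt_neqAle as_ sb eq_sym na nb.
  by rewrite -(e2 sab') addrK mxE e1.
move=> [[hy yE] Ly]; split; [exact/inWvP| |exact: Ly].
have h : \forall t \ae mu, forall i, a <= t <= b ->
    Wder a b k.+1 (fun s => y s i 0) 1%N t = (f t - A t *m y t) i 0.
  apply: ae_ord => i; apply: (Wder1_ae hab (hF hy i 0) (c := y a i 0)) => t /yE.
  by move=> e; rewrite {1}e !mxE.
apply: ae_mono h => t h /andP[at_ tb]; apply/matrixP => i j; rewrite (ord1 j) !mxE.
by rewrite h ?(ltW at_) ?(ltW tb)// !mxE subrK.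
Qed.

Lemma isolB A f g y z : inWmx k A -> inWmx k f -> inWmx k g ->
  isol A f y -> isol A g z -> isol A (fun t => f t - g t) (fun t => y t - z t).
Proof.
move=> hA hf hg [hy yE] [hz zE]; split; first exact: inWmxB.
move=> t tab; have /andP[_ tb] := tab.
have h1 := inWmxB hab hf (inWmxM hab hA (inWmx_pred hab hy)).
have h2 := inWmxB hab hg (inWmxM hab hA (inWmx_pred hab hz)).
rewrite (yE t tab) (zE t tab) opprD addrACA; congr (_ + _).
rewrite -(mprimB hab h1 h2 tb); apply: (@mprim_ext _ a b) => // s _.
by rewrite mulmxBr !opprB addrACA [RHS]addrACA [- g s + _]addrC.
Qed.

Lemma isol0 A : isol A (fun _ => 0) (fun _ => 0).
Proof.
split; first exact: inWmx_cst.
move=> t /andP[_ tb]; rewrite (@mprim_ext _ a b _ _ _ (fun _ => 0))// ?mprim_cst0 ?addr0//.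
by move=> s _; rewrite mulmx0 subr0.
Qed.

Lemma isol_mulmx A (Y : R -> 'M[R[i]]_m) (q : 'cV[R[i]]_m) :
  inWmx k A -> inWmx k.+1 Y ->
  (forall t, a <= t <= b -> Y t = Y a + mprim (fun s => - (A s *m Y s)) t) ->
  isol A (fun _ => 0) (fun t => Y t *m q).
Proof.
move=> hA hY YE; have hq := inWmx_cst hab k.+1 q.
split; first exact: inWmxM.
move=> t tab; have /andP[_ tb] := tab.
have hAY := inWmxN hab (inWmxM hab hA (inWmx_pred hab hY)).
have qE s : a <= s <= b -> q = q + mprim (fun _ => 0 : 'cV[R[i]]_m) s.
  by move=> _; rewrite mprim_cst0 addr0.
rewrite (mprimM hab (G := fun _ => q) hAY (inWmx_cst hab k 0) YE qE tab); congr (_ + _).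
apply: (@mprim_ext _ a b) => // s _.
by rewrite mulmx0 !add0r mulNmx mulmxA.
Qed.

Definition opmx L X : 'M[R[i]]_m := \matrix_(i, j) L (fun t => col j (X t)) i 0.

Lemma inWmx_col j p q (F : R -> 'M[R[i]]_(p, q)) i : inWmx j F -> inWmx j (fun t => col i (F t)).
Proof. by move=> hF l l'; apply: (inW_ext _ (hF l i)) => t _; rewrite mxE. Qed.

Lemma opmxE L X (q : 'cV[R[i]]_m) : bounded_linear_W a b k.+1 L -> inWmx k.+1 X ->
  L (fun t => X t *m q) = opmx L X *m q.
Proof.
move=> hL hX.
have -> : (fun t => X t *m q) = (fun t => \sum_j q j 0 *: col j (X t)).
  apply/funext => t; apply/matrixP => i j; rewrite (ord1 j) !mxE summxE.
  by apply: eq_bigr => l _; rewrite !mxE mulrC.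
rewrite (op_sum hab hL (fun j => q j 0)) => [|j]; last exact: inWmx_col.
apply/matrixP => i j; rewrite (ord1 j) !mxE summxE.
by apply: eq_bigr => l _; rewrite !mxE mulrC.
Qed.

Lemma isol_bound A f y : inWmx k A -> inWmx k f -> isol A f y ->
  inWmx k (fun s => f s - A s *m y s).
Proof. by move=> hA hf [hy _]; exact: (inWmxB hab hf (inWmxM hab hA (inWmx_pred hab hy))). Qed.

Lemma Nmx_eq0 y : inWmx k.+1 y -> Nmx k.+1 y <= 0 -> forall t, a <= t <= b -> y t = 0.
Proof.
move=> hy h t tab; apply: mxn_eq0; apply: le_trans (Nmx_eval hab hy tab) _.
by rewrite mulr_ge0_le0// addr_ge0// mulr_ge0// subr_ge0 ltW.
Qed.

(** * The a priori bound, uniform in the parameter *)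

Section sufficiency.
Context (eps0 : R) (heps0 : 0 < eps0) (A : R -> R -> 'M[R[i]]_m) (L : R -> V -> 'cV[R[i]]_m).
Context (hA : forall e, 0 <= e < eps0 -> inWmx k (A e)).
Context (hL : forall e, 0 <= e < eps0 -> bounded_linear_W a b k.+1 (L e)).
Context (H0 : forall y, isol (A 0) (fun _ => 0) y -> L 0 y = 0 ->
  forall t, a <= t <= b -> y t = 0).
Context (HI : (fun e => Nmx k (fun t => A e t - A 0 t)) @ 0^'+ --> (0 : R)).
Context (HII : forall y, inWmx k.+1 y ->
  (fun e => mxn (L e y - L 0 y)) @ 0^'+ --> (0 : R)).

Let r00 : 0 <= (0 : R) < eps0. Proof. by rewrite lexx heps0. Qed.

(** Otherwise some e_j < eps0 / (j + 1) violates the bound with constant [j]. Along this sequence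
    the operators are bounded at each [y], since L(e) y -> L(0) y, and uniform boundedness
    contradicts the choice of e_j. *)
Lemma equibounded : exists B r : R, [/\ 0 <= B, 0 < r, r <= eps0 &
  forall e, 0 <= e < r -> forall y, inWmx k.+1 y -> mxn (L e y) <= B * Nmx k.+1 y].
Proof.
apply: contrapT => hn.
have step j : eps0 / j.+1%:R <= eps0.
  by rewrite ler_pdivrMr// ler_peMr ?ler1n//; exact: ltW.
have /choice[e he] : forall j : nat, exists e, 0 <= e < eps0 / j.+1%:R /\
    ~ (forall y, inWmx k.+1 y -> mxn (L e y) <= j%:R * Nmx k.+1 y).
  move=> j; apply: contrapT => hj; apply: hn; exists j%:R, (eps0 / j.+1%:R); split=> //.
  - by rewrite divr_gt0.
  by move=> e he; apply: contrapT => hh; apply: hj; exists e.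
have he0 j : 0 <= e j < eps0.
  have [/andP[e0 e1] _] := he j; rewrite e0; exact: lt_le_trans e1 (step j).
have [|B [B0 hB]] := uniform_boundedness hab (fun j => hL (he0 j)).
  move=> y hy; have /cvg_right0P/(_ 1 ltr01)[r r0 hr] := HII hy.
  pose J := (Num.truncn `|eps0 / r|).+1.
  (* From index [J] on, L(e_j) y is within distance 1 of L(0) y; the finitely many earlier values
     are summed. *)
  exists (mxn (L 0 y) + 1 + \sum_(j < J) mxn (L (e j) y)) => j.
  have S0 : 0 <= \sum_(j < J) mxn (L (e j) y) by apply: sumr_ge0 => ? _; exact: mxn_ge0.
  have [jJ|Jj] := ltnP j J.
    rewrite (bigD1 (Ordinal jJ))//= addrCA lerDl addr_ge0//.
      by rewrite addr_ge0// mxn_ge0.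
    by apply: sumr_ge0 => ? _; exact: mxn_ge0.
  have [/andP[e0 e1] _] := he j.
  have er : e j < r.
    apply: lt_trans e1 _; rewrite ltr_pdivrMr// mulrC -ltr_pdivrMr//.
    apply: le_lt_trans (ler_norm _) _; apply: lt_le_trans (truncnS_gt _) _.
    by rewrite ler_nat (leq_trans Jj).
  have h1 : mxn (L (e j) y - L 0 y) <= 1.
    (* The limit is taken along e > 0, so e_j = 0 is treated apart. *)
    move: e0; rewrite le_eqVlt => /predU1P[<-|e0]; first by rewrite subrr mxn0.
    by have := hr (e j); rewrite e0 er ger0_norm ?mxn_ge0// => /(_ isT)/ltW.
  have := mxnD (L (e j) y - L 0 y) (L 0 y); rewrite subrK => h2.
  by apply: le_trans h2 _; lra.
pose j := (Num.truncn `|B|).+1; have [_ []] := he j; move=> y hy.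
apply: le_trans (hB j y hy) _; apply: ler_wpM2r; first exact: Nmx_ge0.
by apply: le_trans (ler_norm _) _; exact: ltW (truncnS_gt _).
Qed.

(** Split y = z + X q with q = y(a) and X the fundamental matrix for e = 0. As z(a) = 0, the Cauchy
    estimate bounds z by its residual, and the boundary value then determines q through the inverse
    of M(0). Since [y] is any primitive and not a solution, the bound applies directly to y(e) -
    y(0). *)
Lemma apriori : exists K r : R, [/\ 0 <= K, 0 < r, r <= eps0 &
  forall e, 0 <= e < r -> forall y g : V, inWmx k g ->
  (forall t, a <= t <= b -> y t = y a + mprim g t) ->
  Nmx k.+1 y <= K * (Nmx k (fun t => g t + A e t *m y t) + mxn (L e y))].
Proof.
have hA0 := hA r00; have hL0 := hL r00.
have [X [Z [hX hZ XE ZE XZ]]] := fundamental_matrix hab hA0.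
have [Xa _] := fundamental_start hab XE ZE.
have [K1 [K10 hK1]] := cauchy_estimate hab hA0 hX hZ XE ZE XZ.
have [B [rB [B0 rB0 rBe hB]]] := equibounded.
have XE' t : a <= t <= b -> X t = X a + mprim (fun s => - (A 0 s *m X s)) t by rewrite Xa; exact: XE.
pose M e := opmx (L e) X.
(* If M(0) q = 0, then X q solves the homogeneous problem for e = 0, so q = X(a) q = 0. *)
have M0u : M 0 \in unitmx.
  apply: unitmx_of_inj => q hq; have aab : a <= a <= b by rewrite lexx ltW.
  have := H0 (isol_mulmx q hA0 hX XE'); rewrite (opmxE q hL0 hX) => /(_ hq a aab).
  by rewrite Xa mul1mx.
pose mu0 := mxn (invmx (M 0)); have mu00 : 0 <= mu0 := mxn_ge0 _.
have p3 : 0 <= 3 ^+ k :> R by rewrite exprn_ge0.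
pose x := Nmx k X; have x0 : 0 <= x := Nmx_ge0 hab _ _.
pose al e := Nmx k (fun t => A e t - A 0 t); have al0 e : 0 <= al e := Nmx_ge0 hab _ _.
pose et e := mxn (M e - M 0); have et0 e : 0 <= et e := mxn_ge0 _.
have hq4 : 0 < 4^-1 :> R by rewrite invr_gt0.
have het : (fun e => et e) @ 0^'+ --> (0 : R).
  have -> : (fun e => et e) =
      (fun e => \sum_(j < m) mxn (L e (fun t => col j (X t)) - L 0 (fun t => col j (X t)))).
    apply/funext => e; rewrite /et /mxn exchange_big; apply: eq_bigr => j _.
    by apply: eq_bigr => i _; rewrite big_ord1 !mxE.
  by apply: cvg_right0_sum => j; apply: HII; exact: inWmx_col.
have c10 : 0 <= K1 * 3 ^+ k by rewrite mulr_ge0.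
have [r1 r10 hr1] := cvg_right0_lt HI c10 hq4.
have c20 : 0 <= mu0 * (B * (2 * K1 * (3 ^+ k * (3 ^+ k * x)))) by rewrite !mulr_ge0.
have [r2 r20 hr2] := cvg_right0_lt HI c20 hq4.
have [r3 r30 hr3] := cvg_right0_lt het mu00 hq4.
(* [r1] serves the Cauchy estimate for A(e), [r2] the term (A(e) - A(0)) X q in the residual of z,
   [r3] the term (M(e) - M(0)) q, [rB] the bound on L(e). The first three make a coefficient at most
   1/4; those of [r2] and [r3] together absorb half of |q|. *)
pose r := Num.min (Num.min r1 r2) (Num.min r3 rB).
(* Combines |y| <= 2 K1 (P + |q|) with |q| <= 2 mu0 (l + 2 K1 B P), where P is the norm of the
   residual and l that of the boundary value. *)
pose K := 2 * K1 * (1 + 2 * mu0 * (1 + B * (2 * K1))).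
have K0 : 0 <= K by rewrite !(mulr_ge0, addr_ge0).
have rpos : 0 < r by rewrite !lt_min r10 r20 r30 rB0.
have rle : r <= eps0 by rewrite !ge_min rBe !orbT.
exists K, r; split=> // e /andP[e0 er] y g hg yE.
have ee : 0 <= e < eps0 by rewrite e0 (lt_le_trans er).
have [er1 er2 er3 erB] : [/\ e < r1, e < r2, e < r3 & e < rB].
  by move: er; rewrite !lt_min => /andP[/andP[-> ->] /andP[-> ->]].
have hAe := hA ee; have hLe := hL ee.
have s1 : K1 * 3 ^+ k * al e <= 4^-1.
  move: e0; rewrite le_eqVlt => /predU1P[<-|e0].
    by rewrite /al (Nmx_subrr hab) mulr0 ltW.
  by have := hr1 e; rewrite e0 er1 ger0_norm ?al0// => /(_ isT)/ltW.
have s2 : mu0 * (B * (2 * K1 * (3 ^+ k * (3 ^+ k * x)))) * al e <= 4^-1.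
  move: e0; rewrite le_eqVlt => /predU1P[<-|e0].
    by rewrite /al (Nmx_subrr hab) mulr0 ltW.
  by have := hr2 e; rewrite e0 er2 ger0_norm ?al0// => /(_ isT)/ltW.
have s3 : mu0 * et e <= 4^-1.
  move: e0; rewrite le_eqVlt => /predU1P[<-|e0].
    by rewrite /et subrr mxn0 mulr0 ltW.
  by have := hr3 e; rewrite e0 er3 ger0_norm ?et0// => /(_ isT)/ltW.
have hD : inWmx k (fun t => A e t - A 0 t) := inWmxB hab hAe hA0.
(* The Cauchy estimate survives small perturbations of the coefficients. *)
have cauchy_e (z h : V) : inWmx k h -> (forall t, a <= t <= b -> z t = z a + mprim h t) ->
    Nmx k.+1 z <= 2 * K1 * (Nmx k (fun t => h t + A e t *m z t) + mxn (z a)).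
  move=> hh zE; have hz := inWmx_prim_eq hab hh zE; have hz' := inWmx_pred hab hz.
  have hp := inWmxD hab hh (inWmxM hab hAe hz').
  have hDz := inWmxM hab hD hz'.
  have h1 := hK1 1%N z h hh zE.
  have h2 : Nmx k (fun t => h t + A 0 t *m z t) <=
      Nmx k (fun t => h t + A e t *m z t) + 3 ^+ k * (al e * Nmx k.+1 z).
    rewrite (Nmx_ext hab (G := fun t => (h t + A e t *m z t) - (A e t - A 0 t) *m z t)).
    - apply: le_trans (NmxB hab hp hDz) _; rewrite lerD2l.
      apply: le_trans (NmxM hab hD hz') _; apply: ler_wpM2l => //.
      by apply: ler_wpM2l; [exact: al0|exact: Nmx_pred].
    - by move=> t _; rewrite mulmxBl opprB addrA addrAC addrK.
    - exact: (inWmxD hab hh (inWmxM hab hA0 hz')).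
  set nz := Nmx k.+1 z in h1 h2 *; set P := Nmx k (fun t => h t + A e t *m z t) in h2 *.
  have nz0 : 0 <= nz := Nmx_ge0 hab _ _.
  have h3 := ler_wpM2l K10 (lerD h2 (lexx (mxn (z a)))).
  have h4 := ler_wpM2r nz0 s1.
  have h5 := le_trans h1 h3; move: h5 h4 nz0.
  rewrite mulrDr [K1 * (P + _)]mulrDr !mulrA [2 * K1 * _]mulrDr.
  lra.
pose q := y a; pose z t := y t - X t *m q.
have hy := inWmx_prim_eq hab hg yE.
have hXq := inWmxM hab hX (inWmx_cst hab k.+1 q).
have hz : inWmx k.+1 z := inWmxB hab hy hXq.
have [_ XqE] := isol_mulmx q hA0 hX XE'.
have za : z a = 0 by rewrite /z Xa mul1mx subrr.
have hAXq := inWmxM hab hA0 (inWmx_pred hab hXq).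
have h0 : inWmx k (fun _ : R => 0 : 'cV[R[i]]_m) := inWmx_cst hab k _.
have hgz := inWmxB hab hg (inWmxB hab h0 hAXq).
have zE t : a <= t <= b -> z t = z a + mprim (fun t => g t - (0 - A 0 t *m (X t *m q))) t.
  move=> tab; have /andP[_ tb] := tab.
  rewrite (mprimB hab hg (inWmxB hab h0 hAXq) tb) za add0r /z (yE t tab) (XqE t tab).
  by rewrite Xa mul1mx opprD addrACA subrr add0r.
have nz := cauchy_e z _ hgz zE; rewrite za mxn0 addr0 in nz.
set P := Nmx k (fun t => g t + A e t *m y t).
have P0 : 0 <= P := Nmx_ge0 hab _ _.
set Q := mxn q; have Q0 : 0 <= Q := mxn_ge0 _.
(* X solves the equation for e = 0, so the residual of z for A(e) is that of y minus (A(e) - A(0)) X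
   q. *)
have hP : Nmx k (fun t => g t - (0 - A 0 t *m (X t *m q)) + A e t *m z t) <=
    P + 3 ^+ k * (al e * (3 ^+ k * (x * Q))).
  have hXk := inWmx_pred hab hXq; have hDXq := inWmxM hab hD hXk.
  have hAy := inWmxM hab hAe (inWmx_pred hab hy).
  rewrite (Nmx_ext hab (G := fun t => (g t + A e t *m y t) - (A e t - A 0 t) *m (X t *m q))).
  - apply: le_trans (NmxB hab (inWmxD hab hg hAy) hDXq) _; rewrite lerD2l.
    apply: le_trans (NmxM hab hD hXk) _; apply: ler_wpM2l => //.
    apply: ler_wpM2l; first exact: al0.
    apply: le_trans (NmxM hab (inWmx_pred hab hX) (inWmx_cst hab k q)) _.
    apply: ler_wpM2l => //; apply: ler_wpM2l => //; exact: Nmx_cst.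
  - move=> t _; rewrite /z mulmxBr mulmxBl sub0r !opprK opprB.
    by rewrite -!addrA; congr (_ + _); rewrite addrCA; congr (_ + _); rewrite addrC.
  - exact: (inWmxD hab hgz (inWmxM hab hAe (inWmx_pred hab hz))).
have nz1 := le_trans nz (ler_wpM2l (mulr_ge0 (ler0n R 2) K10) hP).
set l := mxn (L e y); have l0 : 0 <= l := mxn_ge0 _.
have hQ : Q <= mu0 * (l + B * Nmx k.+1 z + et e * Q).
  (* From L(e) y = L(e) z + M(e) q, with M(e) written as M(0) plus a small matrix. *)
  have qE : q = invmx (M 0) *m (L e y - L e z - (M e - M 0) *m q).
    rewrite [L e z](opB hab hLe hy hXq) (opmxE q hLe hX) -/(M e).
    by rewrite opprB addrCA subrr addr0 mulmxBl opprB addrCA subrr addr0 mulKmx.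
  rewrite {1}/Q {1}qE.
  apply: le_trans (mxnM _ _) _; apply: ler_wpM2l => //.
  apply: le_trans (mxnB _ _) _; apply: lerD; last exact: mxnM.
  apply: le_trans (mxnB _ _) _; rewrite lerD2l.
  by apply: hB; rewrite ?e0.
have hQ2 : Q <= 2 * mu0 * (l + B * (2 * K1) * P).
  have t1 := ler_wpM2l mu00 (ler_wpM2l B0 nz1).
  have t2 := ler_wpM2r Q0 s2; have t3 := ler_wpM2r Q0 s3.
  have e1 : mu0 * (B * (2 * K1 * (P + 3 ^+ k * (al e * (3 ^+ k * (x * Q)))))) =
    mu0 * (B * (2 * K1 * P)) + mu0 * (B * (2 * K1 * (3 ^+ k * (3 ^+ k * x)))) * al e * Q by ring.
  have e2 : mu0 * (l + B * Nmx k.+1 z + et e * Q) = mu0 * l + mu0 * (B * Nmx k.+1 z) + mu0 * et e * Q by ring.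
  have e3 : 2 * mu0 * (l + B * (2 * K1) * P) = 2 * (mu0 * l) + 2 * (mu0 * (B * (2 * K1 * P))) by ring.
  rewrite e1 in t1; rewrite e2 in hQ; rewrite e3.
  set v1 := mu0 * l in hQ *; set v2 := mu0 * (B * (2 * K1 * P)) in t1 *.
  set v3 := _ * Q in t1 t2; set v4 := mu0 * et e * Q in hQ t3.
  set v5 := mu0 * (B * _) in hQ t1.
  move: hQ t1 t2 t3; lra.
have ny := cauchy_e y g hg yE.
apply: le_trans ny _; rewrite /K -!mulrA.
apply: ler_wpM2l => //; apply: ler_wpM2l => //.
apply: le_trans (lerD (lexx _) hQ2) _.
rewrite -/P -/l.
have f1 : 0 <= mu0 * P by exact: mulr_ge0.
have f2 : 0 <= mu0 * (B * (K1 * l)) by rewrite !mulr_ge0.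
rewrite -subr_ge0.
have -> : (1 + 2 * (mu0 * (1 + B * (2 * K1)))) * (P + l) - (P + 2 * mu0 * (l + B * (2 * K1) * P)) =
  l + 2 * (mu0 * P) + 4 * (mu0 * (B * (K1 * l))) by ring.
by rewrite !addr_ge0// mulr_ge0.
Qed.

End sufficiency.

End problem.

Lemma le_absorb (R : realFieldType) (d x z : R) :
  d <= x + z -> z <= 2^-1 * d -> d <= 2 * x.
Proof. lra. Qed.

(** * The two implications *)

Section equivalence.
Context (R : realType) (a b : R) (hab : a < b) (k m : nat).
Local Notation mu := (@lebesgue_measure R).
Local Notation inWmx := (inWmx a b).
Local Notation Nmx := (Nmx a b).
Local Notation mprim := (mprim a).
Local Notation isol := (isol a b k).
Local Notation V := (R -> 'cV[R[i]]_m).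
Context (eps0 : R) (heps0 : 0 < eps0) (A : R -> R -> 'M[R[i]]_m) (L : R -> V -> 'cV[R[i]]_m).
Context (hA : forall e, 0 <= e < eps0 -> inWmx k (A e)).
Context (hL : forall e, 0 <= e < eps0 -> bounded_linear_W a b k.+1 (L e)).

Let r00 : 0 <= (0 : R) < eps0. Proof. by rewrite lexx heps0. Qed.
Let aab : a <= a <= b. Proof. by rewrite lexx ltW. Qed.
Let h0k : inWmx k (fun _ : R => 0 : 'cV[R[i]]_m). Proof. exact: inWmx_cst. Qed.
Let h0S : inWmx k.+1 (fun _ : R => 0 : 'cV[R[i]]_m). Proof. exact: inWmx_cst. Qed.

(** The a priori bound yields everything: for homogeneous data, uniqueness and the injectivity of
    the boundary matrix, hence existence; for y(e) - y(0), convergence. *)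
Lemma sufficient :
  (forall y, isol (A 0) (fun _ => 0) y -> L 0 y = 0 -> forall t, a <= t <= b -> y t = 0) ->
  (fun e => Nmx k (fun t => A e t - A 0 t)) @ 0^'+ --> (0 : R) ->
  (forall y, inWmx k.+1 y -> (fun e => mxn (L e y - L 0 y)) @ 0^'+ --> (0 : R)) ->
  cont_dep_at0 a b k.+1 eps0 A L.
Proof.
move=> H0 HI HII.
have [K [r [K0 rpos rle hK]]] := apriori hab heps0 hA hL H0 HI HII.
have est e (f y : V) : 0 <= e < r -> inWmx k f -> isol (A e) f y ->
    Nmx k.+1 y <= K * (Nmx k f + mxn (L e y)).
  move=> he hf hy; have [hyW yE] := hy; have /andP[e0 er] := he.
  have hAe := hA (introT andP (conj e0 (lt_le_trans er rle))).
  have hg := isol_bound hab hAe hf hy.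
  apply: le_trans (hK e he y _ hg yE) _.
  rewrite (Nmx_ext hab (G := f))//; first by move=> t _; rewrite subrK.
  exact: (inWmxD hab hg (inWmxM hab hAe (inWmx_pred hab hyW))).
(* Halved because the definition requires eps1 < eps0, whereas [r] may equal eps0. *)
exists (r / 2); split; first by apply/andP; split; [lra|move: rle; lra].
have hr e : 0 <= e < r / 2 -> 0 <= e < r by case/andP=> -> h /=; move: h rpos; lra.
have hr0 e : 0 <= e < r -> 0 <= e < eps0 by case/andP=> -> h /=; exact: lt_le_trans h rle.
split.
  move=> e /hr he f c /inWvP hf; have hAe := hA (hr0 e he); have hLe := hL (hr0 e he).
  have [X [Z [hX hZ XE ZE XZ]]] := fundamental_matrix hab hAe.
  have [Xa _] := fundamental_start hab XE ZE.
  have XE' t : a <= t <= b -> X t = X a + mprim (fun s => - (A e s *m X s)) t by rewrite Xa; exact: XE.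
  have [w [hw wa wE]] := cauchy_solve hab hAe hX hZ XE ZE XZ 0 hf.
  have Mu : opmx (L e) X \in unitmx.
    apply: unitmx_of_inj => q hq.
    have sq := isol_mulmx hab q hAe hX XE'; have [hXq _] := sq.
    have := est e _ _ he h0k sq; rewrite (opmxE hab q hLe hX) hq mxn0.
    have := Nmx_cst hab k (0 : 'cV[R[i]]_m); rewrite mxn0 addr0 => h1 h2.
    have := Nmx_eq0 hab hXq (le_trans h2 (mulr_ge0_le0 K0 h1)) aab.
    by rewrite Xa mul1mx.
  (* The solution [w] vanishing at [a] is corrected by X q so as to meet the boundary condition. *)
  pose q := invmx (opmx (L e) X) *m (L e w - c).
  have sq := isol_mulmx hab q hAe hX XE'; have [hXq _] := sq.
  have sy := isolB hab hAe hf h0k (conj hw wE) sq.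
  have f0 : (fun t => f t - 0) = f by apply/funext => t; rewrite subr0.
  rewrite f0 in sy.
  have Ly : L e (fun t => w t - X t *m q) = c.
    by rewrite (opB hab hLe hw hXq) (opmxE hab q hLe hX) mulKVmx// opprB addrC subrK.
  exists (fun t => w t - X t *m q); split.
    by apply/(is_solutionP hab (L e) _ _ hAe hf).
  move=> z /(is_solutionP hab (L e) _ _ hAe hf)[sz Lz] t tab.
  have sd := isolB hab hAe hf hf sz sy; have [hd _] := sd.
  have [hz _] := sz; have [hy _] := sy.
  have := est e _ _ he (inWmxB hab hf hf) sd.
  rewrite (opB hab hLe hz hy) Lz Ly subrr mxn0 addr0 (Nmx_subrr hab) mulr0 => h.
  by apply/eqP; rewrite -subr_eq0; apply/eqP; exact: (Nmx_eq0 hab hd h tab).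
move=> f c y hs cf cc.
have hs' e : 0 <= e < r / 2 -> [/\ inWmx k (f e), isol (A e) (f e) (y e) & L e (y e) = c e].
  move=> he; have [/inWvP hf /(is_solutionP hab (L e) _ _ (hA (hr0 e (hr e he))) hf)[? ?]] := hs e he.
  by split.
have h00 : 0 <= (0 : R) < r / 2 by rewrite lexx divr_gt0.
have [hf0 s0 L0] := hs' 0 h00; have [hy0 y0E] := s0.
have hA0 := hA r00; have hL0 := hL r00.
(* [G] bounds the residual and the boundary value of y(e) - y(0) with respect to A(e) and L(e); the
   differences A(e) - A(0) and L(e) - L(0) act only on the fixed function y(0). *)
pose G e := Nmx k (fun t => f e t - f 0 t) + 3 ^+ k * Nmx k (y 0) * Nmx k (fun t => A e t - A 0 t) +
  mxn (c e - c 0) + mxn (L e (y 0) - L 0 (y 0)).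
have cG : G @ 0^'+ --> (0 : R).
  rewrite -[X in _ --> X](addr0 (0 : R)); apply: cvgD; last exact: HII.
  rewrite -[X in _ --> X](addr0 (0 : R)); apply: cvgD; last first.
    rewrite (_ : (fun e => _) = fun e => cvnorm (c e - c 0)); first exact: cc.
    by apply/funext => e; rewrite cvnormE.
  rewrite -[X in _ --> X](addr0 (0 : R)); apply: cvgD.
    rewrite (_ : (fun e => _) = fun e => Wnormv a b k (fun t => f e t - f 0 t)); first exact: cf.
    by apply/funext => e; rewrite WnormvE.
  apply: (cvg_right0_le _ rpos _ HI (C := 3 ^+ k * Nmx k (y 0))).
    by rewrite mulr_ge0 ?exprn_ge0 ?(Nmx_ge0 hab).
  by move=> e _; rewrite normrM ger0_norm// mulr_ge0 ?exprn_ge0 ?(Nmx_ge0 hab).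
apply: (cvg_right0_le K0 (_ : 0 < r / 2) _ cG); first by rewrite divr_gt0.
move=> e /andP[e0 er]; have he : 0 <= e < r / 2 by rewrite ltW.
have hAe := hA (hr0 e (hr e he)); have hLe := hL (hr0 e (hr e he)).
have [hfe se Le] := hs' e he; have [hye yeE] := se.
have ge := isol_bound hab hAe hfe se; have g0 := isol_bound hab hA0 hf0 s0.
rewrite WnormvE ger0_norm ?(Nmx_ge0 hab)//; apply: le_trans _ (ler_wpM2l K0 (ler_norm _)).
have dE t : a <= t <= b -> y e t - y 0 t = (y e a - y 0 a) +
    mprim (fun s => (f e s - A e s *m y e s) - (f 0 s - A 0 s *m y 0 s)) t.
  move=> tab; have /andP[_ tb] := tab.
  by rewrite (mprimB hab ge g0 tb) (yeE t tab) (y0E t tab) opprD addrACA.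
apply: le_trans (hK e (hr e he) (fun t => y e t - y 0 t) _ (inWmxB hab ge g0) dE) _.
apply: ler_wpM2l => //; rewrite /G -[X in _ <= X]addrA; apply: lerD; last first.
  rewrite (opB hab hLe hye hy0) Le -L0.
  have -> : c e - L e (y 0) = (c e - L 0 (y 0)) - (L e (y 0) - L 0 (y 0)).
    by rewrite opprB addrA subrK.
  exact: mxnB.
have hD := inWmxB hab hAe hA0; have hy0' := inWmx_pred hab hy0.
have hDy := inWmxM hab hD hy0'.
rewrite (Nmx_ext hab (G := fun t => (f e t - f 0 t) - (A e t - A 0 t) *m y 0 t)).
- apply: le_trans (NmxB hab (inWmxB hab hfe hf0) hDy) _; rewrite lerD2l.
  by apply: le_trans (NmxM hab hD hy0') _; rewrite [X in _ * X]mulrC mulrA.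
- move=> t _; rewrite mulmxBr mulmxBl.
  move: (A e t *m y e t) (A e t *m y 0 t) (A 0 t *m y 0 t) (f e t) (f 0 t) => u v w p q.
  by apply/matrixP => i j; rewrite !mxE; ring.
- apply: (inWmxD hab (inWmxB hab ge g0)); apply: (inWmxM hab hAe).
  exact: (inWmxB hab (inWmx_pred hab hye) hy0').
Qed.

(** * Necessity of the three conditions *)

Section necessity.
Context (hc : cont_dep_at0 a b k.+1 eps0 A L).

(** Continuous dependence in terms of [isol]. Uniqueness compares two solutions with equal boundary
    values, the form in which it is applied to y - z(e) and Y(e) q. *)
Lemma cont_dep_isol : exists eps1, [/\ 0 < eps1, eps1 < eps0,
  forall e, 0 <= e < eps1 -> forall (f : V) c, inWmx k f -> exists y, isol (A e) f y /\ L e y = c,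
  forall e, 0 <= e < eps1 -> forall (f y z : V), inWmx k f -> isol (A e) f y -> isol (A e) f z ->
    L e y = L e z -> forall t, a <= t <= b -> y t = z t &
  forall (f y : R -> V) (c : R -> 'cV[R[i]]_m),
    (forall e, 0 <= e < eps1 -> [/\ inWmx k (f e), isol (A e) (f e) (y e) & L e (y e) = c e]) ->
    (fun e => Nmx k (fun t => f e t - f 0 t)) @ 0^'+ --> (0 : R) ->
    (fun e => mxn (c e - c 0)) @ 0^'+ --> (0 : R) ->
    (fun e => Nmx k.+1 (fun t => y e t - y 0 t)) @ 0^'+ --> (0 : R)].
Proof.
have [eps1 [/andP[e10 e1] [hex hcv]]] := hc.
have hlt e : 0 <= e < eps1 -> 0 <= e < eps0 by case/andP=> -> h /=; exact: lt_trans h e1.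
exists eps1; split=> //.
- move=> e he f c hf; have [|y [hy _]] := hex e he f c; first exact/inWvP.
  by exists y; apply/(is_solutionP hab (L e) _ _ (hA (hlt e he)) hf).
- move=> e he f y z hf sy sz Lyz t tab.
  have [|x [_ hu]] := hex e he f (L e z); first exact/inWvP.
  by rewrite (hu y)// ?(hu z)//; apply/(is_solutionP hab (L e) _ _ (hA (hlt e he)) hf).
move=> f y c hs cf cc.
have hs' e : 0 <= e < eps1 -> inWv a b k.+1.-1 (f e) /\
    is_solution a b k.+1 (A e) (L e) (f e) (c e) (y e).
  move=> he; have [hf sy Ly] := hs e he; split; first exact/inWvP.
  exact/(is_solutionP hab (L e) _ _ (hA (hlt e he)) hf).
have := hcv f c y hs'; rewrite /= => H.
rewrite (_ : (fun e => _) = fun e => Wnormv a b k.+1 (fun t => y e t - y 0 t)); last first.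
  by apply/funext => e; rewrite WnormvE.
apply: H.
  rewrite (_ : (fun e => _) = fun e => Nmx k (fun t => f e t - f 0 t)); first exact: cf.
  by apply/funext => e; rewrite WnormvE.
rewrite (_ : (fun e => _) = fun e => mxn (c e - c 0)); first exact: cc.
by apply/funext => e; rewrite cvnormE.
Qed.

Lemma necessary0 y : isol (A 0) (fun _ => 0) y -> L 0 y = 0 -> forall t, a <= t <= b -> y t = 0.
Proof.
move=> sy Ly; have [eps1 [e10 _ _ hu _]] := cont_dep_isol.
have he0 : 0 <= (0 : R) < eps1 by rewrite lexx.
apply: (hu 0 he0 _ _ _ h0k sy (isol0 hab k (A 0))).
by rewrite Ly (op0 hab (hL r00)).
Qed.

(* The columns of [Y e] solve the homogeneous equation with boundary values the
   canonical basis of C^m. *)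
Lemma boundary_basis : exists (eps1 : R) (Y : R -> R -> 'M[R[i]]_m) (Y0i : R -> 'M[R[i]]_m),
  [/\ 0 < eps1 < eps0,
  forall e, 0 <= e < eps1 -> [/\ inWmx k.+1 (Y e),
    forall t, a <= t <= b -> Y e t = Y e a + mprim (fun s => - (A e s *m Y e s)) t &
    opmx (L e) (Y e) = 1%:M],
  (fun e => Nmx k.+1 (fun t => Y e t - Y 0 t)) @ 0^'+ --> (0 : R),
  inWmx k.+1 Y0i & forall t, a <= t <= b -> Y 0 t *m Y0i t = 1%:M].
Proof.
have [eps1 [e10 e1 hex _ hcv]] := cont_dep_isol.
have he0 : 0 <= (0 : R) < eps1 by rewrite lexx.
have hlt e : 0 <= e < eps1 -> 0 <= e < eps0 by case/andP=> -> h /=; exact: lt_trans h e1.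
have /choice[y hy] : forall ej : R * 'I_m, exists y, 0 <= ej.1 < eps1 ->
    isol (A ej.1) (fun _ => 0) y /\ L ej.1 y = delta_mx ej.2 0.
  move=> [e j] /=; have [he|he] := pselect (0 <= e < eps1).
    by have [y hy] := hex e he (fun _ => 0) (delta_mx j 0) h0k; exists y.
  by exists (fun _ => 0).
pose Y e t := \matrix_(i, j) y (e, j) t i 0.
have Ycol e t j : col j (Y e t) = y (e, j) t.
  by apply/matrixP => i l; rewrite (ord1 l) !mxE.
have Yprop e : 0 <= e < eps1 -> [/\ inWmx k.+1 (Y e),
    forall t, a <= t <= b -> Y e t = Y e a + mprim (fun s => - (A e s *m Y e s)) t &
    opmx (L e) (Y e) = 1%:M].
  move=> he; split.
  - move=> i j; have [[h _] _] := hy (e, j) he.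
    by apply: (inW_ext _ (h i 0)) => t _; rewrite mxE.
  - move=> t tab; have /andP[_ tb] := tab; apply/matrixP => i j; rewrite !mxE.
    have [[_ /(_ t tab) h] _] := hy (e, j) he; rewrite {1}h !mxE; congr (_ + _).
    apply: (@cprim_ext _ _ b) => // s _; rewrite !mxE add0r; congr (- _).
    by apply: eq_bigr => l _; rewrite mxE.
  - apply/matrixP => i j; rewrite !mxE; have [_ h] := hy (e, j) he.
    rewrite (_ : (fun t => _) = y (e, j)); last by apply/funext => t; rewrite Ycol.
    by rewrite h mxE andbT.
have [hY0 Y0E Y01] := Yprop 0 he0.
have hA0 := hA r00; have hL0 := hL r00.
have [X [Z [hX hZ XE ZE XZ]]] := fundamental_matrix hab hA0.
have hAY q (U : R -> 'M[R[i]]_(m, q)) : inWmx k.+1 U -> inWmx k (fun s => - (A 0 s *m U s)).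
  by move=> hU; exact: (inWmxN hab (inWmxM hab hA0 (inWmx_pred hab hU))).
have rep q (U : R -> 'M[R[i]]_(m, q)) : inWmx k.+1 U ->
    (forall t, a <= t <= b -> U t = U a + mprim (fun s => - (A 0 s *m U s)) t) ->
    forall t, a <= t <= b -> U t = X t *m U a.
  move=> hU UE t tab; have /andP[_ tb] := tab.
  rewrite (cauchy_repr hab hA0 hZ XE ZE XZ (hAY _ _ hU) UE tab).
  rewrite (@mprim_ext _ a b _ _ _ (fun _ => 0) t)// ?mprim_cst0 ?addr0// => s _.
  by rewrite addNr mulmx0.
(* If Y(0)(a) q = 0, then Y(0) q = X Y(0)(a) q vanishes on [a, b], while its boundary value is q. *)
have Y0u : Y 0 a \in unitmx.
  apply: unitmx_of_inj => q hq.
  have [hYq YqE] := isol_mulmx hab q hA0 hY0 Y0E.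
  have Yq0 t : a <= t <= b -> Y 0 t *m q = 0.
    by move=> tab; rewrite (rep _ _ hY0 Y0E t tab) -mulmxA hq mulmx0.
  have := op_ext hab hL0 hYq h0S Yq0.
  by rewrite (opmxE hab q hL0 hY0) Y01 mul1mx (op0 hab hL0).
(* Y(0) = X Y(0)(a), and Z is the inverse of X. *)
exists eps1, Y, (fun t => invmx (Y 0 a) *m Z t); split=> //.
- by rewrite e10.
(* Continuous dependence is applied to each column, with data that do not vary with e. *)
- rewrite (_ : (fun e => _) = fun e => \sum_j Nmx k.+1 (fun t => y (e, j) t - y (0, j) t)).
    apply: cvg_right0_sum => j.
    apply: (hcv (fun _ _ => 0) (fun e => y (e, j)) (fun _ => delta_mx j 0)).
    + by move=> e he; have [? ?] := hy (e, j) he; split=> //; exact: h0k.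
    + rewrite (_ : (fun e => _) = fun _ => 0); first exact: cvg_cst.
      by apply/funext => e; exact: (Nmx_subrr hab k (fun _ => 0)).
    + rewrite (_ : (fun e => _) = fun _ => 0); first exact: cvg_cst.
      by apply/funext => e; rewrite subrr mxn0.
  apply/funext => e; rewrite Nmx_cols; apply: eq_bigr => j _; congr (Nmx k.+1 _).
  by apply/funext => t; rewrite linearB /= !Ycol.
- exact: (inWmxM hab (inWmx_cst hab k.+1 _) hZ).
move=> t tab; have [h _] := XZ t tab.
by rewrite (rep _ _ hY0 Y0E t tab) -mulmxA mulKVmx.
Qed.

(** With E = Y(e) - Y(0), one has (A(e) - A(0)) Y(0) = - E' - A(0) E - (A(e) - A(0)) E. Only Y(0)
    has to be inverted; the last term is absorbed once E is small, and the derivative accounts for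
    the drop from order k+1 to order k. *)
Lemma necessaryI : (fun e => Nmx k (fun t => A e t - A 0 t)) @ 0^'+ --> (0 : R).
Proof.
have [eps1 [Y [V0 [/andP[e10 e1] hY cY hV VE]]]] := boundary_basis.
have he0 : 0 <= (0 : R) < eps1 by rewrite lexx.
have hlt e : 0 <= e < eps1 -> 0 <= e < eps0 by case/andP=> -> h /=; exact: lt_trans h e1.
have hA0 := hA r00; have [hY0 Y0E _] := hY 0 he0.
have hVk := inWmx_pred hab hV.
have p3 : 0 <= 3 ^+ k :> R by rewrite exprn_ge0.
pose v := Nmx k V0; have v0 : 0 <= v := Nmx_ge0 hab _ _.
pose a0 := Nmx k (A 0); have a00 : 0 <= a0 := Nmx_ge0 hab _ _.
pose E e := Nmx k.+1 (fun t => Y e t - Y 0 t).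
(* [C2] belongs to the absorbed term, [C1] to the other two; the powers of 3 come from products in
   W^k. *)
pose C2 := 3 ^+ k * v * 3 ^+ k; have C20 : 0 <= C2 := mulr_ge0 (mulr_ge0 p3 v0) p3.
pose C1 := 3 ^+ k * v * (1 + 3 ^+ k * a0).
have C10 : 0 <= C1 := mulr_ge0 (mulr_ge0 p3 v0) (addr_ge0 ler01 (mulr_ge0 p3 a00)).
have h2 : 0 < 2^-1 :> R by rewrite invr_gt0.
have [r r0 hr] := cvg_right0_lt cY C20 h2.
have rm : 0 < Num.min r eps1 by rewrite lt_min r0.
apply: (cvg_right0_le (mulr_ge0 (ler0n R 2) C10) rm _ cY) => e /andP[e0].
rewrite lt_min => /andP[er ee1].
have he : 0 <= e < eps1 by rewrite ltW.
have hAe := hA (hlt e he); have [hYe YeE _] := hY e he.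
have hYek := inWmx_pred hab hYe; have hY0k := inWmx_pred hab hY0.
have hD := inWmxB hab hAe hA0; have hE := inWmxB hab hYe hY0; have hEk := inWmx_pred hab hE.
rewrite !ger0_norm ?(Nmx_ge0 hab)// -/(E e).
have := hr e; rewrite e0 er ger0_norm ?(Nmx_ge0 hab)// -/(E e) => /(_ isT)/ltW s2.
set d := Nmx k (fun t => A e t - A 0 t); have d0 : 0 <= d := Nmx_ge0 hab _ _.
have E0 : 0 <= E e := Nmx_ge0 hab _ _.
have hAYe := inWmxN hab (inWmxM hab hAe hYek); have hAY0 := inWmxN hab (inWmxM hab hA0 hY0k).
have hH : inWmx k (fun s => - (A e s *m Y e s) - - (A 0 s *m Y 0 s)) := inWmxB hab hAYe hAY0.
have nH : Nmx k (fun s => - (A e s *m Y e s) - - (A 0 s *m Y 0 s)) <= E e.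
  apply: (Nmx_deriv hab (C := Y e a - Y 0 a) hH) => t tab; have /andP[_ tb] := tab.
  by rewrite (mprimB hab hAYe hAY0 tb) {1}(YeE t tab) {1}(Y0E t tab) opprD addrACA.
have hAE := inWmxM hab hA0 hEk; have hDE := inWmxM hab hD hEk.
have nE : Nmx k (fun t => Y e t - Y 0 t) <= E e := Nmx_pred hab hE.
pose F t := - (- (A e t *m Y e t) - - (A 0 t *m Y 0 t)) - A 0 t *m (Y e t - Y 0 t)
   - (A e t - A 0 t) *m (Y e t - Y 0 t).
have hF : inWmx k F := inWmxB hab (inWmxB hab (inWmxN hab hH) hAE) hDE.
have FE t : F t = (A e t - A 0 t) *m Y 0 t.
  rewrite /F !mulmxBr !mulmxBl.
  move: (A e t *m Y e t) (A 0 t *m Y 0 t) (A 0 t *m Y e t) (A e t *m Y 0 t) => p q u w.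
  by apply/matrixP => i j; rewrite !mxE; ring.
have nF : Nmx k F <= E e + 3 ^+ k * (a0 * E e) + 3 ^+ k * (d * E e).
  apply: le_trans (NmxB hab (inWmxB hab (inWmxN hab hH) hAE) hDE) _; apply: lerD.
    apply: le_trans (NmxB hab (inWmxN hab hH) hAE) _; apply: lerD.
      exact: le_trans (NmxN hab hH) nH.
    by apply: le_trans (NmxM hab hA0 hEk) _; apply: ler_wpM2l => //; exact: ler_wpM2l.
  by apply: le_trans (NmxM hab hD hEk) _; apply: ler_wpM2l => //; exact: ler_wpM2l.
have nD : d <= 3 ^+ k * (Nmx k F * v).
  rewrite /d (Nmx_ext hab (G := fun t => F t *m V0 t))//; first exact: NmxM.
  by move=> t tab; rewrite FE -mulmxA VE// mulmx1.
have n1 := ler_wpM2l p3 (ler_wpM2r v0 nF).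
have n2 := ler_wpM2r d0 s2.
have n3 := le_trans nD n1.
have e3 : 3 ^+ k * ((E e + 3 ^+ k * (a0 * E e) + 3 ^+ k * (d * E e)) * v) =
  C1 * E e + C2 * E e * d by rewrite /C1 /C2; ring.
rewrite e3 in n3; rewrite -mulrA.
exact: le_absorb n3 n2.
Qed.

(** Condition (I) enters here: it makes the right-hand sides y' + A(e) y converge, so that
    continuous dependence applies to z(e). *)
Lemma necessaryII y : inWmx k.+1 y -> (fun e => mxn (L e y - L 0 y)) @ 0^'+ --> (0 : R).
Proof.
move=> hy; have hyk := inWmx_pred hab hy.
have [eps1 [Y [V0 [/andP[e10 e1] hY cY hV VE]]]] := boundary_basis.
have [eps2 [e20 e2 hex hu hcv]] := cont_dep_isol.
have he0 : 0 <= (0 : R) < eps2 by rewrite lexx.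
have hlt e : 0 <= e < eps2 -> 0 <= e < eps0 by case/andP=> -> h /=; exact: lt_trans h e2.
have hA0 := hA r00.
have [g [hg yE]] := inWmxS_ex hab hy.
pose f e t := g t + A e t *m y t.
have hf e : 0 <= e < eps2 -> inWmx k (f e).
  by move=> /hlt he; exact: (inWmxD hab hg (inWmxM hab (hA he) hyk)).
have sy e : 0 <= e < eps2 -> isol (A e) (f e) y.
  move=> he; split=> // t tab; have /andP[_ tb] := tab; rewrite {1}(yE t tab); congr (_ + _).
  by apply: (@mprim_ext _ a b) => // s _; rewrite /f addrK.
have /choice[z hz] : forall e, exists z, 0 <= e < eps2 -> isol (A e) (f e) z /\ L e z = L 0 y.
  move=> e; have [he|he] := pselect (0 <= e < eps2); last by exists (fun _ => 0).
  by have [z hz] := hex e he (f e) (L 0 y) (hf e he); exists z.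
have [sz0 Lz0] := hz 0 he0.
(* At e = 0 both z(0) and [y] solve the same problem, so the limit of z(e) is [y]. *)
have z0E := hu 0 he0 (f 0) (z 0) y (hf 0 he0) sz0 (sy 0 he0) Lz0.
have cz : (fun e => Nmx k.+1 (fun t => z e t - z 0 t)) @ 0^'+ --> (0 : R).
  apply: (hcv f z (fun _ => L 0 y)).
  - by move=> e he; have [? ?] := hz e he; split=> //; exact: hf.
  - have c0 : 0 <= 3 ^+ k * Nmx k y by rewrite mulr_ge0 ?exprn_ge0 ?(Nmx_ge0 hab).
    apply: (cvg_right0_le c0 e20 _ necessaryI) => e /andP[ee0 ee2].
    have he : 0 <= e < eps2 by rewrite ltW.
    rewrite !ger0_norm ?(Nmx_ge0 hab)//.
    have hD := inWmxB hab (hA (hlt e he)) hA0.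
    rewrite (Nmx_ext hab (G := fun t => (A e t - A 0 t) *m y t)).
    + by apply: le_trans (NmxM hab hD hyk) _; rewrite [X in _ * X]mulrC mulrA.
    + by move=> t _; rewrite /f opprD addrACA subrr add0r mulmxBl.
    + exact: (inWmxB hab (hf e he) (hf 0 he0)).
  - rewrite (_ : (fun e => _) = fun _ => 0); first exact: cvg_cst.
    by apply/funext => e; rewrite subrr mxn0.
have he01 : 0 <= (0 : R) < eps1 by rewrite lexx.
have [hY0 _ _] := hY 0 he01.
pose nu := mxn (V0 a); have nu0 : 0 <= nu := mxn_ge0 _.
pose c := 1 + 4 * (b - a); have c0 : 0 <= c by rewrite addr_ge0// mulr_ge0// subr_ge0 ltW.
have h2 : 0 < 2^-1 :> R by rewrite invr_gt0.
have [r r0 hr] := cvg_right0_lt cY (mulr_ge0 nu0 c0) h2.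
have rm : 0 < Num.min r (Num.min eps1 eps2) by rewrite !lt_min r0 e10.
apply: (cvg_right0_le (mulr_ge0 (ler0n R 2) (mulr_ge0 nu0 c0)) rm _ cz) => e /andP[ee0].
rewrite !lt_min => /andP[er /andP[ee1 ee2]].
have he1 : 0 <= e < eps1 by rewrite ltW.
have he2 : 0 <= e < eps2 by rewrite ltW.
have hAe := hA (hlt e he2); have hLe := hL (hlt e he2).
have [hYe YeE Ye1] := hY e he1; have [sze Lze] := hz e he2; have [hze _] := sze.
have [hz0 _] := sz0.
pose q := L e y - L 0 y.
have sd := isolB hab hAe (hf e he2) (hf e he2) (sy e he2) sze.
have ff0 : (fun t => f e t - f e t) = (fun _ => 0) by apply/funext => t; rewrite subrr.
rewrite ff0 in sd; have sq := isol_mulmx hab q hAe hYe YeE.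
have Leq : L e (fun t => y t - z e t) = L e (fun t => Y e t *m q).
  by rewrite (opB hab hLe hy hze) Lze (opmxE hab q hLe hYe) Ye1 mul1mx.
(* y - z(e) and Y(e) q solve the homogeneous equation with the same boundary value q; evaluation at
   [a] turns this into an equation for q. *)
have dE := hu e he2 _ _ _ h0k sd sq Leq a aab.
have := VE a aab => /mulmx1C V1.
(* Y(e)(a) is written as Y(0)(a) plus a small matrix and only Y(0)(a) is inverted, by V0(a); the
   term with Y(e) - Y(0) is then absorbed. *)
have qE : q = V0 a *m (- (z e a - z 0 a) - (Y e a - Y 0 a) *m q).
  rewrite (z0E a aab) opprB dE mulmxBl opprB addrCA subrr addr0 mulmxA V1 mul1mx//.
have n1 : mxn q <= nu * (c * Nmx k.+1 (fun t => z e t - z 0 t) +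
    c * Nmx k.+1 (fun t => Y e t - Y 0 t) * mxn q).
  rewrite {1}qE; apply: le_trans (mxnM _ _) _; apply: ler_wpM2l => //.
  apply: le_trans (mxnB _ _) _; rewrite mxnN; apply: lerD.
    exact: (Nmx_eval hab (inWmxB hab hze hz0) aab).
  apply: le_trans (mxnM _ _) _; apply: ler_wpM2r; first exact: mxn_ge0.
  exact: (Nmx_eval hab (inWmxB hab hYe hY0) aab).
have := hr e; rewrite ee0 er ger0_norm ?(Nmx_ge0 hab)// => /(_ isT)/ltW s2.
rewrite !ger0_norm ?(Nmx_ge0 hab) ?mxn_ge0// -/q.
have Q0 := mxn_ge0 q; have n2 := ler_wpM2r Q0 s2.
rewrite mulrDr !mulrA in n1; rewrite -mulrA.
exact: le_absorb n1 n2.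
Qed.

End necessity.

End equivalence.

Theorem theorem1 (R : realType) (a b : R) (hab : a < b) (m n : nat)
  (hm : (0 < m)%N) (hn : (0 < n)%N) (eps0 : R) (heps0 : 0 < eps0)
  (A : R -> R -> 'M[R[i]]_m)
  (L : R -> (R -> 'cV[R[i]]_m) -> 'cV[R[i]]_m)
  (hA : forall e, 0 <= e < eps0 -> inWm a b n.-1 (A e))
  (hL : forall e, 0 <= e < eps0 -> bounded_linear_W a b n (L e)) :
  cont_dep_at0 a b n eps0 A L <->
  [/\ (* (0) *)
      (forall y, is_solution a b n (A 0) (L 0) (fun _ => 0) 0 y ->
         forall t, a <= t <= b -> y t = 0),
      (* (I) *)
      (fun e => Wnormm a b n.-1 (fun t => A e t - A 0 t)) @ 0^'+ --> (0 : R)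
    & (* (II) *)
      (forall y, inWv a b n y ->
         (fun e => cvnorm (L e y - L 0 y)) @ 0^'+ --> (0 : R)) ].
Proof.
case: n hn hA hL => [//|k] _ /= hA hL.
have hA0 : inWmx a b k (A 0) by apply: hA; rewrite lexx.
have h0 : inWmx a b k (fun _ : R => 0 : 'cV[R[i]]_m) := inWmx_cst hab k _.
have cE y : (fun e => cvnorm (L e y - L 0 y)) = (fun e => mxn (L e y - L 0 y)).
  by apply/funext => e; rewrite cvnormE.
split=> [hc|[H0 HI HII]].
  split.
  - move=> y /(is_solutionP hab (L 0) _ _ hA0 h0)[sy Ly].
    exact: (necessary0 hab heps0 hA hL hc sy Ly).
  - exact: (necessaryI hab heps0 hA hL hc).
  - move=> y /inWvP hy; rewrite cE; exact: (necessaryII hab heps0 hA hL hc hy).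
apply: (sufficient hab heps0 hA hL).
- by move=> y sy Ly; apply: H0; apply/(is_solutionP hab (L 0) _ _ hA0 h0).
- exact: HI.
- by move=> y /inWvP hy; rewrite -cE; exact: HII.
Qed.
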